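(* Let $L>0$, let $\beta=(\beta_j)_{j\in\mathbb Z}$ be a strictly positive symmetric sequence with $\beta_0=1$ and $(\beta_n)_{n\in\mathbb N_0}$ non-decreasing, and let $$\mathcal F(\beta,L)=\Big\{f=\sum_{j\in\mathbb Z}f_j\mathbf e_j:\ f\ge0\ \text{ and }\ \sum_{j\in\mathbb Z}f_j^2\beta_j^2\le L^2\Big\},\qquad \mathbf e_j(\omega)=\exp(-\mathrm ij\omega),$$ be the class of potential spectral densities. Assume that the stationary time series $X=(X_t)_{t\in\mathbb Z}$ is Gaussian with spectral density $f$, and that the anonymized data $Z_{1:n}=(Z_1,\ldots,Z_n)$ are generated from $X_{1:n}=(X_1,\ldots,X_n)$ via a (potentially interactive) channel $Q$ ensuring local $\alpha$-differential privacy. (a) Assume that $B:=\sum_{j\in\mathbb Z}\beta_j^{-2}<\infty$. Define $$k_n^\ast=\operatorname*{argmin}_{k\in\mathbb N}\Big[\max\Big(\beta_k^{-2},\frac{2k+1}n\Big)\Big],\qquad\Psi_n=\max\Big(\beta_{k_n^\ast}^{-2},\frac{2k_n^\ast+1}n\Big),$$ and assume that there is a positive constant $\eta$ such that $$0<\eta^{-1}\le\Psi_n^{-1}\min\Big\{\beta_{k_n^\ast}^{-2},\frac{2k_n^\ast+1}n\Big\}.$$ Then $$\inf_{\widetilde f}\sup_{f\in\mathcal F(\beta,L)}\mathbf E\|\widetilde f-f\|^2\gtrsim\frac{2k_n^\ast+1}n,$$ where the infimum is taken over all estimators $\widetilde f$ of $f$ based on the privatized sample $Z_{1:n}$. (b)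 It holds that $$\inf_{\widetilde f}\sup_{f\in\mathcal F(\beta,L)}\mathbf E\|\widetilde f-f\|^2\gtrsim\min\Big\{\frac{\pi}{n(e^\alpha-1)^2},\frac{L^2}4\Big\},$$ where the infimum is taken over all estimators $\widetilde f$ of $f$ based on the privatized sample $Z_{1:n}$.
   Context: The spectral density of a stationary series with absolutely summable autocovariances $\gamma_k=\operatorname{Cov}(X_t,X_{t+k})$ is $f(\omega)=\frac1{2\pi}\sum_{k\in\mathbb Z}\gamma_ke^{-\mathrm i\omega k}$, $\omega\in[-\pi,\pi]$. $\|\cdot\|$ is the usual $L^2$-norm. $\mathbf E$ is the expectation when the time series has spectral density $f$. $a_n\gtrsim b_n$ means $b_n\le C\,a_n$ for some purely numerical constant $C$ and all sufficiently large $n$. Local $\alpha$-differential privacy ($\alpha>0$): given $X_i=x_i$ and $Z_j=z_j$ for $j<i$, the output $Z_i$ is drawn from $Q_i(\cdot\mid X_i=x_i,Z_1=z_1,\ldots,Z_{i-1}=z_{i-1})$ with Markov kernels $Q_i$ satisfying $$\sup_A\frac{Q_i(A\mid X_i=x,Z_1=z_1,\ldots,Z_{i-1}=z_{i-1})}{Q_i(A\mid X_i=x',Z_1=z_1,\ldots,Z_{i-1}=z_{i-1})}\le e^\alpha$$ for all $x,x'$ and all $z_1,\ldots,z_{i-1}$, the supremum being over measurable sets $A$.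
   Formalization: In (a) the constant hidden in ≳ may depend on L (and on nothing else): with a purely numerical constant the claim fails as L tends to 0, since the risk scales like L² while k_n* does not depend on L. *)

(* Defs.v *)
From HB Require Import structures.
From mathcomp Require Import all_boot all_order all_algebra.
From mathcomp Require Import complex.
From mathcomp Require Import all_classical all_reals all_analysis.
Import Order.TTheory GRing.Theory Num.Theory.
Import numFieldNormedType.Exports.

Set Implicit Arguments.
Unset Strict Implicit.
Unset Printing Implicit Defensive.

Local Open Scope classical_set_scope.
Local Open Scope ring_scope.

Section SpectralClass.
Variable R : realType.
Implicit Types (f : R -> R) (c beta : int -> R).

Definition frequencies : set R := `[- pi, pi].

(* exp (- i j w) *)
Definition fourier_basis (j : int) (w : R) : R[i] :=
  Complex (cos (j%:~R * w)) (- sin (j%:~R * w)).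

(* Sum over the integers j with - m <= j <= m. *)
Definition fourier_partial_sum c (m : nat) (w : R) : R[i] :=
  \sum_(i < m.*2.+1)
    Complex (c (i%:Z - m%:Z)) 0 * fourier_basis (i%:Z - m%:Z) w.

(* f = \sum_j c_j e_j, the series converging in L^2([-pi, pi]). *)
Definition fourier_series f c : Prop :=
  measurable_fun frequencies f /\
  ((fun m => \int[lebesgue_measure]_(w in frequencies)
      (Normc.normc (Complex (f w) 0 - fourier_partial_sum c m w) ^+ 2)%:E)
    @ \oo --> 0)%E.

Definition weight_sequence beta : Prop :=
  [/\ forall j, 0 < beta j,
      forall j, beta (- j) = beta j,
      beta 0 = 1 &
      forall m n : nat, (m <= n)%N -> beta m%:Z <= beta n%:Z].

(* The coefficients are real because the spectral densities of the class are
   those of real-valued series. *)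
Definition spectral_class beta (L : R) : set (R -> R) :=
  [set f | (forall w, frequencies w -> 0 <= f w) /\
     exists c, fourier_series f c /\
       (\esum_(j in [set: int]) (c j ^+ 2 * beta j ^+ 2)%:E <= (L ^+ 2)%:E)%E].

Definition approx_sq beta (k : nat) : R := (beta k%:Z) ^- 2.

Definition dim_ratio (n k : nat) : R := (2 * k + 1)%:R / n%:R.

Definition tradeoff beta (n k : nat) : R :=
  Num.max (approx_sq beta k) (dim_ratio n k).

(* k minimizes the tradeoff over the positive integers; the minimizer need not
   be unique. *)
Definition is_argmin_tradeoff beta (n k : nat) : Prop :=
  (0 < k)%N /\
  forall l : nat, (0 < l)%N -> tradeoff beta n k <= tradeoff beta n l.

End SpectralClass.

Section GaussianSeries.
Context {R : realType} {d : measure_display} {Om : measurableType d}.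
Implicit Types (P : probability Om R) (X : int -> {mfun Om >-> R}).

(* normal_prob m 0 is a junk value in the library, so the degenerate normal
   law is given separately. *)
Definition normal_law (m s : R) (A : set R) : \bar R :=
  if s == 0 then dirac m A else normal_prob m s A.

Definition gaussian_process P X : Prop :=
  forall (ts : seq int) (a : int -> R), exists m s : R, 0 <= s /\
    forall A : set R, measurable A ->
      P ((fun w => \sum_(t <- ts) a t * X t w) @^-1` A) = normal_law m s A.

(* The spectral density f satisfies f = \sum_k (gamma_k / (2 pi)) e_k. *)
Definition stationary_gaussian P X (mu : R) (f : R -> R) : Prop :=
  [/\ gaussian_process P X,
      forall t, ('E_P[X t] = mu%:E)%E &
      exists gamma : int -> R,
        (forall t k, covariance P (X t) (X (t + k)) = (gamma k)%:E) /\
        fourier_series f (fun k => gamma k / (2 * pi))].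

End GaussianSeries.

Section Privacy.
Context {R : realType} {dZ : measure_display} {ZT : measurableType dZ}.
Variable n : nat.

(* The index i : 'I_n stands for the time i + 1; the kernel Q_i takes the
   current observation and the i outputs released before. *)
Definition channel : Type :=
  forall i : 'I_n, R.-pker (R * i.-tuple ZT)%type ~> ZT.

(* The ratio bound in product form, which avoids 0 / 0. *)
Definition locally_private (alpha : R) (Q : channel) : Prop :=
  forall (i : 'I_n) (x x' : R) (z : i.-tuple ZT) (A : set ZT), measurable A ->
    (Q i (x, z) A <= (expR alpha)%:E * Q i (x', z) A)%E.

Context {d : measure_display} {Om : measurableType d}.
Implicit Types (P : probability Om R) (X : int -> {mfun Om >-> R})
  (Z : 'I_n -> {mfun Om >-> ZT}).

Definition sample X (w : Om) : n.-tuple R := [tuple X i.+1%:Z w | i < n].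

Definition outputs Z (w : Om) : n.-tuple ZT := [tuple Z i w | i < n].

Definition history Z (i : 'I_n) (w : Om) : i.-tuple ZT :=
  [tuple Z (widen_ord (ltnW (ltn_ord i)) j) w | j < i].

(* The conditional law of Z_i given X_{1:n} and Z_{1:i-1} is
   Q_i(. | X_i, Z_{1:i-1}). *)
Definition privatized P X Z (Q : channel) : Prop :=
  forall (i : 'I_n) (A : set ZT) (B : set (n.-tuple R * i.-tuple ZT)),
    measurable A -> measurable B ->
    let past := [set w | B (sample X w, history Z i w)] in
    P (Z i @^-1` A `&` past) =
    (\int[P]_(w in past) Q i (X i.+1%:Z w, history Z i w) A)%E.

(* P f is the law of the experiment when the spectral density is f; the mean
   mu of the series does not depend on f. *)
Definition private_experiment (F : set (R -> R)) (mu : R) (Q : channel)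
    (P : (R -> R) -> probability Om R) X Z : Prop :=
  forall f, F f ->
    stationary_gaussian (P f) X mu f /\ privatized (P f) X Z Q.

(* A jointly measurable function of the outputs and of the frequency. *)
Definition estimator : Type := {mfun (n.-tuple ZT * R)%type >-> R}.

Definition L2_risk P Z (g : estimator) (f : R -> R) : \bar R :=
  (\int[P]_w \int[lebesgue_measure]_(u in @frequencies R)
     ((g (outputs Z w, u) - f u) ^+ 2)%:E)%E.

Definition minimax_risk (F : set (R -> R))
    (P : (R -> R) -> probability Om R) Z : \bar R :=
  ereal_inf [set ereal_sup [set L2_risk (P f) Z g f | f in F]
            | g in [set: estimator]].

End Privacy.
Arguments channel R {dZ} ZT n.

(* Main.v *)
Require Import Defs.
From HB Require Import structures.
From mathcomp Require Import all_boot all_order all_algebra.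
From mathcomp Require Import complex ring lra zify.
From mathcomp Require Import all_classical all_reals all_analysis.
From mathcomp Require Import measurable_realfun simple_functions.
Import Order.TTheory GRing.Theory Num.Theory.
Import numFieldNormedType.Exports.

Set Implicit Arguments.
Unset Strict Implicit.
Unset Printing Implicit Defensive.

Local Open Scope classical_set_scope.
Local Open Scope ring_scope.

(** Both bounds follow from one estimate, [minimax_lower_bound]: if K <= n,
    K^2 <= 16 n and K beta_K^2 <= n, then the minimax risk is at least
    L^2 K / (1536 n). It is an instance of Assouad's method.

    The alternatives are the 2^K densities with constant Fourier coefficient
    L / 2 and with coefficients r or 0 at the frequencies 1, ..., K, where
    r = L / (32 sqrt n). They lie in the ellipsoid and stay above L / 4
    ([cube_density_in_class], [cube_density_ge]). An estimator yields a guess of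
    every bit by thresholding its Fourier coefficients, and by Bessel's inequality
    each wrong guess costs pi r^2 in squared L2 distance ([detection_loss]). If
    two densities that differ in one bit cannot be tested with small errors, some
    density has at least K / 3 wrong guesses on average ([assouad_minimax]).

    Testing is controlled in two steps. Since each output is drawn by a kernel
    that is the same under all densities, a test based on the outputs is a
    randomized test based on the sample itself ([data_processing]). For the
    sample, the covariance matrix belonging to a cosine polynomial of degree K
    embeds exactly in a circulant matrix of size N >= n + K: the sample has the
    law of a sum of 2N independent scalar normal variables times fixed cosine and
    sine waves, with variances 2 pi f / N at the N grid frequencies
    ([latent_variance], [sample_law]). Two densities thus give Gaussian laws with
    the same directions, and the second moment of their likelihood ratio is a
    product of explicit one-dimensional factors ([chi_square_normal],
    [gaussian_testing]); one flipped bit moves every variance by a relative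
    amount of order 1 / sqrt n, which keeps this product at most 4 / 3. The
    representation of the sample is an identity of characteristic functions, and
    these determine the law ([cramer_wold]), which is proved by approximating
    indicators of half-lines by polynomials in sines.

    For part (a) take K = k*_n - 1. Minimality of k*_n forces
    (2 k*_n + 1) / n <= beta_K^-2 ([argmin_approx_ge]), hence K beta_K^2 <= n.
    Summability of beta^-2 gives beta_K^-2 = O(1 / K) ([approx_sq_decay]), hence
    K^2 = O(n), and makes k*_n tend to infinity ([argmin_tends_to_oo]), so that K
    and 2 k*_n + 1 are comparable. For part (b) a constant K suffices: the
    estimate L^2 K / (1536 n) exceeds pi / (n (exp alpha - 1)^2) for K large. *)

(** * Integration against a density *)

Section density.
Context d (T : measurableType d) (R : realType).
Variables (mu nu : {measure set T -> \bar R}) (p : T -> R).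
Hypothesis mp : measurable_fun [set: T] p.
Hypothesis p_ge0 : forall x, 0 <= p x.
Hypothesis nuE : forall A, measurable A -> nu A = (\int[mu]_(x in A) (p x)%:E)%E.
Local Open Scope ereal_scope.
Import HBNNSimple.

(** The formula holds for simple functions because nu has density p, and passes
    to the limit along an increasing sequence of simple functions. *)
Lemma ge0_integral_density (f : T -> \bar R) : measurable_fun [set: T] f ->
  (forall x, 0 <= f x) -> \int[nu]_x f x = \int[mu]_x (f x * (p x)%:E).
Proof.
move=> mf f0.
pose g := nnsfun_approx measurableT mf.
have gf x : (g n x)%:E @[n --> \oo] --> f x.
  by apply: cvg_nnsfun_approx.
have ndg x : {homo (fun n => (g n x)%:E) : m n / (m <= n)%N >-> m <= n}.
  move=> m n mn; rewrite lee_fin.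
  by have /lefP := nd_nnsfun_approx measurableT mf mn.
have pE0 x : 0 <= (p x)%:E by rewrite lee_fin.
transitivity (limn (fun n => \int[nu]_x (g n x)%:E)).
  rewrite -monotone_convergence//.
  - by apply: eq_integral => x _; apply/esym/cvg_lim.
  - by move=> n; apply/measurable_EFinP.
  - by move=> n x _; rewrite lee_fin.
transitivity (limn (fun n => \int[mu]_x ((g n x)%:E * (p x)%:E))); last first.
  rewrite -monotone_convergence//.
  - apply: eq_integral => x _; apply/cvg_lim => //.
    apply: cvgeZr => //; exact: gf.
  - by move=> n; apply: emeasurable_funM; apply/measurable_EFinP.
  - by move=> n x _; rewrite mule_ge0// lee_fin.
  - by move=> x _ m n mn; rewrite lee_wpmul2r// ndg.
congr (limn _); apply/funext => n.
rewrite [LHS](_ : _ = \int[nu]_x \sum_(r \in range (g n))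
   (r * \1_(g n @^-1` [set r]) x)%:E); last first.
  by apply: eq_integral => x _; rewrite fsumEFin//; congr EFin; rewrite {1}(fimfunE (g n)).
rewrite ge0_integral_fsum//; last 2 first.
- by move=> r; exact/measurable_EFinP/measurableT_comp.
- by move=> r x _; exact: nnfun_muleindic_ge0.
transitivity (\int[mu]_x \sum_(r \in range (g n))
   ((r * \1_(g n @^-1` [set r]) x)%:E * (p x)%:E)); last first.
  apply: eq_integral => x _; rewrite -ge0_mule_fsuml.
    by rewrite fsumEFin//; congr (_ * _); congr EFin; rewrite {1}(fimfunE (g n)).
  by move=> r; exact: nnfun_muleindic_ge0.
rewrite ge0_integral_fsum//; last 2 first.
- move=> r; apply: emeasurable_funM; last exact/measurable_EFinP.
  by exact/measurable_EFinP/measurableT_comp.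
- by move=> r x _; apply: mule_ge0 => //; exact: nnfun_muleindic_ge0.
apply: eq_fsbigr => r /set_mem[x _ gxr].
have r0 : (0 <= r)%R by rewrite -gxr.
under eq_integral do rewrite EFinM.
under [in RHS]eq_integral do rewrite EFinM -muleA.
rewrite ge0_integralZl//; last exact/measurable_EFinP.
rewrite ge0_integralZl//; last 2 first.
- by apply: emeasurable_funM; apply/measurable_EFinP.
- by move=> y _; rewrite mule_ge0// lee_fin.
congr (_ * _); rewrite integral_indic// setIT nuE//.
rewrite [LHS]integral_mkcond; apply: eq_integral => y _.
rewrite patchE indicE; case: ifPn => yg; rewrite ?mul1e ?mul0e//.
Qed.

Lemma integral_density (f : T -> \bar R) : measurable_fun [set: T] f ->
  \int[nu]_x f x = \int[mu]_x (f x * (p x)%:E).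
Proof.
move=> mf; rewrite [LHS]integralE [RHS]integralE.
have pE0 x : 0 <= (p x)%:E by rewrite lee_fin.
congr (_ - _).
- rewrite ge0_integral_density//; last exact: measurable_funepos.
  by apply: eq_integral => x _; rewrite !funeposE maxe_pMl// mul0e.
- rewrite ge0_integral_density//; last exact: measurable_funeneg.
  by apply: eq_integral => x _; rewrite !funenegE -mulNe maxe_pMl// mul0e.
Qed.
End density.

(** * Moments and characteristic function of the normal law *)

Section integral_derivative.
Context {R : realType}.
Local Notation mu := (@lebesgue_measure R).

(** The fundamental theorem of calculus on [- n, n], with n tending to infinity by
    dominated convergence. Every Gaussian moment identity below is an instance. *)
Lemma integral_derivative_eq0 (G g : R -> R) :
  (forall x : R, is_derive x 1 G (g x)) -> continuous g ->
  mu.-integrable [set: R] (EFin \o g) ->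
  (fun n : nat => G n%:R) @ \oo --> 0 ->
  (fun n : nat => G (- n%:R)) @ \oo --> 0 ->
  (\int[mu]_x (g x)%:E = 0)%E.
Proof.
move=> dG cg ig G1 G2.
have mg : measurable_fun [set: R] g by exact: continuous_measurable_fun.
pose I n := `[(- n%:R : R), n%:R]%classic.
have FTC n : (0 < n)%N ->
    (\int[mu]_(x in I n) (g x)%:E = (G n%:R - G (- n%:R))%:E)%E.
  move=> n0; have n0' : (0 : R) < n%:R by rewrite ltr0n.
  rewrite (@continuous_FTC2 _ _ G) ?EFinB//.
  - by rewrite (lt_trans _ n0')// oppr_lt0.
  - by apply: continuous_subspaceT.
  - have cG : continuous G.
      by move=> x; apply: differentiable_continuous; apply/derivable1_diffP.
    split.
    + by move=> x _.
    + apply: cvg_at_right_filter; exact: cG.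
    + apply: cvg_at_left_filter; exact: cG.
  - by move=> x _; rewrite derive1E; apply: derive_val.
have mgI n : measurable_fun [set: R] (g \_ (I n)).
  have mI : measurable (I n) by exact: measurable_itv.
  apply: (measurable_restrictT g mI).1; exact: measurable_funTS.
have H1 : forall x : R, setT x -> (EFin \o (g \_ (I n))) x @[n --> \oo] --> (EFin \o g) x.
  move=> x _; apply: cvg_near_cst.
  near=> n; rewrite /= patchE ifT// inE /I /= in_itv /= -ler_norml.
  near: n; exact: nbhs_infty_ger.
have := @dominated_cvg _ _ _ mu setT measurableT
  (fun n => EFin \o (g \_ (I n))) (EFin \o g) (fun x => `|(g x)%:E|%E) _ H1.
have -> : (fun n : nat => \int[mu]_x (EFin \o g \_ (I n)) x)%E =
          (fun n => \int[mu]_(x in I n) (g x)%:E)%E.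
  apply/funext => n; rewrite [RHS]integral_mkcond; apply: eq_integral => x _.
  by rewrite /= !patchE; case: ifPn.
move=> cvg1.
have {}cvg1 : (\int[mu]_(x in I n) (g x)%:E)%E @[n --> \oo] --> (\int[mu]_x (g x)%:E)%E.
  apply: cvg1 => [||| n x _].
  - by move=> n; apply/measurable_EFinP; exact: mgI.
  - by [].
  - exact: (integrable_abse ig).
  - rewrite /= patchE; case: ifPn => // _.
    by rewrite normr0 lee_fin.
have cvg2 : (\int[mu]_(x in I n) (g x)%:E)%E @[n --> \oo] --> (0%:E : \bar R).
  have : (G n%:R - G (- n%:R))%:E @[n --> \oo] --> (0%:E : \bar R).
    by apply: cvg_EFin; [exact: nearW | rewrite -[0]subr0; apply: cvgB].
  apply: cvg_trans; apply: near_eq_cvg; near=> n; rewrite FTC//.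
  by near: n; exact: nbhs_infty_gt.
exact: cvg_unique cvg1 cvg2.
Unshelve. all: end_near. Qed.
End integral_derivative.

Section normal_moments.
Context {R : realType}.
Local Notation mu := (@lebesgue_measure R).
Variables (m s : R).
Hypothesis s0 : s != 0.
Let phi := normal_pdf m s.

Let s2_gt0 : 0 < s ^+ 2.
Proof. by rewrite exprn_even_gt0. Qed.

Let phiE x : phi x = normal_peak s * expR (- (x - m) ^+ 2 / (s ^+ 2 *+ 2)).
Proof. by rewrite /phi normal_pdfE. Qed.

Let cphi : continuous phi.
Proof. exact: continuous_normal_pdf. Qed.

Lemma is_derive_normal_pdf (x : R) : is_derive x 1 (normal_pdf m s)
  (- ((x - m) / s ^+ 2) * normal_pdf m s x).
Proof.
rewrite -[normal_pdf m s x]/(phi x) phiE.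
have -> : normal_pdf m s = (fun z => normal_peak s * z) \o (expR \o
    (fun x => (- ((s ^+ 2 *+ 2)^-1)) * ((x - m) ^+ 2))).
  apply/funext => z; rewrite -[LHS]/(phi z) phiE /=; congr (_ * expR _).
  by rewrite !mulNr mulrC.
apply: is_derive_eq.
rewrite /GRing.scale /=.
have -> : - (s ^+ 2 *+ 2)^-1 * (x - m) ^+ 2 = - (x - m) ^+ 2 / (s ^+ 2 *+ 2).
  by rewrite !mulNr mulrC.
by field; rewrite s0.
Qed.

(** Completing the square: an exponential tilt of the density is a translate of it
    up to a constant, which gives the exponential moments. *)
Lemma normal_pdf_tilt t x :
  normal_pdf m s x * expR (t * (x - m)) =
  expR (t ^+ 2 * s ^+ 2 / 2) * normal_pdf (m + t * s ^+ 2) s x.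
Proof.
have -> : normal_pdf (m + t * s ^+ 2) s x =
    normal_peak s * expR (- (x - (m + t * s ^+ 2)) ^+ 2 / (s ^+ 2 *+ 2)).
  by rewrite normal_pdfE.
rewrite -[normal_pdf m s x]/(phi x) phiE.
rewrite -[LHS]mulrA -expRD [RHS]mulrCA -expRD.
by congr (_ * expR _); field; rewrite s0.
Qed.

Lemma integrable_normal_pdf_sqr :
  mu.-integrable setT (fun x => ((x - m) ^+ 2 * normal_pdf m s x)%:E).
Proof.
have I t : mu.-integrable setT (fun x => (normal_pdf m s x * expR (t * (x - m)))%:E).
  under eq_fun do rewrite normal_pdf_tilt EFinM.
  apply: integrableZl => //; exact: integrable_normal_pdf.
apply: (@le_integrable _ _ _ mu setT measurableT _
(* The square is dominated by 2 exp |x - m|, hence by the two tilts t = 1, -1.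
   *)
  (fun x => (2%:E * ((normal_pdf m s x * expR (1 * (x - m)))%:E +
             (normal_pdf m s x * expR ((-1) * (x - m)))%:E))%E)) => //.
- apply/measurable_EFinP; apply: measurable_funM; last exact: measurable_normal_pdf.
  by apply: measurable_funX; apply: measurable_funB.
- move=> x _; rewrite -EFinD -EFinM !abse_EFin lee_fin.
  have p0 : 0 <= normal_pdf m s x by exact: normal_pdf_ge0.
  rewrite -mulrDr mul1r mulN1r (mulrC (_ ^+ 2)) (mulrCA 2) (normrM (normal_pdf _ _ _)) (normrM (normal_pdf _ _ _) (2 * _)) ler_wpM2l//.
  rewrite (ger0_norm (sqr_ge0 _)) ger0_norm ?mulr_ge0 ?addr_ge0 ?expR_ge0//.
  have := expR_ge1Dxn 1 (normr_ge0 (x - m)).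
  rewrite real_normK ?num_real// => h.
  have {}h : (x - m) ^+ 2 <= 2 * expR `|x - m|.
    rewrite -ler_pdivrMl// mulrC; apply: le_trans h.
    by rewrite (_ : 2`! = 2)%N// lerDr.
  apply: (le_trans h); rewrite ler_wpM2l//.
  by case: (ger0P (x - m)) => _; rewrite ?lerDl ?lerDr expR_ge0.
- by apply: integrableZl => //; apply: integrableD.
Qed.

Lemma integrable_normal_pdf_lin :
  mu.-integrable setT (fun x => ((x - m) * normal_pdf m s x)%:E).
Proof.
apply: (@le_integrable _ _ _ mu setT measurableT _
  (fun x => ((normal_pdf m s x)%:E + ((x - m) ^+ 2 * normal_pdf m s x)%:E)%E)) => //.
- apply/measurable_EFinP; apply: measurable_funM; last exact: measurable_normal_pdf.
  by apply: measurable_funB.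
- move=> x _; rewrite -EFinD !abse_EFin lee_fin -{2}[normal_pdf m s x]mul1r -mulrDl !normrM.
  rewrite ler_wpM2r// [X in _ <= X]ger0_norm ?addr_ge0 ?sqr_ge0//.
  rewrite -(real_normK (num_real (x - m))); have := normr_ge0 (x - m); nra.
- by apply: integrableD => //; [exact: integrable_normal_pdf|exact: integrable_normal_pdf_sqr].
Qed.

(** The crude bound exp (- u) <= 1 / u suffices: it leaves decay of order 1 / |x|
    after multiplication by 1 + |x - m|, the growth of the primitives used below. *)
Lemma normal_pdf_decay x : `|m| + 1 <= `|x| ->
  (1 + `|x - m|) * normal_pdf m s x <= 4 * s ^+ 2 * normal_peak s / (`|x| - `|m|).
Proof.
move=> mx; have xm : `|x| - `|m| <= `|x - m| by exact: lerB_dist.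
have y1 : 1 <= `|x - m| by apply: le_trans xm; rewrite lerBrDl.
set y := `|x - m| in xm y1 *.
rewrite ler_pdivlMr; last by rewrite subr_gt0 (lt_le_trans _ mx)// ltrDl.
rewrite -[normal_pdf m s x]/(phi x) phiE.
have -> : - (x - m) ^+ 2 = - y ^+ 2 by rewrite /y real_normK ?num_real.
have yy : 0 < y by apply: lt_le_trans y1.
have h : expR (- y ^+ 2 / (s ^+ 2 *+ 2)) <= 2 * s ^+ 2 / y ^+ 2.
  have u0 : 0 < y ^+ 2 / (s ^+ 2 *+ 2) by rewrite divr_gt0 ?pmulrn_lgt0// exprn_gt0.
  rewrite mulNr expRN -[X in _ <= X]invrK lef_pV2 ?posrE ?expR_gt0 ?invr_gt0//.
    rewrite invf_div; apply: (le_trans _ (expR_ge1Dx _)).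
    by rewrite -(mulr_natl (s ^+ 2) 2) lerDr.
  by apply: divr_gt0; [rewrite mulr_gt0|rewrite exprn_gt0].
have p0 := normal_peak_ge0 s.
have : (1 + y) * (`|x| - `|m|) * expR (- y ^+ 2 / (s ^+ 2 *+ 2)) <= 4 * s ^+ 2.
  apply: (@le_trans _ _ ((2 * y ^+ 2) * expR (- y ^+ 2 / (s ^+ 2 *+ 2)))).
    rewrite ler_wpM2r ?expR_ge0//; nra.
  apply: (@le_trans _ _ ((2 * y ^+ 2) * (2 * s ^+ 2 / y ^+ 2))).
    by rewrite ler_wpM2l// mulr_ge0// sqr_ge0.
  by rewrite le_eqVlt; apply/orP; left; apply/eqP; field; rewrite gt_eqF.
move=> /(ler_wpM2r p0); apply: le_trans; rewrite le_eqVlt; apply/orP; left; apply/eqP; ring.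
Qed.

Lemma cvg_normal_pdf_decay (G : R -> R) (K : R) (e : R) : `|e| = 1 ->
  (forall x, `|G x| <= K * ((1 + `|x - m|) * normal_pdf m s x)) ->
  (fun n : nat => G (e * n%:R)) @ \oo --> 0.
Proof.
move=> e1 GK; apply/cvgr0Pnorm_le => eps eps0.
have en n : `|e * n%:R| = n%:R by rewrite normrM e1 mul1r normr_nat.
have p0 := normal_peak_ge0 s.
set D := `|K| * (4 * s ^+ 2 * normal_peak s).
have D0 : 0 <= D.
  by apply: mulr_ge0 => //; apply: mulr_ge0 => //; apply: mulr_ge0 => //; exact: sqr_ge0.
near=> n.
have n1 : `|m| + 1 + D / eps <= n%:R by near: n; exact: nbhs_infty_ger.
have De : 0 <= D / eps by rewrite divr_ge0// ltW.
apply: (le_trans (GK _)).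
apply: (le_trans (ler_wpM2r _ (ler_norm K))).
  by rewrite mulr_ge0 ?addr_ge0 ?normal_pdf_ge0.
apply: (le_trans (ler_wpM2l _ (normal_pdf_decay _))) => //.
  by rewrite en; apply: le_trans n1; rewrite lerDl.
rewrite en mulrA -/D ler_pdivrMr.
  by rewrite mulrC -ler_pdivrMr// lerBrDl (le_trans _ n1)// lerD2r lerDl.
by rewrite subr_gt0 (lt_le_trans _ n1)// -addrA ltrDl ltr_wpDr.
Unshelve. all: end_near. Qed.

(** The form in which integration by parts against the normal density is used: the
    primitive G is a function of at most linear growth times the density. *)
Lemma integral_normal_pdf_deriv (G g : R -> R) (K : R) :
  (forall x : R, is_derive x 1 G (g x)) -> continuous g ->
  mu.-integrable [set: R] (EFin \o g) ->
  (forall x, `|G x| <= K * ((1 + `|x - m|) * normal_pdf m s x)) ->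
  (\int[mu]_x (g x)%:E = 0)%E.
Proof.
move=> dG cg ig GK; apply: (integral_derivative_eq0 dG cg ig).
  have := @cvg_normal_pdf_decay G K 1 (normr1 _) GK.
  by under eq_fun do rewrite mul1r.
have := @cvg_normal_pdf_decay G K (-1) _ GK.
under eq_fun do rewrite mulN1r; apply.
by rewrite normrN1.
Qed.

End normal_moments.

Section normal_cf.
Context {R : realType}.
Local Notation mu := (@lebesgue_measure R).
Variables (m s : R).
Hypothesis s0 : s != 0.
Let phi := normal_pdf m s.

Let cphi : continuous phi. Proof. exact: continuous_normal_pdf. Qed.
Let mphi : measurable_fun [set: R] phi. Proof. exact: measurable_normal_pdf. Qed.
Let phi0 x : 0 <= phi x. Proof. exact: normal_pdf_ge0. Qed.
Let dphi (x : R) : is_derive x 1 phi (- ((x - m) / s ^+ 2) * phi x).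
Proof. exact: is_derive_normal_pdf. Qed.

Let icphi (f : R -> R) : measurable_fun setT f -> (forall x, `|f x| <= 1) ->
  mu.-integrable setT (fun x => (f x * phi x)%:E).
Proof.
move=> mf f1; apply: (@le_integrable _ _ _ mu setT measurableT _
  (fun x => (phi x)%:E)) => //.
- by apply/measurable_EFinP; apply: measurable_funM.
- move=> x _; rewrite !abse_EFin lee_fin normrM -[X in _ <= X]mul1r ler_wpM2r//.
- exact: integrable_normal_pdf.
Qed.

Let ixphi (f : R -> R) : measurable_fun setT f -> (forall x, `|f x| <= 1) ->
  mu.-integrable setT (fun x => ((x - m) * f x * phi x)%:E).
Proof.
move=> mf f1; apply: (@le_integrable _ _ _ mu setT measurableT _
  (fun x => ((x - m) * phi x)%:E)) => //.
- apply/measurable_EFinP; apply: measurable_funM => //; apply: measurable_funM => //.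
  exact: measurable_funB.
- move=> x _; rewrite !abse_EFin lee_fin !normrM ler_wpM2r//.
  by rewrite -[X in _ <= X]mulr1 ler_wpM2l.
- exact: integrable_normal_pdf_lin.
Qed.

Let mlin c b : measurable_fun [set: R] (fun x : R => c * (x - m) + b).
Proof.
by apply: measurable_funD => //; apply: measurable_funM => //; apply: measurable_funB.
Qed.
Let mcos c b : measurable_fun [set: R] (fun x : R => cos (c * (x - m) + b)).
Proof.
by apply: measurableT_comp => //; apply: continuous_measurable_fun; exact: continuous_cos.
Qed.
Let msin c b : measurable_fun [set: R] (fun x : R => sin (c * (x - m) + b)).
Proof.
by apply: measurableT_comp => //; apply: continuous_measurable_fun; exact: continuous_sin.
Qed.

Let clin : continuous (fun x : R => x - m).
Proof. by move=> x; apply: cvgB; [exact: cvg_id|exact: cvg_cst]. Qed.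

Lemma integral_normal_pdf_lin : (\int[mu]_x ((x - m) * phi x)%:E = 0)%E.
Proof.
pose g x := - (s ^+ 2)^-1 * ((x - m) * phi x).
have i1 := integrable_normal_pdf_lin m s0.
have : (\int[mu]_x (g x)%:E = 0)%E.
  apply: (@integral_normal_pdf_deriv _ _ _ s0 phi g 1).
  - by move=> x; apply: (is_derive_eq (dphi x)); rewrite /g; ring.
  - move=> x; apply: cvgM; first exact: cvg_cst.
    by apply: cvgM; [exact: clin|exact: cphi].
  - have -> : EFin \o g = (fun x => (- s ^- 2)%:E * ((x - m) * phi x)%:E)%E.
      by apply/funext.
    exact: integrableZl.
  - move=> x; rewrite mul1r -/phi ger0_norm//; apply: ler_peMl => //.
    by rewrite lerDl.
rewrite /g; under eq_integral do rewrite EFinM.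
rewrite integralZl// => /eqP; rewrite mule_eq0 => /orP[|/eqP//].
by rewrite eqe oppr_eq0 invr_eq0 expf_eq0/= (negbTE s0).
Qed.

Lemma integral_normal_pdf_sqr : (\int[mu]_x ((x - m) ^+ 2 * phi x)%:E = (s ^+ 2)%:E)%E.
Proof.
have s2 : s ^+ 2 != 0 by rewrite expf_neq0.
pose g x := phi x - (s ^+ 2)^-1 * ((x - m) ^+ 2 * phi x).
have i2 := integrable_normal_pdf_sqr m s0.
have iphi : mu.-integrable [set: R] (fun x => (phi x)%:E) by exact: integrable_normal_pdf.
have : (\int[mu]_x (g x)%:E = 0)%E.
  apply: (@integral_normal_pdf_deriv _ _ _ s0 (fun x => (x - m) * phi x) g 1).
  - move=> x; have dp := dphi x.
    by apply: is_derive_eq; rewrite /GRing.scale /= /g; field.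
  - move=> x; apply: cvgB; first exact: cphi.
    apply: cvgM; first exact: cvg_cst.
    apply: cvgM; last exact: cphi.
    by apply: (@cvg_comp _ _ _ _ (fun y => y ^+ 2)); [exact: clin|exact: exprn_continuous].
  - have -> : EFin \o g = (fun x => (phi x)%:E -
        (s ^- 2)%:E * ((x - m) ^+ 2 * phi x)%:E)%E by apply/funext.
    by apply: integrableB => //; exact: integrableZl.
  - move=> x; rewrite mul1r normrM (ger0_norm (phi0 x)); apply: ler_wpM2r => //.
    by rewrite lerDr.
rewrite /g; under eq_integral do rewrite EFinB EFinM.
rewrite integralB//; last exact: integrableZl.
rewrite integralZl// integral_normal_pdf.
have := integrable_fin_num measurableT i2.
case: (\int[mu]_x _)%E => // r _ /eqP.
rewrite -EFinM -EFinB eqe subr_eq0 => /eqP e1.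
by congr EFin; rewrite -[RHS]mulr1 e1 mulVKf.
Qed.

(** Integration by parts against the normal density (Stein's identity) for the
    function sin (c (x - m) + b). *)
Lemma stein_sin c b :
  (\int[mu]_x ((x - m) * sin (c * (x - m) + b) * phi x) =
    s ^+ 2 * c * \int[mu]_x (cos (c * (x - m) + b) * phi x))%R.
Proof.
have s2 : s ^+ 2 != 0 by rewrite expf_neq0.
pose g x := c * (cos (c * (x - m) + b) * phi x) -
  (s ^+ 2)^-1 * ((x - m) * sin (c * (x - m) + b) * phi x).
have ic := icphi (mcos c b) (fun x => cos_max _).
have ix := ixphi (msin c b) (fun x => sin_max _).
have : (\int[mu]_x (g x)%:E = 0)%E.
  apply: (@integral_normal_pdf_deriv _ _ _ s0 (fun x => sin (c * (x - m) + b) * phi x) g 1).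
  - move=> x; have dp := dphi x.
    have d1 : is_derive x 1 (fun x => sin (c * (x - m) + b)) (cos (c * (x - m) + b) * c).
      apply: is_derive1_comp; apply: is_derive_eq.
      by rewrite /GRing.scale /= subr0 mulr1 addr0.
    by apply: is_derive_eq; rewrite /GRing.scale /= /g; field.
  - have cl : continuous (fun x : R => c * (x - m) + b).
      move=> x; apply: cvgD; last exact: cvg_cst.
      by apply: cvgM; [exact: cvg_cst|exact: clin].
    move=> x; apply: cvgB; apply: cvgM; try exact: cvg_cst.
      apply: cvgM; last exact: cphi.
      by apply: (@cvg_comp _ _ _ _ cos); [exact: cl|exact: continuous_cos].
    apply: cvgM; last exact: cphi.
    apply: cvgM; first exact: clin.
    by apply: (@cvg_comp _ _ _ _ sin); [exact: cl|exact: continuous_sin].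
  - have -> : EFin \o g = (fun x => c%:E * (cos (c * (x - m) + b) * phi x)%:E -
        (s ^- 2)%:E * ((x - m) * sin (c * (x - m) + b) * phi x)%:E)%E.
      by apply/funext.
    by apply: integrableB => //; exact: integrableZl.
  - move=> x; rewrite mul1r normrM (ger0_norm (phi0 x)); apply: ler_wpM2r => //.
    by rewrite (le_trans (sin_max _))// lerDl.
rewrite /g; under eq_integral do rewrite EFinB (EFinM c) (EFinM (_^-1)).
rewrite integralB//; [|exact: integrableZl..].
rewrite !integralZl// /Rintegral.
have := integrable_fin_num measurableT ic.
have := integrable_fin_num measurableT ix.
case: (\int[mu]_x _)%E => // r _; case: (\int[mu]_x _)%E => // r' _ /eqP.
rewrite -!EFinM -EFinB eqe subr_eq0 => /eqP e1 /=.
by rewrite -mulrA e1 mulVKf.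
Qed.

Let F b c := \int[mu]_x (cos (c * (x - m) + b) * phi x).

(** Differentiating under the integral sign and applying Stein's identity gives the
    differential equation F' = - s^2 c F satisfied by the characteristic function. *)
Lemma is_derive_normal_cf b (c : R) : is_derive c 1 (F b) (- (s ^+ 2 * c * F b c)).
Proof.
pose f c x := cos (c * (x - m) + b) * phi x.
have df (c' x : R) : is_derive c' 1 (f ^~ x) (- ((x - m) * sin (c' * (x - m) + b) * phi x)).
  have d1 : is_derive c' 1 (fun c => cos (c * (x - m) + b)) (- sin (c' * (x - m) + b) * (x - m)).
    apply: is_derive1_comp; apply: is_derive_eq.
    by rewrite /GRing.scale /= mulr1 addr0 ?mul0r ?addr0 ?mulr0 ?add0r.
  by apply: is_derive_eq; rewrite /GRing.scale /=; ring.
have d1E c' x : partial1of2 f c' x = - ((x - m) * sin (c' * (x - m) + b) * phi x).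
  by rewrite partial1of2E; apply: derive_val.
have cI : `]c - 1, c + 1[%classic c by rewrite /= in_itv/= ltrBlDr ltrDl ltr01.
have int1 x : `]c - 1, c + 1[%classic x -> mu.-integrable setT (EFin \o f x).
  by move=> _; exact: icphi (mcos x b) (fun x => cos_max _).
have der1 x y : `]c - 1, c + 1[%classic x -> [set: R] y -> derivable (f ^~ y) x 1.
  by move=> _ _; have [] := df x y.
pose G x := `|x - m| * phi x.
have G0 x : 0 <= G x by rewrite mulr_ge0.
have iG : mu.-integrable setT (EFin \o G).
  have := integrable_norm (integrable_normal_pdf_lin m s0).
  by apply: eq_integrable => // x _; rewrite /= normrM (ger0_norm (phi0 x)).
have Gub x y : `]c - 1, c + 1[%classic x -> [set: R] y -> `|partial1of2 f x y| <= G y.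
  move=> _ _; rewrite d1E normrN !normrM (ger0_norm (phi0 y)) ler_wpM2r//.
  by rewrite -[X in _ <= X]mulr1 ler_wpM2l// sin_max.
have D1 := derivable_under_integral measurableT cI int1 der1 G0 iG Gub.
have D2 := differentiation_under_integral measurableT cI int1 der1 G0 iG Gub.
apply: DeriveDef => //.
rewrite -derive1E [LHS]D2 -stein_sin.
under eq_Rintegral do rewrite d1E -mulN1r.
rewrite RintegralZl//; first by rewrite mulN1r.
exact: ixphi (msin c b) (fun x => sin_max _).
Qed.

(** By the differential equation, F c * exp (c^2 s^2 / 2) has zero derivative in c;
    its value is found at c = 0. Real cosines with a phase b replace the complex
    exponential throughout. *)
Lemma normal_cf_center b c :
  (\int[mu]_x (cos (c * (x - m) + b) * phi x)%:E =
    (expR (- (c ^+ 2 * s ^+ 2 / 2)) * cos b)%:E)%E.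
Proof.
have ic := icphi (mcos c b) (fun x => cos_max _).
rewrite -[LHS]fineK; last exact: integrable_fin_num.
congr EFin; rewrite -[LHS]/(F b c).
pose H c := F b c * expR (c ^+ 2 * s ^+ 2 / 2).
have dH (x : R) : is_derive x 1 H 0.
  have dF := is_derive_normal_cf b x.
  have dE : is_derive x 1 (fun c => expR (c ^+ 2 * s ^+ 2 / 2))
     (expR (x ^+ 2 * s ^+ 2 / 2) * (x * s ^+ 2)).
    apply: is_derive1_comp; apply: is_derive_eq; rewrite /GRing.scale /=; by field.
  by apply: is_derive_eq; rewrite /GRing.scale /=; ring.
have HE := is_derive_0_is_cst c 0 dH.
have H0 : H 0 = cos b.
  rewrite /H expr0n /= !mul0r expR0 mulr1 /F /Rintegral.
  under eq_integral do rewrite mul0r add0r EFinM.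
  by rewrite integralZl//; [rewrite integral_normal_pdf mule1|exact: integrable_normal_pdf].
by rewrite -H0 -HE /H mulrCA -expRD addrC subrr expR0 mulr1.
Qed.

End normal_cf.

Section normal_law_moments.
Context {R : realType}.
Variables (nu : probability (measurableTypeR R) R) (m s : R).
Hypothesis nuE : forall A : set R, measurable A -> nu A = normal_law m s A.
Local Notation mu := (@lebesgue_measure R).
Local Open Scope ereal_scope.

Let nu_dirac (f : R -> \bar R) : s = 0%R -> measurable_fun [set: R] f ->
  \int[nu]_x f x = f m.
Proof.
move=> s0 mf; rewrite (eq_measure_integral (@dirac _ (measurableTypeR R) m R)).
  by rewrite integral_dirac// diracT mul1e.
by move=> A mA _; have := nuE mA; rewrite /normal_law s0 eqxx.
Qed.

Let nu_normal A : s != 0%R -> measurable A ->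
  nu A = \int[mu]_(x in A) (normal_pdf m s x)%:E.
Proof. by move=> s0 mA; have := nuE mA; rewrite /normal_law (negbTE s0). Qed.

Let mpdf : measurable_fun [set: R] (normal_pdf m s).
Proof. exact: measurable_normal_pdf. Qed.

Let nu_int (f : R -> \bar R) : s != 0%R -> measurable_fun [set: R] f ->
  \int[nu]_x f x = \int[mu]_x (f x * (normal_pdf m s x)%:E).
Proof.
move=> s0 mf.
have := @integral_density _ _ _ mu nu _ mpdf (normal_pdf_ge0 m s) (fun A mA => nu_normal s0 mA) f mf.
exact.
Qed.

Lemma normal_law_variance : \int[nu]_x ((x - m) ^+ 2)%:E = (s ^+ 2)%:E.
Proof.
have mf : measurable_fun [set: R] (fun x => ((x - m) ^+ 2)%:E).
  apply/measurable_EFinP; apply: measurable_funX; exact: measurable_funB.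
have [s0|s0] := eqVneq s 0%R.
  by rewrite nu_dirac// s0 subrr.
rewrite nu_int//; under eq_integral do rewrite -EFinM.
exact: integral_normal_pdf_sqr.
Qed.

Lemma normal_law_mean : \int[nu]_x (x - m)%:E = 0.
Proof.
have mf : measurable_fun [set: R] (fun x => (x - m)%:E).
  by apply/measurable_EFinP; exact: measurable_funB.
have [s0|s0] := eqVneq s 0%R.
  by rewrite nu_dirac// subrr.
rewrite nu_int//; under eq_integral do rewrite -EFinM.
exact: integral_normal_pdf_lin.
Qed.

Lemma normal_law_cos c b : \int[nu]_x (cos (c * x + b))%:E =
  (expR (- (c ^+ 2 * s ^+ 2 / 2)) * cos (c * m + b))%:E.
Proof.
have mf : measurable_fun [set: R] (fun x => (cos (c * x + b))%:E).
  apply/measurable_EFinP; apply: continuous_measurable_fun => x.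
  apply: (@cvg_comp _ _ _ (fun x => c * x + b)%R cos); last exact: continuous_cos.
  apply: cvgD; last exact: cvg_cst.
  by apply: cvgM; [exact: cvg_cst|exact: cvg_id].
have [s0|s0] := eqVneq s 0%R.
  by rewrite nu_dirac// s0 expr0n/= mulr0 mul0r oppr0 expR0 mul1r.
rewrite nu_int// -(normal_cf_center m s0 (c * m + b)); apply: eq_integral => x _.
by rewrite -EFinM; congr (cos _ * _)%:E; ring.
Qed.

End normal_law_moments.

(** * Laws on R^n and their characteristic functions *)

Section step_limits.
Context {R : realType}.
Implicit Types v x : R.

Lemma bernoulli_sub v N : 0 <= v <= 1 -> 1 - N%:R * v <= (1 - v) ^+ N.
Proof.
move=> /andP[v0 v1]; elim: N => [|N IH]; first by rewrite mul0r subr0 expr0.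
rewrite exprS; apply: le_trans (ler_wpM2l _ IH); last by rewrite subr_ge0.
have : 0 <= N%:R * v ^+ 2 by rewrite mulr_ge0 ?sqr_ge0.
rewrite -natr1; nra.
Qed.

Lemma bernoulli_add v N : 0 <= v -> 1 + N%:R * v <= (1 + v) ^+ N.
Proof.
move=> v0; elim: N => [|N IH]; first by rewrite mul0r addr0 expr0.
rewrite exprS; apply: le_trans (ler_wpM2l _ IH); last by rewrite addr_ge0.
have : 0 <= N%:R * v ^+ 2 by rewrite mulr_ge0 ?sqr_ge0.
rewrite -natr1; nra.
Qed.

(** For s in [-1, 1] the first factor tends to the indicator of s != 0. For s != 0
    the second tends to the indicator of 0 < s, because 2^m ((1 - s) / 2)^m tends to 0
    when s > 0 and to infinity when s < 0. So polynomials in s with values in [0, 1]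
    converge everywhere on [-1, 1] to the indicator of 0 < s. *)
Definition poly_step (m : nat) (s : R) : R :=
  (1 - (1 - s ^+ 2) ^+ m) * (1 - ((1 - s) / 2) ^+ m) ^+ (2 ^ m).

Lemma poly_step_bound m s : `|s| <= 1 -> 0 <= poly_step m s <= 1.
Proof.
rewrite ler_norml => /andP[s1 s2].
have B u : 0 <= u <= 1 -> 0 <= 1 - u ^+ m <= 1.
  move=> /andP[u0 u1]; rewrite subr_ge0 exprn_ile1//= lerBlDr lerDl.
  by rewrite exprn_ge0.
have /B/andP[a0 a1] : 0 <= 1 - s ^+ 2 <= 1 by apply/andP; split; nra.
have /B/andP[b0 b1] : 0 <= (1 - s) / 2 <= 1 by apply/andP; split; lra.
rewrite /poly_step mulr_ge0 ?exprn_ge0//=.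
by rewrite mulr_ile1 ?exprn_ge0// exprn_ile1.
Qed.

Lemma cvg_poly_step s : `|s| <= 1 ->
  poly_step m s @[m --> \oo] --> ((0 < s)%R%:R : R).
Proof.
move=> s1; have := s1; rewrite ler_norml => /andP[sm sM].
have [s0|s0|/esym s0] := ltgtP 0 s; last 2 first.
- set v := (1 - s) / 2.
  have v0 : 1 / 2 < v by rewrite /v; lra.
  have v1 : v <= 1 by rewrite /v; lra.
  have w1 : `|(2 * v)^-1| < 1.
    by rewrite ger0_norm ?invr_ge0 ?invf_lt1; lra.
  apply: (@squeeze_cvgr _ _ _ _ (cst 0) (fun m => ((2 * v)^-1) ^+ m)).
  + near=> m; have /andP[-> _] := poly_step_bound m s1 => /=.
    apply: (@le_trans _ _ ((1 - v ^+ m) ^+ (2 ^ m))).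
      rewrite /poly_step -[X in _ <= X]mul1r ler_wpM2r//.
        by rewrite exprn_ge0// subr_ge0 exprn_ile1//; lra.
      rewrite lerBlDr lerDl exprn_ge0//; nra.
    have p0 : 0 < (1 + v ^+ m) ^+ (2 ^ m) by rewrite exprn_gt0// ltr_wpDr// exprn_ge0//; lra.
    rewrite -(ler_pM2r p0) -exprMn exprVn.
    have -> : (1 - v ^+ m) * (1 + v ^+ m) = 1 - v ^+ (m * 2) by rewrite exprM; ring.
    apply: (@le_trans _ _ 1).
      by rewrite exprn_ile1 ?subr_ge0 ?exprn_ile1 ?lerBlDr ?lerDl ?exprn_ge0//; lra.
    rewrite mulrC ler_pdivlMr ?mul1r; last by rewrite exprn_gt0//; lra.
    apply: le_trans (bernoulli_add _ _); last by rewrite exprn_ge0//; lra.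
    by rewrite natrX exprMn lerDr.
  + exact: cvg_cst.
  + exact: cvg_expr.
- rewrite s0 /poly_step; apply: cvg_near_cst; apply: nearW => m.
  by rewrite expr0n/= subr0 expr1n subrr mul0r.
set v := (1 - s) / 2.
have v0 : 0 <= v by rewrite /v; lra.
have v1 : 2 * v < 1 by rewrite /v; lra.
apply: (@squeeze_cvgr _ _ _ _ (fun m => (1 - (1 - s ^+ 2) ^+ m) * (1 - (2 * v) ^+ m)) (cst 1)).
- near=> m; have /andP[_ ->] := poly_step_bound m s1; rewrite andbT.
  rewrite /poly_step ler_wpM2l//.
    by rewrite subr_ge0 exprn_ile1//; nra.
  have := @bernoulli_sub (v ^+ m) (2 ^ m); rewrite natrX -exprMn; apply.
  by rewrite exprn_ge0// exprn_ile1//; lra.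
- rewrite -[X in _ --> X]mulr1; apply: cvgM.
  + rewrite -[X in _ --> X]subr0; apply: cvgB; first exact: cvg_cst.
    by apply: cvg_expr; rewrite ger0_norm; nra.
  + rewrite -[X in _ --> X]subr0; apply: cvgB; first exact: cvg_cst.
    by apply: cvg_expr; rewrite ger0_norm; nra.
- exact: cvg_cst.
Unshelve. all: end_near. Qed.

(** Once l exceeds |x - t| / pi, the argument lies in (- pi, pi), where the sine has
    the sign of its argument. This turns half-lines into limits of trigonometric
    functions. *)
Lemma sin_sign_scaled x t : \forall l \near \oo,
  (0 < sin ((x - t) / l.+1%:R)) = (t < x).
Proof.
near=> l.
have l0 : (0 : R) < l.+1%:R by rewrite ltr0n.
have lb : `|x - t| < pi * l.+1%:R.
  rewrite mulrC -ltr_pdivrMr ?pi_gt0//.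
  apply: (@lt_trans _ _ l%:R); last by rewrite ltr_nat.
  by near: l; exact: nbhs_infty_gtr.
have {}lb : `|(x - t) / l.+1%:R| < pi.
  by rewrite normrM normfV (gtr0_norm l0) ltr_pdivrMr.
have [tx|xt|xt] := ltgtP t x.
- by rewrite sin_gt0_pi// divr_gt0 ?subr_gt0//= (le_lt_trans (ler_norm _)).
- apply/negbTE; rewrite -leNgt -oppr_ge0 -sinN ltW// sin_gt0_pi//.
  rewrite -mulNr opprB divr_gt0 ?subr_gt0//= (le_lt_trans (ler_norm _))//.
  by rewrite -opprB mulNr normrN.
- by rewrite xt subrr mul0r sin0 ltxx.
Unshelve. all: end_near. Qed.

End step_limits.

Section cramer_wold.
Context {R : realType} {n : nat}.
Local Notation T := (n.-tuple R).

Definition lin_form (a : 'I_n -> R) (x : T) : R := \sum_i a i * tnth x i.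

Lemma measurable_lin_form a : measurable_fun [set: T] (lin_form a).
Proof.
apply: measurable_sum => i; apply: measurable_funM => //.
exact: measurable_tnth.
Qed.

Definition cos_lin a b (x : T) : R := cos (lin_form a x + b).

Lemma measurable_cos_lin a b : measurable_fun [set: T] (cos_lin a b).
Proof.
apply: (@measurableT_comp _ _ _ _ _ _ cos _ (fun x => lin_form a x + b)).
  by apply: continuous_measurable_fun; exact: continuous_cos.
by apply: measurable_funD => //; exact: measurable_lin_form.
Qed.

Variables mu nu : probability T R.
Hypothesis cfE : forall a b,
  (\int[mu]_x (cos_lin a b x)%:E = \int[nu]_x (cos_lin a b x)%:E)%E.

Let bounded_integrable (P : probability T R) (g : T -> R) M :
  measurable_fun [set: T] g -> (forall x, `|g x| <= M) ->
  P.-integrable setT (EFin \o g).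
Proof.
move=> mg gM; apply: measurable_bounded_integrable => //.
  by rewrite (le_lt_trans (probability_le1 _ _)) ?ltry.
by exists M; split; [exact: num_real|move=> y My x _; apply: (le_trans (gM x)); exact: ltW].
Qed.

(** Products of cosines are again combinations of cosines, so this class of functions
    g contains the constant 1 and is stable under multiplication by a cosine; the
    quantification over all cosines in its definition is what makes it stable. *)
Definition cos_test (g : T -> R) : Prop :=
  [/\ measurable_fun [set: T] g, exists M, forall x, `|g x| <= M &
   forall a b, (\int[mu]_x (g x * cos_lin a b x)%:E =
                \int[nu]_x (g x * cos_lin a b x)%:E)%E].

Let int_cos (P : probability T R) (g : T -> R) a b : cos_test g ->
  P.-integrable setT (fun x => (g x * cos_lin a b x)%:E).
Proof.
move=> [mg [M gM] _]; apply: (@bounded_integrable _ _ M).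
  by apply: measurable_funM => //; exact: measurable_cos_lin.
move=> x; rewrite normrM -[M]mulr1 ler_pM// cos_max//.
Qed.

Let test1 : cos_test (fun=> 1).
Proof.
split => //; first by exists 1 => x; rewrite normr1.
by move=> a b; under eq_integral do rewrite mul1r; rewrite cfE;
  under [RHS]eq_integral do rewrite mul1r.
Qed.

Let testD g h : cos_test g -> cos_test h -> cos_test (fun x => g x + h x).
Proof.
move=> tg th; move: (tg) (th) => [mg [M gM] _] [mh [N hN] _]; split.
- exact: measurable_funD.
- by exists (M + N) => x; rewrite (le_trans (ler_normD _ _))// lerD.
- move=> a b; have [_ _ ge] := tg; have [_ _ he] := th.
  under eq_integral do rewrite mulrDl EFinD.
  under [RHS]eq_integral do rewrite mulrDl EFinD.
  by rewrite !integralD//; [rewrite ge he|exact: int_cos..].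
Qed.

Let testZ k g : cos_test g -> cos_test (fun x => k * g x).
Proof.
move=> tg; move: (tg) => [mg [M gM] ge]; split.
- exact: measurable_funM.
- by exists (`|k| * M) => x; rewrite normrM ler_wpM2l.
- move=> a b; under eq_integral do rewrite -mulrA EFinM.
  under [RHS]eq_integral do rewrite -mulrA EFinM.
  by rewrite !integralZl//; [rewrite ge|exact: int_cos..].
Qed.

Let lin_formD a a' x : lin_form (fun i => a i + a' i) x = lin_form a x + lin_form a' x.
Proof. by rewrite /lin_form -big_split; apply: eq_bigr => i _; rewrite mulrDl. Qed.

Let lin_formN a x : lin_form (fun i => - a i) x = - lin_form a x.
Proof. by rewrite /lin_form -sumrN; apply: eq_bigr => i _; rewrite mulNr. Qed.

Let test_cos a b g : cos_test g -> cos_test (fun x => g x * cos_lin a b x).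
Proof.
move=> tg; move: (tg) => [mg [M gM] ge]; split.
- by apply: measurable_funM => //; exact: measurable_cos_lin.
- by exists M => x; rewrite normrM -[M]mulr1 ler_pM// cos_max.
- move=> a' b'.
  have E x : (g x * cos_lin a b x * cos_lin a' b' x)%:E =
    ((2^-1)%:E * ((g x * cos_lin (fun i => a i + a' i) (b + b') x)%:E +
              (g x * cos_lin (fun i => a i + - a' i) (b - b') x)%:E))%E.
    rewrite -EFinD -EFinM; congr EFin.
    have -> : cos_lin (fun i => a i + a' i) (b + b') x =
        cos ((lin_form a x + b) + (lin_form a' x + b')).
      by rewrite /cos_lin lin_formD; congr cos; ring.
    have -> : cos_lin (fun i => a i + - a' i) (b - b') x =
        cos ((lin_form a x + b) - (lin_form a' x + b')).
      by rewrite /cos_lin lin_formD lin_formN; congr cos; ring.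
    by rewrite cosD cosB /cos_lin; field.
  under eq_integral do rewrite E.
  under [RHS]eq_integral do rewrite E.
  have i1 := int_cos _ _ _ tg.
  rewrite !integralZl//; try by apply: integrableD => //; exact: i1.
  by rewrite !integralD//; [rewrite !ge|exact: i1..].
Qed.

Let test_lim (h : nat -> T -> R) g M : (forall k, cos_test (h k)) ->
  (forall k x, `|h k x| <= M) -> (forall x, h k x @[k --> \oo] --> g x) ->
  cos_test g.
Proof.
move=> th hM hg.
have gM x : `|g x| <= M.
  have : `|h k x| @[k --> \oo] --> `|g x| by apply: cvg_norm.
  move=> /cvg_lim <-//; apply: limr_le.
    by apply/cvg_ex; exists `|g x|; apply: cvg_norm.
  by apply: nearW => k; exact: hM.
have mg : measurable_fun [set: T] g.
  apply: (@measurable_fun_cvg _ _ _ _ h) => [k|x _]; last exact: hg.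
  by have [] := th k.
split => //; first by exists M.
move=> a b.
have M0 : 0 <= M by rewrite (le_trans (normr_ge0 _) (gM point)).
have L (P : probability T R) :
    (\int[P]_x (h k x * cos_lin a b x)%:E)%E @[k --> \oo] -->
    (\int[P]_x (g x * cos_lin a b x)%:E)%E.
  apply: (@dominated_cvg _ _ _ P setT measurableT
    (fun k x => (h k x * cos_lin a b x)%:E) _ (fun=> M%:E)) => //.
  - move=> k; exact: measurable_int (int_cos P a b (th k)).
  - move=> x _; apply: cvg_EFin; first exact: nearW.
    by apply: cvgM; [exact: hg|exact: cvg_cst].
  - by apply: (@bounded_integrable P (fun=> M) M) => // x; rewrite ger0_norm.
  - by move=> k x _; rewrite lee_fin normrM -[M]mulr1 ler_pM// cos_max.
have := L mu; under eq_fun do rewrite (let: And3 _ _ e := th _ in e a b).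
by move=> /cvg_unique; apply; [exact: ereal_hausdorff|exact: L].
Qed.

Let test_ext g h : cos_test g -> g =1 h -> cos_test h.
Proof. by move=> + /funext <-. Qed.

(** The multipliers form an algebra closed under bounded pointwise limits. The sets
    whose indicator is a multiplier then form a sigma-algebra, and applying the
    multiplier to the constant 1 shows that the two laws agree on such a set. *)
Let multiplier (f : T -> R) := forall g, cos_test g -> cos_test (fun x => g x * f x).

Let mult_ext f h : multiplier f -> f =1 h -> multiplier h.
Proof. by move=> + /funext <-. Qed.

Let mult_cst k : multiplier (fun=> k).
Proof. by move=> g tg; apply: (test_ext (testZ k tg)) => x; rewrite mulrC. Qed.

Let multD f h : multiplier f -> multiplier h -> multiplier (fun x => f x + h x).
Proof.
move=> mf mh g tg; apply: (test_ext (testD (mf _ tg) (mh _ tg))) => x.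
by rewrite mulrDr.
Qed.

Let multM f h : multiplier f -> multiplier h -> multiplier (fun x => f x * h x).
Proof.
by move=> mf mh g tg; apply: (test_ext (mh _ (mf _ tg))) => x; rewrite mulrA.
Qed.

Let multB f h : multiplier f -> multiplier h -> multiplier (fun x => f x - h x).
Proof.
move=> mf mh; apply: (mult_ext (multD mf (multM (mult_cst (-1)) mh))) => x.
by rewrite mulN1r.
Qed.

Let multX f k : multiplier f -> multiplier (fun x => f x ^+ k).
Proof.
move=> mf; elim: k => [|k IH].
  by apply: (mult_ext (mult_cst 1)) => x; rewrite expr0.
by apply: (mult_ext (multM mf IH)) => x; rewrite exprS.
Qed.

Let mult_lim (h : nat -> T -> R) f : (forall k, multiplier (h k)) ->
  (forall k x, 0 <= h k x <= 1) -> (forall x, h k x @[k --> \oo] --> f x) ->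
  multiplier f.
Proof.
move=> mh h1 hf g tg; have [_ [M gM] _] := tg.
apply: (@test_lim (fun k x => g x * h k x) _ M).
- by move=> k; exact: mh.
- move=> k x; rewrite normrM -[M]mulr1 ler_pM//.
  by have /andP[? ?] := h1 k x; rewrite ger0_norm.
- by move=> x; apply: cvgM; [exact: cvg_cst|exact: hf].
Qed.

Let mult_sin a b : multiplier (fun x => sin (lin_form a x + b)).
Proof.
move=> g tg; apply: (test_ext (test_cos a (b - pi / 2) tg)) => x.
by rewrite /cos_lin addrA cosBpihalf.
Qed.

(** The indicator of x_i > t is the limit, first in the degree m of the polynomial
    step, then in the scale l, of polynomials in sin ((x_i - t) / l). *)
Let mult_ray i t : multiplier (fun x => (t < tnth x i)%R%:R).
Proof.
pose s l (x : T) : R := sin ((tnth x i - t) / l.+1%:R).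
have ms l : multiplier (s l).
  apply: (mult_ext (mult_sin (fun j => (j == i)%:R / l.+1%:R) (- t / l.+1%:R))) => x.
  rewrite /s mulrDl; congr (sin (_ + _)).
  rewrite /lin_form (bigD1 i)//= eqxx mul1r mulrC big1 ?addr0// => j /negbTE ->.
  by rewrite !mul0r.
have mp m l : multiplier (fun x => poly_step m (s l x)).
  apply: multM; apply: (multB (mult_cst 1)) || apply: multX.
    by apply: multX; apply: (multB (mult_cst 1)); apply: multX; exact: ms.
  apply: (multB (mult_cst 1)); apply: multX; apply: multM; last exact: mult_cst.
  by apply: multB; [exact: mult_cst|exact: ms].
have mb l : multiplier (fun x => (0 < s l x)%R%:R).
  apply: (@mult_lim (fun m x => poly_step m (s l x))) => //.
    by move=> m x; apply: poly_step_bound; exact: sin_max.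
  by move=> x; apply: cvg_poly_step; exact: sin_max.
apply: (@mult_lim (fun l x => (0 < s l x)%R%:R)) => //.
  by move=> l x; case: (0 < _) => /=; rewrite ?lexx ?ler01.
move=> x; apply: cvg_near_cst.
by near=> l; rewrite /s; congr (_%:R); congr nat_of_bool; near: l; exact: sin_sign_scaled.
Unshelve. all: end_near. Qed.

Let mset : set (set T) := [set S | multiplier (\1_S : T -> R)].

Let msetC S : mset S -> mset (~` S).
Proof.
move=> mS; apply: (mult_ext (multB (mult_cst 1) mS)) => x.
by rewrite !indicE in_setC; case: (x \in S); rewrite ?subrr ?subr0.
Qed.

Let mset_bigcap (F : nat -> set T) : (forall k, mset (F k)) -> mset (\bigcap_k F k).
Proof.
move=> mF; pose h k x : R := \prod_(j < k) \1_(F j) x.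
have hE k x : h k x = [forall j : 'I_k, x \in F j]%:R.
  rewrite /h; case: forallP => [H|/forallP].
    by rewrite big1// => j _; rewrite indicE H.
  rewrite negb_forall => /existsP[j /negbTE jF].
  by rewrite (bigD1 j)//= indicE jF mul0r.
apply: (@mult_lim h) => [k|k x|x].
- elim: k => [|k IH].
    by apply: (mult_ext (mult_cst 1)) => x; rewrite /h big_ord0.
  by apply: (mult_ext (multM IH (mF k))) => x; rewrite /h big_ord_recr.
- by rewrite hE; case: [forall _, _]; rewrite ?lexx ?ler01.
- apply: cvg_near_cst; rewrite indicE.
  have [xF|/asboolPn] := pselect ((\bigcap_k F k) x).
    rewrite mem_set//; apply: nearW => k; rewrite hE.
    by have -> : [forall j : 'I_k, x \in F j] by apply/forallP => j; apply/mem_set/xF.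
  move=> /asboolPn nF; rewrite memNset//.
  have [j nj] : exists j, ~ F j x by apply: contrapT => /forallNP H; apply: nF => j _; exact: contrapT.
  near=> k; rewrite hE; have jk : (j < k)%N by near: k; exact: nbhs_infty_gt.
  rewrite (_ : [forall _, _] = false)//; apply/negbTE; rewrite negb_forall.
  by apply/existsP; exists (Ordinal jk); rewrite memNset.
Unshelve. all: end_near. Qed.

Let mset0 : mset set0.
Proof. by apply: (mult_ext (mult_cst 0)) => x; rewrite indicE in_set0. Qed.

Let mset_bigcup (F : nat -> set T) : (forall k, mset (F k)) -> mset (\bigcup_k F k).
Proof.
by move=> mF; rewrite -[X in mset X]setCK setC_bigcup; apply/msetC/mset_bigcap => k; exact: msetC.
Qed.

Let mset_measurable S : measurable S -> mset S.
Proof.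
apply: (@smallest_sub _ (sigma_algebra setT) _ mset).
  by split => // A mA; rewrite setTD; exact: msetC.
rewrite -bigcup_seq /= => A [i _] [B mB <-]; rewrite setTI.
move: mB; rewrite /measurable /= /measurableR RGenOInfty.measurableE.
apply: (@smallest_sub _ (sigma_algebra setT) _
   (fun B => mset ((fun x : T => tnth x i) @^-1` B))).
  split; rewrite /= ?preimage_set0//.
    by move=> C mC; rewrite setTD preimage_setC; exact: msetC.
  by move=> F mF; rewrite preimage_bigcup; exact: mset_bigcup.
move=> _ [t ->]; apply: (mult_ext (mult_ray i t)) => x.
by rewrite indicE; congr (_%:R); congr nat_of_bool; apply/idP/idP;
  rewrite inE /= in_itv /= andbT.
Qed.

(** Uniqueness of the law with a given characteristic function, in the real form
    that asks for all the integrals of cos (a . x + b). Half-spaces orthogonal to the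
    axes have multiplier indicators, and they generate the Borel sets. *)
Theorem cramer_wold S : measurable S -> mu S = nu S.
Proof.
move=> mS; have [_ _ /(_ (fun=> 0) 0)] := mset_measurable mS test1.
have E x : (1 * \1_S x * cos_lin (fun=> 0) 0 x : R) = \1_S x.
  rewrite /cos_lin addr0 /lin_form big1 ?cos0 ?mulr1 ?mul1r// => i _.
  by rewrite mul0r.
under eq_integral do rewrite E; under [RHS]eq_integral do rewrite E.
by rewrite !integral_indic// !setIT.
Qed.

End cramer_wold.

(** * Sums of independent one-dimensional normal components *)

Section gaussian_mixture.
Context {R : realType} {n : nat}.
Local Notation T := (n.-tuple R).
Local Notation RM := (measurableTypeR R).

Definition shift_tuple (u : T) (p : T * RM) : T :=
  [tuple tnth p.1 i + p.2 * tnth u i | i < n].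

Lemma measurable_shift_tuple u : measurable_fun [set: T * RM] (shift_tuple u).
Proof.
apply/measurable_fun_tnthP => i.
rewrite (_ : _ \o _ = fun p => tnth p.1 i + p.2 * tnth u i); last first.
  by apply/funext => p; rewrite /= tnth_mktuple.
apply: (@measurable_funD _ (T * RM)%type).
  apply: (@measurableT_comp _ _ _ _ _ _ (fun x : T => tnth x i)).
    exact: measurable_tnth.
  exact: measurable_fst.
apply: (@measurable_funM _ (T * RM)%type).
  exact: (@measurable_snd _ _ T RM).
exact: measurable_cst.
Qed.

HB.instance Definition _ u := isMeasurableFun.Build _ _ _ _ (shift_tuple u)
  (measurable_shift_tuple u).

(** The law of x + y u for x of law P and y an independent centered normal variable
    of standard deviation s. *)
Definition add_gaussian (P : probability T R) (s : R) (u : T) : probability T R :=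
  distribution (P \x normal_prob 0 s)%E (shift_tuple u).

(** The law of x0 + \sum_(s, u) s * xi_(s, u) * u with independent standard normal
    xi_(s, u). Building the law one scalar at a time reduces a change of covariance to
    one-dimensional changes of variance. *)
Fixpoint gaussian_sum_law (x0 : T) (l : seq (R * T)) : probability T R :=
  if l is (s, u) :: l' then add_gaussian (gaussian_sum_law x0 l') s u else dirac x0.

End gaussian_mixture.

Section gaussian_mixture_integrals.
Context {R : realType} {n : nat}.
Local Notation T := (n.-tuple R).
Local Notation RM := (measurableTypeR R).
Implicit Types (P : probability T R) (s : R) (u : T).

Lemma ge0_integral_add_gaussian P s u (U : T -> \bar R) :
  measurable_fun [set: T] U -> (forall x, 0 <= U x)%E ->
  (\int[add_gaussian P s u]_x U x =
   \int[normal_prob 0 s]_y \int[P]_x U (shift_tuple u (x, y)))%E.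
Proof.
move=> mU U0; rewrite ge0_integral_distribution//.
apply: fubini_tonelli2; first exact: measurableT_comp.
by move=> x; exact: U0.
Qed.

Lemma integral_add_gaussian P s u (f : T -> R) M :
  measurable_fun [set: T] f -> (forall x, `|f x| <= M) ->
  (\int[add_gaussian P s u]_x (f x)%:E =
   \int[P]_x \int[normal_prob 0 s]_y (f (shift_tuple u (x, y)))%:E)%E.
Proof.
move=> mf fM.
have i : (P \x normal_prob 0 s)%E.-integrable setT ((EFin \o f) \o shift_tuple u).
  apply: (@measurable_bounded_integrable _ _ _ _ (f \o shift_tuple u)) => //.
  - rewrite (le_lt_trans _ (ltry 1))//.
    exact: (@probability_le1 _ _ _ (P \x normal_prob 0 s)%E).
  - exact: measurableT_comp.
  - exists M; split; [exact: num_real|move=> y My x _].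
    by apply: (le_trans (fM _)); exact: ltW.
rewrite integral_distribution//; last exact/measurable_EFinP.
by rewrite -integral12_prod_meas1.
Qed.

Lemma lin_form_shift (a : 'I_n -> R) u (p : T * RM) :
  lin_form a (shift_tuple u p) = lin_form a p.1 + p.2 * lin_form a u.
Proof.
rewrite /lin_form mulr_sumr -big_split; apply: eq_bigr => i _.
by rewrite tnth_mktuple mulrDr mulrCA.
Qed.

Lemma gaussian_sum_law_cos (x0 : T) (l : seq (R * T)) a b : all (fun p => p.1 != 0) l ->
  (\int[gaussian_sum_law x0 l]_x (cos_lin a b x)%:E =
   (expR (- ((\sum_(p <- l) p.1 ^+ 2 * lin_form a p.2 ^+ 2) / 2)) *
      cos (lin_form a x0 + b))%:E)%E.
Proof.
elim: l => [|[s u] l IH] /=.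
  move=> _; rewrite big_nil mul0r oppr0 expR0 mul1r integral_dirac//.
    by rewrite diracT mul1e.
  by apply/measurable_EFinP; exact: measurable_cos_lin.
move=> /andP[s0 /IH{}IH].
rewrite (@integral_add_gaussian _ _ _ _ 1); last 2 first.
- exact: measurable_cos_lin.
- by move=> x; exact: cos_max.
set c := lin_form a u.
have E x : (\int[normal_prob 0 s]_y (cos_lin a b (shift_tuple u (x, y)))%:E =
    (expR (- (c ^+ 2 * s ^+ 2 / 2)))%:E * (cos_lin a b x)%:E)%E.
  have nE (A : set RM) : measurable A -> normal_prob 0 s A = normal_law 0 s A.
    by move=> _; rewrite /normal_law (negbTE s0).
  have := normal_law_cos (nE : forall A, measurable A -> normal_prob 0 s A = _) c (lin_form a x + b).
  rewrite mulr0 add0r -EFinM => <-; apply: eq_integral => y _.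
  by rewrite /cos_lin lin_form_shift /=; congr (cos _)%:E; rewrite -/c; ring.
under eq_integral do rewrite E.
rewrite integralZl//; last first.
  apply: measurable_bounded_integrable => //.
  - by rewrite (le_lt_trans (probability_le1 _ _)) ?ltry.
  - exact: measurable_cos_lin.
  - exists 1; split; [exact: num_real|move=> y My x _].
    by apply: (le_trans (cos_max _)); exact: ltW.
rewrite IH -EFinM big_cons /= -/c mulrA -expRD; congr (expR _ * _)%:E.
by field.
Qed.

End gaussian_mixture_integrals.

(** * Testing between two Gaussian laws with common directions *)

Section chi_square.
Context {R : realType}.
Local Notation RM := (measurableTypeR R).
Local Notation mu := (@lebesgue_measure R).

Definition var_dev (s s' : R) : R := s' ^+ 2 / s ^+ 2 - 1.

(** The likelihood ratio of N(0, s'^2) to N(0, s^2), with the normalizations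
    simplified. *)
Definition pdf_ratio (s s' y : R) : R :=
  s / s' * expR (((s ^+ 2 *+ 2)^-1 - (s' ^+ 2 *+ 2)^-1) * y ^+ 2).

Lemma measurable_pdf_ratio s s' : measurable_fun [set: R] (pdf_ratio s s').
Proof.
apply: measurable_funM => //; apply: measurableT_comp => //.
by apply: measurable_funM => //; apply: measurable_funX.
Qed.

Let pk (r : R) : 0 < r -> normal_peak r = (r * Num.sqrt (pi *+ 2))^-1.
Proof.
move=> r0; rewrite /normal_peak -mulrnAr sqrtrM ?sqr_ge0//.
by rewrite sqrtr_sqr ger0_norm// ltW.
Qed.

Let q0 : 0 < Num.sqrt (pi *+ 2 : R).
Proof. by rewrite sqrtr_gt0 pmulrn_lgt0// pi_gt0. Qed.

Let pdfE (s y : R) : 0 < s ->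
  normal_pdf 0 s y = (s * Num.sqrt (pi *+ 2))^-1 * expR (- (s ^+ 2 *+ 2)^-1 * y ^+ 2).
Proof.
move=> s0; rewrite normal_pdfE ?gt_eqF// -pk//; rewrite -[X in _ = _ * expR (_ * X ^+ 2)](subr0 y).
by congr (_ * expR _); rewrite !mulNr mulrC.
Qed.

Lemma pdf_ratioE s s' y : 0 < s -> 0 < s' ->
  pdf_ratio s s' y * normal_pdf 0 s y = normal_pdf 0 s' y.
Proof.
move=> s0 s0'; rewrite !pdfE// mulrACA -expRD -mulrDl; congr (_ * expR (_ * _)).
  by field; rewrite !gt_eqF.
by ring.
Qed.

Lemma pdf_ratio_ge0 s s' y : 0 < s -> 0 < s' -> 0 <= pdf_ratio s s' y.
Proof. by move=> s0 s0'; rewrite mulr_ge0 ?expR_ge0// divr_ge0// ltW. Qed.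

Lemma ge0_integral_change_normal (s s' : R) (U : R -> \bar R) : 0 < s -> 0 < s' ->
  measurable_fun [set: R] U -> (forall y, 0 <= U y)%E ->
  (\int[normal_prob 0 s']_y U y =
   \int[normal_prob 0 s]_y (U y * (pdf_ratio s s' y)%:E))%E.
Proof.
move=> s0 s0' mU U0.
rewrite (@ge0_integral_density _ _ _ mu (normal_prob 0 s') (normal_pdf 0 s'))//; last 2 first.
- exact: measurable_normal_pdf.
- exact: normal_pdf_ge0.
rewrite (@ge0_integral_density _ _ _ mu (normal_prob 0 s) (normal_pdf 0 s))//; first last.
- by move=> y; rewrite mule_ge0// lee_fin pdf_ratio_ge0.
- by apply: emeasurable_funM => //; apply/measurable_EFinP; exact: measurable_pdf_ratio.
- exact: normal_pdf_ge0.
- exact: measurable_normal_pdf.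
by apply: eq_integral => y _; rewrite -muleA -EFinM pdf_ratioE.
Qed.

(** The square of the likelihood ratio times the density of N(0, s^2) is a Gaussian
    density up to the constant s t / s'^2, where 1 / t^2 = 2 / s'^2 - 1 / s^2. The exact
    value of the integral is (1 - e^2)^(-1/2) with e the relative deviation; it is
    bounded by (1 - e^2)^-1, which avoids square roots. *)
Lemma chi_square_normal (s s' : R) : 0 < s -> 0 < s' -> `|var_dev s s'| < 1 ->
  (\int[normal_prob 0 s]_y (pdf_ratio s s' y ^+ 2)%:E <=
    ((1 - var_dev s s' ^+ 2)^-1)%:E)%E.
Proof.
move=> s0 s0' e1.
have sN0 : s != 0 by rewrite gt_eqF.
have sN0' : s' != 0 by rewrite gt_eqF.
have s2 : 0 < s ^+ 2 by rewrite exprn_gt0.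
have s2' : 0 < s' ^+ 2 by rewrite exprn_gt0.
set e := var_dev s s' in e1 *.
have eE : s' ^+ 2 = (1 + e) * s ^+ 2 by rewrite /e /var_dev; field.
have [em eM] : -1 < e /\ e < 1 by move: e1; rewrite ltr_norml => /andP[].
have d0 : 0 < 2 * s ^+ 2 - s' ^+ 2 by rewrite eE; nra.
pose t := Num.sqrt (s' ^+ 2 * s ^+ 2 / (2 * s ^+ 2 - s' ^+ 2)).
have t2 : t ^+ 2 = s' ^+ 2 * s ^+ 2 / (2 * s ^+ 2 - s' ^+ 2).
  by rewrite sqr_sqrtr// divr_ge0// ?mulr_ge0// ltW.
have t0 : 0 < t by rewrite sqrtr_gt0 divr_gt0// mulr_gt0.
have tN0 : t != 0 by rewrite gt_eqF.
rewrite (@ge0_integral_density _ _ _ mu (normal_prob 0 s) (normal_pdf 0 s))//; first last.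
- by move=> y; rewrite lee_fin sqr_ge0.
- apply/measurable_EFinP; apply: measurable_funX; exact: measurable_pdf_ratio.
- exact: normal_pdf_ge0.
- exact: measurable_normal_pdf.
have E y : pdf_ratio s s' y ^+ 2 * normal_pdf 0 s y = s * t / s' ^+ 2 * normal_pdf 0 t y.
  rewrite expr2 -mulrA pdf_ratioE// !pdfE// /pdf_ratio.
  rewrite mulrACA -expRD -mulrDl [RHS]mulrA; congr (_ * expR (_ * _)).
    by field; rewrite sN0' tN0 gt_eqF.
  by rewrite t2; field; rewrite sN0 sN0' gt_eqF.
under eq_integral do rewrite -EFinM E EFinM.
rewrite ge0_integralZl//; first last.
- by rewrite lee_fin divr_ge0// ?mulr_ge0// ltW.
- by move=> y _; rewrite lee_fin normal_pdf_ge0.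
- by apply/measurable_EFinP; exact: measurable_normal_pdf.
rewrite integral_normal_pdf mule1 lee_fin.
have e2 : 0 < 1 - e ^+ 2 by nra.
have e21 : 1 - e ^+ 2 <= 1 by have := sqr_ge0 e; lra.
rewrite -[X in _ <= X]mul1r ler_pdivlMr//.
have H : (s * t / s' ^+ 2) ^+ 2 * (1 - e ^+ 2) = 1.
  rewrite expr_div_n exprMn t2.
  have -> : 1 - e ^+ 2 = (s' ^+ 2 * (2 * s ^+ 2 - s' ^+ 2)) / s ^+ 4.
    by rewrite /e /var_dev; field.
  by field; rewrite sN0 sN0' gt_eqF.
have z0 : 0 <= s * t / s' ^+ 2 by rewrite divr_ge0// ?mulr_ge0// ltW.
have z1 : 0 <= s * t / s' ^+ 2 * (1 - e ^+ 2) by apply: mulr_ge0 => //; exact: ltW.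
rewrite -(@ler_pXn2r _ 2)// ?nnegrE//.
have -> : (s * t / s' ^+ 2 * (1 - e ^+ 2)) ^+ 2 =
    ((s * t / s' ^+ 2) ^+ 2 * (1 - e ^+ 2)) * (1 - e ^+ 2) by ring.
by rewrite H mul1r expr1n.
Qed.

End chi_square.

Section gaussian_testing.
Context {R : realType} {n : nat}.
Local Notation T := (n.-tuple R).
Local Notation RM := (measurableTypeR R).
Implicit Types (l : seq (R * R * T)).

(** A list of triples (s, s', u) stands for the pair of laws with standard deviations
    s and s' along the same directions u. *)
Definition left_list l : seq (R * T) := [seq (p.1.1, p.2) | p <- l].
Definition right_list l : seq (R * T) := [seq (p.1.2, p.2) | p <- l].

Definition admissible_pair (p : R * R * T) : bool :=
  [&& 0 < p.1.1, 0 < p.1.2 & `|var_dev p.1.1 p.1.2| < 1].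

(** A bound for the second moment of the likelihood ratio, which is a product over
    the independent components. *)
Definition chi2_bound l : R := \prod_(p <- l) (1 - var_dev p.1.1 p.1.2 ^+ 2)^-1.

Lemma chi2_bound_ge0 l : all admissible_pair l -> 0 <= chi2_bound l.
Proof.
elim: l => [|p l IH]; first by rewrite /chi2_bound big_nil.
move=> /= /andP[/and3P[_ _ ep] /IH]; rewrite /chi2_bound big_cons; apply: mulr_ge0.
by rewrite invr_ge0 subr_ge0 -real_normK ?num_real// exprn_ile1// ltW.
Qed.

(** For a likelihood ratio h of second moment chi, w * h * U <= U + (w * h)^2 / 4 and
    integration give the claim. The proof peels off one Gaussian component at a time:
    conditionally on its value y, the weight w becomes w * h y, which is why the weight
    is part of the statement. *)
Lemma gaussian_testing (x0 : T) l (U : T -> R) (w : R) :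
  all admissible_pair l -> measurable_fun [set: T] U ->
  (forall x, 0 <= U x <= 1) -> 0 <= w ->
  (w%:E * \int[gaussian_sum_law x0 (right_list l)]_x (U x)%:E <=
   \int[gaussian_sum_law x0 (left_list l)]_x (U x)%:E + (chi2_bound l * (w ^+ 2 / 4))%:E)%E.
Proof.
elim: l U w => [|[[s s'] u] l IH] U w /=.
  move=> _ mU U01 w0; rewrite !integral_dirac//; try exact/measurable_EFinP.
  rewrite !diracT !mul1e -EFinM -EFinD lee_fin /chi2_bound big_nil mul1r.
  by have /andP[u0 u1] := U01 x0; have := sqr_ge0 (w / 2 - 1); nra.
move=> /andP[/and3P[/= s0 s0' e1] al] mU U01 w0.
have U0 x : (0 <= (U x)%:E)%E by rewrite lee_fin; have /andP[] := U01 x.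
have mUE : measurable_fun [set: T] (EFin \o U) by exact/measurable_EFinP.
rewrite !(ge0_integral_add_gaussian _ _ _ mUE)//.
set P1 := gaussian_sum_law x0 (right_list l); set P0 := gaussian_sum_law x0 (left_list l).
pose V (P : probability T R) (y : RM) := (\int[P]_x (U (shift_tuple u (x, y)))%:E)%E.
have mV P : measurable_fun [set: RM] (V P).
  apply: (@measurable_fun_fubini_tonelli_G _ _ T RM R P (fun z => (U (shift_tuple u z))%:E)) => //.
  exact: (@measurableT_comp _ _ _ _ _ _ (EFin \o U)).
have V0 P y : (0 <= V P y)%E by apply: integral_ge0.
have D0 : 0 <= chi2_bound l by exact: chi2_bound_ge0.
pose h := pdf_ratio s s'.
have h0 y : 0 <= h y by exact: pdf_ratio_ge0.
have mh : measurable_fun [set: RM] h by exact: measurable_pdf_ratio.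
rewrite (ge0_integral_change_normal s0 s0' (mV P1) (V0 P1)).
rewrite -ge0_integralZl//; first last.
- by move=> y _; rewrite mule_ge0// ?lee_fin.
- by apply: emeasurable_funM => //; exact/measurable_EFinP.
apply: (@le_trans _ _ (\int[normal_prob 0 s]_y
   (V P0 y + (chi2_bound l * (w ^+ 2 / 4))%:E * (h y ^+ 2)%:E))%E).
  apply: ge0_le_integral => //.
  - by move=> y _; rewrite mule_ge0 ?mule_ge0// lee_fin.
  - by apply: measurable_funeM; apply: emeasurable_funM => //; exact/measurable_EFinP.
  - apply: emeasurable_funD => //; apply: measurable_funeM.
    by apply/measurable_EFinP; apply: measurable_funX.
  move=> y _.
  have := IH (fun x => U (shift_tuple u (x, y))) (w * h y) al _ _ (mulr_ge0 w0 (h0 y)).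
  rewrite -/P1 -/P0 -/(V P1 y) -/(V P0 y).
  have -> : (w%:E * (V P1 y * (h y)%:E) = (w * h y)%:E * V P1 y)%E.
    by rewrite (EFinM w) -muleA; congr (_ * _)%E; exact: muleC.
  rewrite -EFinM.
  have -> : chi2_bound l * ((w * h y) ^+ 2 / 4) = chi2_bound l * (w ^+ 2 / 4) * h y ^+ 2.
    by field.
  apply => //.
  apply: (measurableT_comp mU).
  apply: (measurableT_comp (measurable_shift_tuple u)).
  exact: (@measurable_fun_pair _ _ _ T T RM).
rewrite ge0_integralD//; first last.
- by apply: measurable_funeM; apply/measurable_EFinP; apply: measurable_funX.
- by move=> y _; rewrite -EFinM lee_fin mulr_ge0 ?sqr_ge0// mulr_ge0// divr_ge0// sqr_ge0.
rewrite leeD2l// ge0_integralZl//; first last.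
- by rewrite lee_fin mulr_ge0// divr_ge0// sqr_ge0.
- by move=> y _; rewrite lee_fin sqr_ge0.
- by apply/measurable_EFinP; apply: measurable_funX.
apply: le_trans (lee_wpmul2l _ (chi_square_normal s0 s0' e1)) _.
  by rewrite lee_fin mulr_ge0// divr_ge0// sqr_ge0.
by rewrite -EFinM lee_fin /chi2_bound big_cons /= mulrAC [X in X * _]mulrC.
Qed.

(** From \prod (1 - e_k^2) >= 1 - \sum e_k^2. *)
Lemma chi2_bound_le l (S : R) : all admissible_pair l ->
  \sum_(p <- l) var_dev p.1.1 p.1.2 ^+ 2 <= S -> S < 1 ->
  chi2_bound l <= (1 - S)^-1.
Proof.
move=> al lS S1.
have H : forall k, all admissible_pair k ->
  1 - \sum_(p <- k) var_dev p.1.1 p.1.2 ^+ 2 <= (chi2_bound k)^-1 <= 1.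
  elim=> [|p k IH]; first by rewrite /chi2_bound !big_nil subr0 invr1 lexx.
  move=> /= /andP[/and3P[_ _ ep] ak]; have /andP[IH1 IH2] := IH ak.
  rewrite /chi2_bound !big_cons invfM invrK -/(chi2_bound k).
  set e := var_dev _ _ in ep *.
  have e0 : 0 <= e ^+ 2 by exact: sqr_ge0.
  have e2 : e ^+ 2 <= 1 by rewrite -real_normK ?num_real// exprn_ile1// ltW.
  have b0 : 0 <= (chi2_bound k)^-1 by rewrite invr_ge0 chi2_bound_ge0.
  apply/andP; split; nra.
have /andP[H1 _] := H l al.
have c0 : 0 < (chi2_bound l)^-1 by lra.
rewrite -[X in X <= _]invrK lef_pV2 ?posrE//; lra.
Qed.

End gaussian_testing.

(** * Private outputs as a randomized function of the sample *)

(** If Y given the past has conditional law kap, then the law of (past, Y) is the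
    composition of the law of the past with the kernel kap: both agree on rectangles. *)
Section joint_law.
Context {R : realType} {dO dS dT : measure_display} {Om : measurableType dO}
  {S : measurableType dS} {T : measurableType dT}.
Variables (P : probability Om R) (kap : R.-pker S ~> T).
Variables (past : {mfun Om >-> S}) (Y : {mfun Om >-> T}).
Hypothesis condE : forall (A : set T) (B : set S), measurable A -> measurable B ->
  P (Y @^-1` A `&` past @^-1` B) = (\int[P]_(w in past @^-1` B) kap (past w) A)%E.

Let law (_ : unit) : {measure set S -> \bar R} := distribution P past.

Let mlaw (U : set S) : measurable U -> measurable_fun [set: unit] (law ^~ U).
Proof. by move=> mU; exact: measurable_cst. Qed.

HB.instance Definition _ := isKernel.Build _ _ _ _ R law mlaw.

Let law1 u : law u setT = 1%E. Proof. exact: probability_setT. Qed.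

HB.instance Definition _ := Kernel_isProbability.Build _ _ _ _ R law law1.

Let pairT (s : S) (t : T) : S * T := (s, t).
Let mpairT s : measurable_fun [set: T] (pairT s).
Proof. exact: pair1_measurable. Qed.

HB.instance Definition _ s := isMeasurableFun.Build _ _ _ _ (pairT s) (mpairT s).

Let ext (p : unit * S) : {measure set (S * T) -> \bar R} :=
  measure_function_pushforward__canonical__measure_function_Measure
    (kap p.2) (mpairT p.2).

Let extE p U : ext p U = kap p.2 (xsection U p.2).
Proof.
rewrite /ext /= /pushforward; congr (kap p.2 _); apply/seteqP; split => t /=.
  by rewrite /xsection /= inE.
by rewrite /xsection /= inE.
Qed.

Let mext (U : set (S * T)) : measurable U -> measurable_fun [set: unit * S] (ext ^~ U).
Proof.
move=> mU; rewrite (_ : ext ^~ U = (fun s => kap s (xsection U s)) \o snd); last first.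
  by apply/funext => p; rewrite extE.
apply: measurableT_comp; last exact: measurable_snd.
by apply: measurable_fun_xsection_finite_kernel; rewrite inE.
Qed.

HB.instance Definition _ := isKernel.Build _ _ _ _ R ext mext.

Let ext1 u : ext u setT = 1%E.
Proof.
rewrite extE (_ : xsection setT u.2 = setT) ?prob_kernel//.
by apply/seteqP; split => t // _; rewrite /xsection /= inE.
Qed.

HB.instance Definition _ := Kernel_isProbability.Build _ _ _ _ R ext ext1.

Let pastY w : S * T := (past w, Y w).
Let mpastY : measurable_fun [set: Om] pastY.
Proof. by apply: measurable_fun_pair. Qed.
HB.instance Definition _ := isMeasurableFun.Build _ _ _ _ pastY mpastY.

Let joint := kcomp law ext tt.

Let mkap U : measurable U -> measurable_fun [set: S] (fun s => kap s (xsection U s)).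
Proof. by move=> mU; apply: measurable_fun_xsection_finite_kernel; rewrite inE. Qed.

Let jointE U : measurable U ->
  joint U = (\int[P]_w kap (past w) (xsection U (past w)))%E.
Proof.
move=> mU; rewrite /joint /kcomp; under eq_integral do rewrite extE /=.
by rewrite ge0_integral_distribution//; exact: mkap.
Qed.

Let joint_rect (A : set S) (B : set T) : measurable A -> measurable B ->
  distribution P pastY (A `*` B) = joint (A `*` B).
Proof.
move=> mA mB; rewrite jointE; last exact: measurableX.
transitivity (P (Y @^-1` B `&` past @^-1` A)).
  by congr (P _); apply/seteqP; split => w [].
rewrite condE// integral_mkcond; apply: eq_integral => w _; rewrite patchE.
case: ifPn => wA; first by rewrite in_xsectionX//; rewrite inE in wA; rewrite inE.
by rewrite notin_xsectionX ?measure0//; rewrite notin_setE in wA; rewrite notin_setE.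
Qed.

Let joint_eq U : measurable U -> distribution P pastY U = joint U.
Proof.
move=> mU.
apply: (measure_unique [set A `*` B | A in measurable & B in measurable] (fun=> setT)) => //.
- exact: measurable_prod_measurableType.
- move=> _ _ [A1 mA1 [B1 mB1 <-]] [A2 mA2 [B2 mB2 <-]]; rewrite -setXI.
  by exists (A1 `&` A2); [exact: measurableI|exists (B1 `&` B2) => //; exact: measurableI].
- by move=> _; exists setT => //; exists setT => //; rewrite setXTT.
- by rewrite bigcup_const.
- by move=> _ [A mA [B mB <-]]; exact: joint_rect.
- by move=> _; rewrite (le_lt_trans (probability_le1 (distribution P pastY) _)) ?ltry.
Qed.

Lemma integral_joint_law (g : S * T -> \bar R) : measurable_fun [set: S * T] g ->
  (forall p, 0 <= g p)%E ->
  (\int[P]_w g (past w, Y w) = \int[P]_w \int[kap (past w)]_t g (past w, t))%E.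
Proof.
move=> mg g0.
transitivity (\int[distribution P pastY]_p g p)%E.
  by rewrite ge0_integral_distribution.
rewrite (eq_measure_integral joint); last by move=> A mA _; exact: joint_eq.
rewrite integral_kcomp//=.
have inner s : (\int[ext (tt, s)]_p g p = \int[kap s]_t g (s, t))%E.
  by rewrite /ext /= ge0_integral_pushforward.
under eq_integral do rewrite inner.
rewrite /law ge0_integral_distribution//; last by move=> s; apply: integral_ge0.
exact: measurable_fun_integral_finite_kernel.
Qed.

End joint_law.

Section data_processing.
Context {R : realType} {dZ : measure_display} {ZT : measurableType dZ}.
Context {n : nat} (Q : channel R ZT n).
Context {dO : measure_display} {Om : measurableType dO}.
Variables (X : int -> {mfun Om >-> R}) (Z : 'I_n -> {mfun Om >-> ZT}).

Let obs (i : 'I_n) (s : n.-tuple R * i.-tuple ZT) : R * i.-tuple ZT :=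
  (tnth s.1 i, s.2).

Let mobs (i : 'I_n) : measurable_fun [set: n.-tuple R * i.-tuple ZT] (@obs i).
Proof.
apply: measurable_fun_pair; last exact: measurable_snd.
apply: (@measurableT_comp _ _ _ _ _ _ (fun x : n.-tuple R => tnth x i)).
  exact: measurable_tnth.
exact: measurable_fst.
Qed.

Let release (i : 'I_n) (s : n.-tuple R * i.-tuple ZT) : {measure set ZT -> \bar R} :=
  Q i (obs s).

Let mrelease (i : 'I_n) (A : set ZT) : measurable A ->
  measurable_fun [set: n.-tuple R * i.-tuple ZT] ((@release i) ^~ A).
Proof.
move=> mA; apply: (@measurableT_comp _ _ _ _ _ _ (Q i ^~ A)) => //.
  exact: measurable_kernel.
exact: mobs.
Qed.

HB.instance Definition _ i := isKernel.Build _ _ _ _ R (@release i) (@mrelease i).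

Let release1 (i : 'I_n) s : @release i s setT = 1%E. Proof. exact: prob_kernel. Qed.

HB.instance Definition _ i :=
  Kernel_isProbability.Build _ _ _ _ R (@release i) (@release1 i).

Lemma measurable_sample : measurable_fun [set: Om] (@sample R n _ Om X).
Proof.
apply/measurable_fun_tnthP => i.
rewrite (_ : _ \o _ = X i.+1%:Z)//.
by apply/funext => w; rewrite /= tnth_mktuple.
Qed.

Let past (i : 'I_n) (w : Om) : n.-tuple R * i.-tuple ZT := (sample n X w, history Z i w).

Let mpast (i : 'I_n) : measurable_fun [set: Om] (past i).
Proof.
apply: measurable_fun_pair; first exact: measurable_sample.
apply/measurable_fun_tnthP => j.
rewrite (_ : _ \o _ = Z (widen_ord (ltnW (ltn_ord i)) j))//.
by apply/funext => w; rewrite /= tnth_mktuple.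
Qed.

HB.instance Definition _ i := isMeasurableFun.Build _ _ _ _ (past i) (@mpast i).

Definition first_outputs k (kn : (k <= n)%N) (w : Om) : k.-tuple ZT :=
  [tuple Z (widen_ord kn j) w | j < k].

Let first_outputsS k (kn : (k < n)%N) w :
  first_outputs kn w = rcons_tuple (first_outputs (ltnW kn) w) (Z (Ordinal kn) w).
Proof.
apply: eq_from_tnth => j; rewrite tnth_mktuple.
rewrite (tnth_nth (Z (Ordinal kn) w)) /= nth_rcons (size_tuple (first_outputs (ltnW kn) w)).
case: (ltngtP j k) => [jk|kj|jk].
- have := tnth_nth (Z (Ordinal kn) w) (first_outputs (ltnW kn) w) (Ordinal jk).
  rewrite /= => <-; rewrite tnth_mktuple.
  by congr (Z _ w); exact: val_inj.
- by have := ltn_ord j; rewrite ltnS leqNgt kj.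
- by congr (Z _ w); exact: val_inj.
Qed.

Lemma measurable_rcons_tuple k :
  measurable_fun [set: k.-tuple ZT * ZT] (fun p => rcons_tuple p.1 p.2).
Proof.
apply/measurable_fun_tnthP => j.
have [jk|jk] := ltnP j k.
  rewrite (_ : _ \o _ = (fun z => tnth z (Ordinal jk)) \o fst).
    apply: measurableT_comp; [exact: measurable_tnth|exact: measurable_fst].
  by apply/funext => p /=; rewrite !(tnth_nth p.2) /= nth_rcons size_tuple jk.
rewrite (_ : _ \o _ = snd); first exact: measurable_snd.
apply/funext => p /=; rewrite (tnth_nth p.2) /= nth_rcons size_tuple ltnNge jk /=.
by rewrite eqn_leq jk -ltnS ltn_ord.
Qed.

(** The outputs are integrated out from the last to the first, each against the
    kernel that released it. The resulting function of the sample is built from the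
    channel alone, and hence is the same for all laws of the observations. *)
Let reduce k (kn : (k <= n)%N) (g : n.-tuple R * k.-tuple ZT -> \bar R) :
  measurable_fun [set: n.-tuple R * k.-tuple ZT] g ->
  (forall p, 0 <= g p <= 1)%E ->
  exists U : n.-tuple R -> \bar R,
    [/\ measurable_fun [set: n.-tuple R] U, forall x, (0 <= U x <= 1)%E &
     forall P : probability Om R, privatized P X Z Q ->
      (\int[P]_w g (sample n X w, first_outputs kn w) = \int[P]_w U (sample n X w))%E].
Proof.
elim: k kn g => [|k IH] kn g mg g01.
  exists (fun x => g (x, [tuple])); split => //.
    apply: (measurableT_comp mg); exact: pair2_measurable.
  by move=> P _; apply: eq_integral => w _; rewrite [first_outputs _ _]tuple0.
pose i : 'I_n := Ordinal kn.
pose gt (p : (n.-tuple R * k.-tuple ZT) * ZT) := g (p.1.1, rcons_tuple p.1.2 p.2).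
have mgt : measurable_fun setT gt.
  apply: (measurableT_comp mg); apply: measurable_fun_pair.
    by apply: measurableT_comp; exact: measurable_fst.
  have m2 : measurable_fun [set: (n.-tuple R * k.-tuple ZT) * ZT] (fun p => (p.1.2, p.2)).
    apply: measurable_fun_pair; last exact: measurable_snd.
    by apply: measurableT_comp; [exact: measurable_snd|exact: measurable_fst].
  exact: (measurableT_comp (@measurable_rcons_tuple k) m2).
have gt0 p : (0 <= gt p)%E by have /andP[] := g01 (p.1.1, rcons_tuple p.1.2 p.2).
pose g' (s : n.-tuple R * k.-tuple ZT) := (\int[@release i s]_t gt (s, t))%E.
have mg' : measurable_fun setT g'.
  exact: (@measurable_fun_integral_finite_kernel _ _ _ _ _ _ (@release i)).
have g'01 s : (0 <= g' s <= 1)%E.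
  apply/andP; split; first exact: integral_ge0.
  rewrite -(@release1 i s) -[X in (_ <= X)%E]mul1e -integral_cst//.
  apply: ge0_le_integral => //.
  - by apply: (measurableT_comp mgt); exact: pair1_measurable.
  - by move=> t _; have /andP[] := g01 (s.1, rcons_tuple s.2 t).
have [U [mU U01 UE]] := IH (ltnW kn) g' mg' g'01.
exists U; split => // P PQ; rewrite -UE//.
have hE w : history Z i w = first_outputs (ltnW kn) w.
  by apply: eq_from_tnth => j; rewrite !tnth_mktuple; congr (Z _ w); exact: val_inj.
transitivity (\int[P]_w gt (past i w, Z i w))%E.
  by apply: eq_integral => w _; rewrite first_outputsS -hE.
transitivity (\int[P]_w g' (past i w))%E; last first.
  by apply: eq_integral => w _; rewrite /past hE.
apply: (@integral_joint_law R _ _ _ Om _ ZT P (@release i) (past i) (Z i) _ gt mgt gt0).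
move=> A B mA mB; rewrite [LHS](PQ i A B mA mB); apply: eq_integral => w _.
by have -> : X i.+1%:Z w = tnth (sample n X w) i by rewrite tnth_mktuple.
Qed.

(** Any event on the outputs amounts to a randomized test U of the raw sample, with
    the same U for all spectral densities. Hence two spectral densities cannot be told
    apart better from the outputs than from the raw sample. *)
Lemma data_processing (S : set (n.-tuple ZT)) : measurable S ->
  exists U : n.-tuple R -> R,
    [/\ measurable_fun [set: n.-tuple R] U, forall x, 0 <= U x <= 1 &
     forall P : probability Om R, privatized P X Z Q ->
      (P (outputs Z @^-1` S) = \int[P]_w (U (sample n X w))%:E)%E].
Proof.
move=> mS.
have := @reduce n (leqnn n) (fun p => (\1_S p.2)%:E).
case.
- apply/measurable_EFinP; apply: measurableT_comp; last exact: measurable_snd.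
  exact: measurable_indic.
- by move=> p; rewrite !lee_fin indicE; case: (_ \in _); rewrite ?lexx ?ler01.
move=> U [mU U01 UE]; exists (fine \o U).
have Ufin x : U x \is a fin_num.
  have /andP[U0 U1] := U01 x; rewrite ge0_fin_numE//; apply: le_lt_trans U1 _; exact: ltry.
split.
- apply/measurable_EFinP; apply: (eq_measurable_fun U) => // x _; by rewrite /= fineK.
- by move=> x; rewrite -!lee_fin /= fineK.
- move=> P PQ; under eq_integral do rewrite /= fineK//.
  rewrite -UE//.
  have oE w : first_outputs (leqnn n) w = outputs Z w.
    by apply: eq_from_tnth => j; rewrite !tnth_mktuple; congr (Z _ w); exact: val_inj.
  have mo : measurable (outputs Z @^-1` S).
    rewrite -[X in measurable X]setTI.
    have : measurable_fun [set: Om] (outputs Z); last exact.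
    apply/measurable_fun_tnthP => i; rewrite (_ : _ \o _ = Z i)//.
    by apply/funext => w; rewrite /= tnth_mktuple.
  transitivity (\int[P]_w (\1_(outputs Z @^-1` S) w)%:E)%E.
    by rewrite integral_indic// setIT.
  apply: eq_integral => w _.
  by rewrite /= oE !indicE; congr (_%:R%:E); congr nat_of_bool; rewrite !inE.
Qed.

End data_processing.

(** * Cosine polynomials and Fourier coefficients *)

Section bessel.
Context d (T : measurableType d) (R : realType).
Variables (mu : {measure set T -> \bar R}) (D : set T).
Hypotheses (mD : measurable D) (muD : (mu D < +oo)%E).
Implicit Types (h e : T -> R).

Lemma bounded_integrable_on h M : measurable_fun D h -> (forall x, `|h x| <= M) ->
  mu.-integrable D (EFin \o h).
Proof.
move=> mh hM; apply: measurable_bounded_integrable => //.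
exists M; split; [exact: num_real|move=> y My x _].
by apply: (le_trans (hM x)); exact: ltW.
Qed.

Definition square_integrable h : Prop :=
  measurable_fun D h /\ mu.-integrable D (fun x => (h x ^+ 2)%:E).

Lemma square_integrable_mul h e : square_integrable h -> measurable_fun D e ->
  (forall x, `|e x| <= 1) -> mu.-integrable D (fun x => (h x * e x)%:E).
Proof.
move=> [mh ih] me e1; apply: (@le_integrable _ _ _ mu D mD _
  (fun x => (1%:E + (h x ^+ 2)%:E)%E)).
- by apply/measurable_EFinP; exact: measurable_funM.
- move=> x _; rewrite -EFinD !abse_EFin lee_fin normrM.
  rewrite [X in _ <= X]ger0_norm ?addr_ge0 ?sqr_ge0//.
  have := e1 x; have := normr_ge0 (h x); have := normr_ge0 (e x).
  rewrite -(real_normK (num_real (h x))); nra.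
- apply: integrableD => //; apply: (@bounded_integrable_on (fun=> 1) 1) => //.
  by move=> x; rewrite normr1.
Qed.

Lemma square_integrable_sub h e t : square_integrable h -> measurable_fun D e ->
  (forall x, `|e x| <= 1) -> square_integrable (fun x => h x - t * e x).
Proof.
move=> [mh ih] me e1; split.
  by apply: measurable_funB => //; exact: measurable_funM.
apply: (@le_integrable _ _ _ mu D mD _
  (fun x => (2%:E * (h x ^+ 2)%:E + (2 * t ^+ 2)%:E)%E)).
- apply/measurable_EFinP; apply: measurable_funX; apply: measurable_funB => //.
  exact: measurable_funM.
- move=> x _; rewrite -EFinM -EFinD !abse_EFin lee_fin (ger0_norm (sqr_ge0 _)).
  have h2 : 0 <= 2 * h x ^+ 2 by apply: mulr_ge0 => //; exact: sqr_ge0.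
  have t2 : 0 <= 2 * t ^+ 2 by apply: mulr_ge0 => //; exact: sqr_ge0.
  rewrite ger0_norm ?addr_ge0//.
  have : e x ^+ 2 <= 1 by rewrite -(real_normK (num_real (e x))) exprn_ile1.
  have := sqr_ge0 (h x + t * e x); have := sqr_ge0 t; nra.
- apply: (@integrableD _ _ _ mu D mD (fun x => 2%:E * (h x ^+ 2)%:E)%E
    (fun=> (2 * t ^+ 2)%:E)); first exact: integrableZl.
  apply: (@bounded_integrable_on (fun=> 2 * t ^+ 2) (2 * t ^+ 2)) => //.
  by move=> x; rewrite ger0_norm//; apply: mulr_ge0 => //; exact: sqr_ge0.
Qed.

Variables (e : nat -> T -> R) (nu : nat -> R).
Hypotheses (me : forall j, measurable_fun D (e j)) (e1 : forall j x, `|e j x| <= 1).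
Hypothesis nu_gt0 : forall j, 0 < nu j.
Hypothesis orth : forall i j,
  (\int[mu]_(x in D) (e i x * e j x))%R = if i == j then nu j else 0.

(** Subtracting from h its projection on the last function of the system leaves the
    other coefficients unchanged and lowers the squared norm by exactly that of the
    projection. *)
Lemma bessel_inequality K h : square_integrable h ->
  \sum_(j < K) (\int[mu]_(x in D) (h x * e j x)) ^+ 2 / nu j <=
  \int[mu]_(x in D) (h x ^+ 2).
Proof.
elim: K h => [|K IH] h sh.
  by rewrite big_ord0; apply: Rintegral_ge0 => x _; exact: sqr_ge0.
have ie i j : mu.-integrable D (EFin \o (fun x => e i x * e j x)).
  apply: (@bounded_integrable_on _ 1); first exact: measurable_funM.
  by move=> x; rewrite normrM mulr_ile1.
have ihe j : mu.-integrable D (EFin \o (fun x => h x * e j x)).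
  exact: square_integrable_mul.
set t := (\int[mu]_(x in D) (h x * e K x)) / nu K.
have tE : \int[mu]_(x in D) (h x * e K x) = t * nu K by rewrite /t divfK// gt_eqF.
have IHh := IH _ (square_integrable_sub t sh (me K) (e1 K)).
have E1 (j : 'I_K) : \int[mu]_(x in D) ((h x - t * e K x) * e j x) =
    \int[mu]_(x in D) (h x * e j x).
  under eq_Rintegral do rewrite mulrBl -mulrA.
  rewrite RintegralB//; last exact: (integrableZl mD t (ie K j)).
  by rewrite RintegralZl// orth eqn_leq leqNgt ltn_ord /= mulr0 subr0.
have E2 : \int[mu]_(x in D) ((h x - t * e K x) ^+ 2) =
    \int[mu]_(x in D) (h x ^+ 2) - t ^+ 2 * nu K.
  have -> : \int[mu]_(x in D) ((h x - t * e K x) ^+ 2) =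
     \int[mu]_(x in D) (h x ^+ 2 - ((2 * t) * (h x * e K x) - t ^+ 2 * (e K x * e K x))).
    by apply: eq_Rintegral => x _; ring.
  have i1 : mu.-integrable D (EFin \o (fun x => (2 * t) * (h x * e K x))).
    exact: (integrableZl mD (2 * t) (ihe K)).
  have i2 : mu.-integrable D (EFin \o (fun x => t ^+ 2 * (e K x * e K x))).
    exact: (integrableZl mD (t ^+ 2) (ie K K)).
  have i3 : mu.-integrable D (EFin \o (fun x => (2 * t) * (h x * e K x) - t ^+ 2 * (e K x * e K x))).
    exact: (integrableB mD i1 i2).
  rewrite RintegralB//; last by case: sh.
  rewrite RintegralB// !RintegralZl// orth eqxx tE; ring.
rewrite big_ord_recr /= tE.
under eq_bigr do rewrite -E1.
apply: (le_trans (lerD IHh (lexx _))).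
rewrite E2 (_ : (t * nu K) ^+ 2 / nu K = t ^+ 2 * nu K); last by field; rewrite gt_eqF.
by rewrite subrK.
Qed.

End bessel.

Section cosine_system.
Context {R : realType}.
Local Notation mu := (@lebesgue_measure R).
Local Notation D := (@frequencies R).

Lemma measurable_frequencies : measurable (D : set (measurableTypeR R)).
Proof. exact: measurable_itv. Qed.

Lemma Npi_lt_pi : - pi < pi :> R.
Proof. by rewrite (lt_trans _ (pi_gt0 R))// oppr_lt0 pi_gt0. Qed.

Lemma measure_frequencies : (mu D = (2 * pi)%:E)%E.
Proof.
rewrite /frequencies lebesgue_measure_itv /= lte_fin Npi_lt_pi.
by rewrite -EFinB; congr EFin; ring.
Qed.

Lemma measure_frequencies_fin : (mu D < +oo)%E.
Proof. by rewrite measure_frequencies ltry. Qed.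

Definition cosn (j : nat) (w : R) : R := cos (j%:R * w).

Lemma continuous_cosn j : continuous (cosn j).
Proof.
move=> x; apply: (@cvg_comp _ _ _ (fun w => j%:R * w) cos); last exact: continuous_cos.
by apply: cvgM; [exact: cvg_cst|exact: cvg_id].
Qed.

Lemma measurable_cosn j (A : set R) : measurable_fun A (cosn j).
Proof. by apply: measurable_funTS; apply: continuous_measurable_fun; exact: continuous_cosn. Qed.

Lemma cosn_max j w : `|cosn j w| <= 1. Proof. exact: cos_max. Qed.

Lemma sin_natpi j : sin (j%:R * pi : R) = 0.
Proof.
elim: j => [|j IH]; first by rewrite mul0r sin0.
by rewrite -natr1 mulrDl mul1r sinDpi IH oppr0.
Qed.

Lemma integrable_cosn j : mu.-integrable D (EFin \o cosn j).
Proof.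
have := @bounded_integrable_on _ _ _ mu D measurable_frequencies measure_frequencies_fin (cosn j) 1.
apply; [exact: measurable_cosn|exact: cosn_max].
Qed.

Lemma integral_cosn j :
  \int[mu]_(w in D) cosn j w = if j == 0%N then 2 * pi else 0.
Proof.
case: (eqVneq j 0%N) => [->|j0].
  rewrite /cosn; under eq_Rintegral do rewrite mul0r cos0.
  rewrite Rintegral_cst; last exact: measurable_frequencies.
  by rewrite mul1r; have /= -> := congr1 fine measure_frequencies.
have jR : j%:R != 0 :> R by rewrite pnatr_eq0.
rewrite /Rintegral /frequencies.
rewrite (@continuous_FTC2 _ _ (fun w => sin (j%:R * w) / j%:R)).
- by rewrite mulrN sinN sin_natpi oppr0 mul0r subee.
- exact: Npi_lt_pi.
- by apply: continuous_subspaceT; exact: continuous_cosn.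
- have dF (w : R) : is_derive w 1 (fun w => sin (j%:R * w) / j%:R) (cosn j w).
    have d1 : is_derive w 1 (fun w => sin (j%:R * w)) (cos (j%:R * w) * j%:R).
      apply: is_derive1_comp; apply: is_derive_eq.
      by rewrite /GRing.scale /= mulr1 ?mulr0 ?addr0.
    apply: is_derive_eq; rewrite /GRing.scale /= /cosn; by field.
  have cF : continuous (fun w : R => sin (j%:R * w) / j%:R).
    by move=> x; apply: differentiable_continuous; apply/derivable1_diffP; have [] := dF x.
  split; first by move=> x _; have [] := dF x.
  + by apply: cvg_at_right_filter; exact: cF.
  + by apply: cvg_at_left_filter; exact: cF.
- move=> w _; rewrite derive1E.
  have d1 : is_derive w 1 (fun w => sin (j%:R * w)) (cos (j%:R * w) * j%:R).
    apply: is_derive1_comp; apply: is_derive_eq.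
    by rewrite /GRing.scale /= mulr1 ?mulr0 ?addr0.
  have dF : is_derive w 1 (fun w => sin (j%:R * w) / j%:R) (cosn j w).
    apply: is_derive_eq; rewrite /GRing.scale /= /cosn; by field.
  exact: derive_val.
Qed.

Lemma cosnM i j w : cosn i w * cosn j w =
  2^-1 * (cosn (i + j) w + cosn `|i%:Z - j%:Z|%N w).
Proof.
have -> : cosn `|i%:Z - j%:Z|%N w = cos (i%:R * w - j%:R * w).
  rewrite /cosn; have [ij|/ltnW ij] := leqP j i.
    by rewrite distnEl// natrB// mulrBl.
  by rewrite distnEr// natrB// mulrBl -cosN opprB.
rewrite /cosn natrD mulrDl cosD cosB; by field.
Qed.

Lemma integral_cosnM i j :
  \int[mu]_(w in D) (cosn i w * cosn j w) =
  if i == j then (if j == 0%N then 2 * pi else pi) else 0.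
Proof.
under eq_Rintegral do rewrite cosnM.
have i1 := integrable_cosn.
have mD := measurable_frequencies.
rewrite RintegralZl//; last exact: (integrableD mD (i1 _) (i1 _)).
rewrite RintegralD// !integral_cosn addn_eq0 distn_eq0.
case: (eqVneq i j) => [->|ij]; last first.
  rewrite ifN ?addr0 ?mulr0//; apply: contra ij => /andP[/eqP-> /eqP->] //.
by case: (j == 0%N) => /=; rewrite ?add0r; field.
Qed.

Lemma bessel_cosn K (h : R -> R) : square_integrable mu D h ->
  \sum_(j < K) (\int[mu]_(w in D) (h w * cosn j.+1 w)) ^+ 2 / pi <=
  \int[mu]_(w in D) (h w ^+ 2).
Proof.
apply: (bessel_inequality measurable_frequencies measure_frequencies_fin
   (e := fun j => cosn j.+1) (nu := fun=> pi)).
- by move=> j; exact: measurable_cosn.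
- by move=> j x; exact: cosn_max.
- by move=> _; exact: pi_gt0.
- by move=> i j; rewrite integral_cosnM eqSS.
Qed.

Lemma bessel_cosn_one k (h : R -> R) : square_integrable mu D h ->
  (\int[mu]_(w in D) (h w * cosn k w)) ^+ 2 <= 2 * pi * \int[mu]_(w in D) (h w ^+ 2).
Proof.
move=> sh; have sq0 : 0 <= \int[mu]_(w in D) (h w ^+ 2).
  by apply: Rintegral_ge0 => x _; exact: sqr_ge0.
have pi0 := pi_gt0 R.
case: k => [|k].
  pose nu j : R := if j == 0%N then 2 * pi else pi.
  have nu0 j : 0 < nu j by rewrite /nu; case: ifP => _; rewrite ?mulr_gt0.
  have := @bessel_inequality _ _ _ mu D measurable_frequencies measure_frequencies_fin
    cosn nu (fun j => measurable_cosn j (A := D)) cosn_max nu0 integral_cosnM 1 h sh.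
  by rewrite big_ord_recl big_ord0 /= addr0 ler_pdivrMr ?mulr_gt0// mulrC.
have := bessel_cosn k.+1 sh; rewrite big_ord_recr /= => H.
have {}H : (\int[mu]_(w in D) (h w * cosn k.+1 w)) ^+ 2 / pi <= \int[mu]_(w in D) (h w ^+ 2).
  apply: le_trans H; rewrite lerDr sumr_ge0// => j _.
  by rewrite divr_ge0 ?sqr_ge0// ltW.
move: H; rewrite ler_pdivrMr// => H; apply: (le_trans H).
rewrite mulrC -mulrA ler_peMl ?ler1n//; apply: mulr_ge0 => //; exact: ltW.
Qed.

(** For an even sequence c this is the real form of the Fourier partial sum of order
    K with coefficients c. *)
Definition cos_poly (c : int -> R) (K : nat) (w : R) : R :=
  c 0 + \sum_(j < K) 2 * c j.+1%:Z * cosn j.+1 w.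

Lemma continuous_cos_poly c K : continuous (cos_poly c K).
Proof.
move=> x; apply: cvgD; first exact: cvg_cst.
elim: K => [|K IH].
  rewrite (_ : (fun _ => _) = fun=> 0); last by apply/funext => y; rewrite big_ord0.
  by rewrite big_ord0; exact: cvg_cst.
rewrite (_ : (fun _ => _) = fun y =>
   \sum_(j < K) 2 * c j.+1%:Z * cosn j.+1 y + 2 * c K.+1%:Z * cosn K.+1 y); last first.
  by apply/funext => y; rewrite big_ord_recr.
rewrite big_ord_recr /=; apply: cvgD => //.
by apply: cvgM; [exact: cvg_cst|exact: continuous_cosn].
Qed.

Lemma measurable_cos_poly c K (A : set R) : measurable_fun A (cos_poly c K).
Proof.
by apply: measurable_funTS; apply: continuous_measurable_fun; exact: continuous_cos_poly.
Qed.

Lemma cos_poly_bound c K w : `|cos_poly c K w| <= `|c 0| + \sum_(j < K) `|2 * c j.+1%:Z|.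
Proof.
rewrite (le_trans (ler_normD _ _))// lerD2l (le_trans (ler_norm_sum _ _ _))//.
by apply: ler_sum => j _; rewrite normrM ler_piMr// cosn_max.
Qed.

Lemma integral_cos_polyM c K (k : nat) : (k <= K)%N ->
  \int[mu]_(w in D) (cos_poly c K w * cosn k w) = 2 * pi * c k%:Z.
Proof.
have mD := measurable_frequencies.
have im i j : mu.-integrable D (EFin \o (fun w => cosn i w * cosn j w)).
  have := @bounded_integrable_on _ _ _ mu D mD measure_frequencies_fin (fun w => cosn i w * cosn j w) 1; apply.
    by apply: measurable_funM; exact: measurable_cosn.
  by move=> x; rewrite normrM mulr_ile1// cosn_max.
have H m : (\int[mu]_(w in D) (cos_poly c m w * cosn k w) =
    if (k <= m)%N then 2 * pi * c k%:Z else 0) /\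
    mu.-integrable D (EFin \o (fun w => cos_poly c m w * cosn k w)).
  elim: m => [|m [IH1 IH2]].
    have E w : cos_poly c 0 w * cosn k w = c 0 * (cosn 0 w * cosn k w).
      by rewrite /cos_poly big_ord0 addr0 {2}/cosn mul0r cos0 mul1r.
    split.
      under eq_Rintegral do rewrite E.
      rewrite RintegralZl// integral_cosnM leqn0 eq_sym.
      by case: eqP => [->|_] /=; ring.
    by rewrite (_ : (fun w => _) = fun w => c 0 * (cosn 0 w * cosn k w));
      [exact: (integrableZl mD _ (im _ _))|apply/funext => w; exact: E].
  have E w : cos_poly c m.+1 w * cosn k w = cos_poly c m w * cosn k w +
       (2 * c m.+1%:Z) * (cosn m.+1 w * cosn k w).
    by rewrite /cos_poly big_ord_recr /=; ring.
  have i2 := integrableZl mD (2 * c m.+1%:Z) (im m.+1 k).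
  split.
    under eq_Rintegral do rewrite E.
    rewrite RintegralD// IH1 RintegralZl// integral_cosnM.
    case: (ltngtP k m.+1) => [km|km|->].
    - by rewrite -ltnS km mulr0 addr0.
    - by rewrite leqNgt (ltn_trans (ltnSn m) km)/= mulr0 addr0.
    - by rewrite ltnn add0r; ring.
  rewrite (_ : (fun w => _) = fun w => cos_poly c m w * cosn k w +
       (2 * c m.+1%:Z) * (cosn m.+1 w * cosn k w)).
    exact: (integrableD mD IH2 i2).
  by apply/funext => w; exact: E.
by move=> kK; have [-> _] := H K; rewrite kK.
Qed.

End cosine_system.

Section fourier_coefficients.
Context {R : realType}.
Local Notation mu := (@lebesgue_measure R).
Local Notation D := (@frequencies R).
Implicit Types c : int -> R.

Lemma fourier_termE c j (w : R) : Complex (c j) 0 * fourier_basis j w =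
  Complex (c j * cos (j%:~R * w)) (- (c j * sin (j%:~R * w))).
Proof. by apply/eqP; rewrite eq_complex /= !mul0r subr0 addr0 mulrN !eqxx. Qed.

Lemma fourier_partial_sum_even c m (w : R) : (forall j, c (- j) = c j) ->
  fourier_partial_sum c m w = Complex (cos_poly c m w) 0.
Proof.
move=> cN; elim: m => [|m IH].
  rewrite /fourier_partial_sum big_ord_recl big_ord0 fourier_termE /= /cos_poly big_ord0.
  rewrite subrr mul0r cos0 sin0 !addr0 mulr0 oppr0 mulr1.
  by apply/eqP; rewrite eq_complex /= ?addr0 !eqxx.
rewrite /fourier_partial_sum doubleS big_ord_recl big_ord_recr /=.
rewrite [X in _ + (X + _)](_ : _ = fourier_partial_sum c m w); last first.
  apply: eq_bigr => i _; rewrite /bump /= add1n.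
  by have -> : (i.+1%:Z - m.+1%:Z) = i%:Z - m%:Z by rewrite !intS opprD addrACA subrr add0r.
rewrite IH !fourier_termE.
have -> : 0%:Z - m.+1%:Z = - (m.+1%:Z) by rewrite sub0r.
have -> : (bump 0 m.*2.+1)%:Z - m.+1%:Z = m.+1%:Z.
  by rewrite /bump /= add1n -doubleS -addnn PoszD addrK.
rewrite cN !intrN mulNr cosN sinN.
apply/eqP; rewrite eq_complex /= /cos_poly big_ord_recr /= /cosn.
by apply/andP; split; apply/eqP; ring.
Qed.

Lemma fourier_seriesE (f : R -> R) c : (forall j, c (- j) = c j) ->
  fourier_series f c <-> measurable_fun D f /\
   ((fun m => \int[mu]_(w in D) ((f w - cos_poly c m w) ^+ 2)%:E) @ \oo --> 0)%E.
Proof.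
move=> cN; rewrite /fourier_series.
have E m : (\int[mu]_(w in D)
      (Normc.normc (Complex (f w) 0 - fourier_partial_sum c m w) ^+ 2)%:E =
   \int[mu]_(w in D) ((f w - cos_poly c m w) ^+ 2)%:E)%E.
  apply: eq_integral => w _; rewrite fourier_partial_sum_even//=.
  by rewrite subr0 expr0n /= addr0 sqrtr_sqr real_normK ?num_real.
by under [X in _ /\ (X @ _ --> _)]eq_fun do rewrite E.
Qed.

Lemma cos_poly_stable c K m (w : R) :
  (forall j : nat, (K < j)%N -> c j%:Z = 0) -> (K <= m)%N ->
  cos_poly c m w = cos_poly c K w.
Proof.
move=> c0; elim: m => [|m IH]; first by rewrite leqn0 => /eqP ->.
rewrite leq_eqVlt => /predU1P[<-//|Km]; rewrite -IH//.
by rewrite /cos_poly big_ord_recr /= c0// mulr0 mul0r addr0.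
Qed.

Lemma fourier_series_cos_poly c K : (forall j, c (- j) = c j) ->
  (forall j : nat, (K < j)%N -> c j%:Z = 0) -> fourier_series (cos_poly c K) c.
Proof.
move=> cN c0; apply/fourier_seriesE => //; split; first exact: measurable_cos_poly.
apply: cvg_near_cst; near=> m.
rewrite (eq_integral (fun=> 0%E)) ?integral0// => w _.
rewrite (cos_poly_stable _ c0) ?subrr ?expr0n//.
by near: m; exact: nbhs_infty_ge.
Unshelve. all: end_near. Qed.

(** By Bessel's inequality for a single cosine, a squared difference of two
    coefficients is at most a constant times the squared L2 distance of the partial
    sums, which tends to 0. *)
Lemma fourier_coef_unique c c' K : (forall j, c (- j) = c j) ->
  (forall j, c' (- j) = c' j) ->
  (forall j : nat, (K < j)%N -> c j%:Z = 0) ->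
  fourier_series (cos_poly c K) c' -> c' =1 c.
Proof.
move=> cN cN' c0 /(fourier_seriesE _ cN')[_ cv].
have main (k : nat) : c' k%:Z = c k%:Z.
  pose b := 2 * pi * (c k%:Z - c' k%:Z) ^+ 2.
  have pi0 := pi_gt0 R.
  have lb : \forall m \near \oo, (b%:E <= \int[mu]_(w in D) ((cos_poly c K w - cos_poly c' m w) ^+ 2)%:E)%E.
    near=> m.
    have Km : (K <= m)%N by near: m; exact: nbhs_infty_ge.
    have km : (k <= m)%N by near: m; exact: nbhs_infty_ge.
    have mD := @measurable_frequencies R.
    pose h w := cos_poly c m w - cos_poly c' m w.
    have mh : measurable_fun D h by apply: measurable_funB; exact: measurable_cos_poly.
    pose B := `|c 0| + \sum_(j < m) `|2 * c j.+1%:Z| + (`|c' 0| + \sum_(j < m) `|2 * c' j.+1%:Z|).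
    have hB x : `|h x| <= B.
      by rewrite (le_trans (ler_normB _ _))// lerD// cos_poly_bound.
    have B0 : 0 <= B by apply: le_trans (hB 0).
    have ih : mu.-integrable D (EFin \o (fun w => h w ^+ 2)).
      have := @bounded_integrable_on _ _ _ mu D mD measure_frequencies_fin (fun w => h w ^+ 2) (B ^+ 2).
      apply; first exact: measurable_funX.
      by move=> x; rewrite normrX lerXn2r ?nnegrE.
    have sh : square_integrable mu D h by [].
    have := bessel_cosn_one k sh.
    have -> : \int[mu]_(w in D) (h w * cosn k w) = 2 * pi * (c k%:Z - c' k%:Z).
      have ic c'' : mu.-integrable D (EFin \o (fun w => cos_poly c'' m w * cosn k w)).
        have := @bounded_integrable_on _ _ _ mu D mD measure_frequencies_fin
          (fun w => cos_poly c'' m w * cosn k w) (`|c'' 0| + \sum_(j < m) `|2 * c'' j.+1%:Z|).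
        apply; first by apply: measurable_funM; [exact: measurable_cos_poly|exact: measurable_cosn].
        move=> x; rewrite normrM -[X in _ <= X]mulr1 ler_pM//; first exact: cos_poly_bound.
        exact: cosn_max.
      under eq_Rintegral do rewrite mulrBl.
      by rewrite RintegralB// !integral_cos_polyM// mulrBr.
    rewrite exprMn expr2 -!mulrA !ler_pM2l// => H.
    have -> : (\int[mu]_(w in D) ((cos_poly c K w - cos_poly c' m w) ^+ 2)%:E =
       \int[mu]_(w in D) (h w ^+ 2)%:E)%E.
      by apply: eq_integral => w _; rewrite /h (cos_poly_stable _ c0 Km).
    rewrite -[X in (_ <= X)%E]fineK; last exact: integrable_fin_num.
    by rewrite lee_fin /b -mulrA.
  have b0 : (b%:E <= 0)%E.
    move/cvg_lim : (cv) => <-//; apply: lime_ge => //.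
    by apply/cvg_ex; exists 0%E.
  have : (c k%:Z - c' k%:Z) ^+ 2 <= 0.
    by move: b0; rewrite lee_fin /b -mulrA pmulr_rle0// pmulr_rle0.
  by rewrite le_eqVlt ltNge sqr_ge0 orbF sqrf_eq0 subr_eq0 => /eqP.
by move=> [k|k]; rewrite ?NegzE ?cN ?cN' main.
Unshelve. all: end_near. Qed.

End fourier_coefficients.

(** * The law of the sample when the spectral density is a cosine polynomial *)

Section circulant.
Context {R : realType}.
Implicit Types c : int -> R.

Definition grid_freq (N k : nat) : R := 2 * pi * k%:R / N%:R.

(** Orthogonality of characters of Z/N; the sum telescopes after multiplication by
    2 sin (pi p / N). *)
Lemma sum_cosn_grid N p : (p < N)%N ->
  \sum_(k < N) cosn p (grid_freq N k) = if p == 0%N then N%:R else 0 :> R.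
Proof.
move=> pN; case: (eqVneq p 0%N) => [->|p0].
  under eq_bigr do rewrite /cosn mul0r cos0.
  by rewrite sumr_const card_ord.
have N0 : (0 < N)%N by apply: leq_ltn_trans pN.
have NR : (0 : R) < N%:R by rewrite ltr0n.
pose x : R := pi * p%:R / N%:R.
have sx : 0 < sin x.
  apply: sin_gt0_pi; apply/andP; split.
    by rewrite divr_gt0// mulr_gt0 ?pi_gt0// ltr0n lt0n.
  by rewrite ltr_pdivrMr// ltr_pM2l ?pi_gt0// ltr_nat.
apply: (mulfI (lt0r_neq0 sx)); rewrite mulr0; apply: (mulfI (_ : (2 : R) != 0)) => //.
rewrite mulr0 mulrA mulr_sumr.
have E k : 2 * sin x * cosn p (grid_freq N k) =
    sin ((k%:R * 2 + 1) * x) - sin ((k%:R * 2 - 1) * x).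
  have -> : (k%:R * 2 + 1) * x = p%:R * grid_freq N k + x.
    by rewrite /x /grid_freq; field; rewrite gt_eqF.
  have -> : (k%:R * 2 - 1) * x = p%:R * grid_freq N k - x.
    by rewrite /x /grid_freq; field; rewrite gt_eqF.
  by rewrite /cosn sinD sinB; ring.
under eq_bigr do rewrite E.
have T m : \sum_(k < m) (sin ((k%:R * 2 + 1) * x) - sin ((k%:R * 2 - 1) * x)) =
    sin ((m%:R * 2 - 1) * x) + sin x.
  elim: m => [|m IH]; first by rewrite big_ord0 mul0r sub0r mulN1r sinN addNr.
  rewrite big_ord_recr /= IH.
  have -> : (m.+1%:R * 2 - 1) * x = (m%:R * 2 + 1) * x by rewrite -natr1; ring.
  by ring.
rewrite T (_ : (N%:R * 2 - 1) * x = p%:R * pi + p%:R * pi - x).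
  by rewrite sinB sinD !sin_natpi mul0r mulr0 addr0 mul0r sub0r cosD sin_natpi mulr0 subr0
    -expr2 (_ : cos (p%:R * pi) ^+ 2 = 1) ?mul1r ?addNr// cos2sin2 sin_natpi expr0n subr0.
by rewrite /x; field; rewrite gt_eqF.
Qed.

(** The quadrature rule on the N-point grid recovers the Fourier coefficients exactly
    as long as the sum of two frequencies that occur stays below N. *)
Lemma sum_cos_poly_grid c K N t : (forall j : nat, (K < j)%N -> c j%:Z = 0) ->
  (t + K < N)%N ->
  \sum_(k < N) cos_poly c K (grid_freq N k) * cosn t (grid_freq N k) = N%:R * c t%:Z.
Proof.
move=> c0 tKN; have KN : (K < N)%N by apply: leq_ltn_trans tKN; exact: leq_addl.
pose S p : R := \sum_(k < N) cosn p (grid_freq N k).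
have SE p : (p < N)%N -> S p = if p == 0%N then N%:R else 0 by exact: sum_cosn_grid.
have -> : \sum_(k < N) cos_poly c K (grid_freq N k) * cosn t (grid_freq N k) =
   c 0 * S t + \sum_(j < K) c j.+1%:Z * (S (j.+1 + t)%N + S `|j.+1%:Z - t%:Z|%N).
  rewrite /S mulr_sumr.
  under [X in _ = _ + X]eq_bigr do rewrite -big_split mulr_sumr.
  rewrite exchange_big -big_split; apply: eq_bigr => k _ /=.
  rewrite /cos_poly mulrDl mulr_suml; congr (_ + _); apply: eq_bigr => j _.
  by rewrite -mulrA cosnM; field.
have E (j : 'I_K) : c j.+1%:Z * (S (j.+1 + t)%N + S `|j.+1%:Z - t%:Z|%N) =
    if j.+1 == t then N%:R * c t%:Z else 0.
  have jK := ltn_ord j.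
  rewrite (SE (j.+1 + t)%N); last first.
    by rewrite addnC; apply: leq_ltn_trans tKN; rewrite leq_add2l.
  rewrite addSn /= add0r SE; last first.
    have [jt|/ltnW jt] := leqP t j.+1.
      by rewrite distnEl// (leq_ltn_trans (leq_subr _ _))// (leq_ltn_trans jK).
    rewrite distnEr// (leq_ltn_trans (leq_subr _ _))//.
    by apply: leq_ltn_trans tKN; exact: leq_addr.
  rewrite distn_eq0; case: eqP => [->|_]; by rewrite ?mulr0// mulrC.
under eq_bigr do rewrite E.
rewrite SE; last by apply: leq_ltn_trans tKN; exact: leq_addr.
case: t tKN E => [|t] tKN E /=.
  by rewrite big1 ?addr0// mulrC.
rewrite mulr0 add0r; have [tK|Kt] := ltnP t K.
  rewrite (bigD1 (Ordinal tK))//= eqxx big1 ?addr0// => j.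
  by rewrite -val_eqE /= eqSS => /negbTE ->.
rewrite c0// mulr0 big1// => j _; rewrite eqSS ifN//.
by apply: contraTneq (ltn_ord j) => ->; rewrite -leqNgt.
Qed.

End circulant.

Section latent_variance.
Context {R : realType} {n : nat}.
Implicit Types (c : int -> R) (a : 'I_n -> R).

Definition cos_wave (w : R) : n.-tuple R := [tuple cos (i%:R * w) | i < n].
Definition sin_wave (w : R) : n.-tuple R := [tuple sin (i%:R * w) | i < n].

(** The circulant embedding of the covariance matrix: the sample is represented with
    one pair of independent normal variables per grid frequency, of variance
    2 pi f / N, carried by the cosine and the sine wave of that frequency. *)
Definition latent_std c K N k : R :=
  Num.sqrt (2 * pi * cos_poly c K (grid_freq N k) / N%:R).

Definition latent c K N : seq (R * n.-tuple R) :=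
  [seq (latent_std c K N k, cos_wave (grid_freq N k)) | k <- iota 0 N] ++
  [seq (latent_std c K N k, sin_wave (grid_freq N k)) | k <- iota 0 N].

Lemma wave_square a w : lin_form a (cos_wave w) ^+ 2 + lin_form a (sin_wave w) ^+ 2 =
  \sum_(i < n) \sum_(j < n) a i * a j * cosn `|i%:Z - j%:Z|%N w.
Proof.
rewrite /lin_form !expr2 !mulr_suml -big_split; apply: eq_bigr => i _ /=.
rewrite !mulr_sumr -big_split; apply: eq_bigr => j _ /=; rewrite !tnth_mktuple.
have -> : cosn `|i%:Z - j%:Z|%N w = cos (i%:R * w - j%:R * w).
  rewrite /cosn; have [ij|/ltnW ij] := leqP j i.
    by rewrite distnEl// natrB// mulrBl.
  by rewrite distnEr// natrB// mulrBl -cosN opprB.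
by rewrite cosB; ring.
Qed.

(** The representation is exact rather than approximate because N is at least n + K:
    the quadrature rule then gives all the autocovariances of lag below n. The Gaussian
    laws attached to two cosine polynomials thus share their directions and differ only
    in scalar variances, so that no determinant or matrix square root is needed to
    compare them. *)
Lemma latent_variance c K N a : (forall j : nat, (K < j)%N -> c j%:Z = 0) ->
  (n + K <= N)%N -> (forall w, 0 <= cos_poly c K w) ->
  \sum_(p <- latent c K N) p.1 ^+ 2 * lin_form a p.2 ^+ 2 =
  \sum_(i < n) \sum_(j < n) a i * a j * (2 * pi * c `|i%:Z - j%:Z|%N%:Z).
Proof.
move=> c0 nKN f0; rewrite /latent big_cat !big_map /= (_ : iota 0 N = index_iota 0 N);
  last by rewrite /index_iota subn0.
rewrite -big_split /= big_mkord.
have E k : latent_std c K N k ^+ 2 * lin_form a (cos_wave (grid_freq N k)) ^+ 2 +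
    latent_std c K N k ^+ 2 * lin_form a (sin_wave (grid_freq N k)) ^+ 2 =
    \sum_(i < n) \sum_(j < n) a i * a j * (2 * pi / N%:R *
      (cos_poly c K (grid_freq N k) * cosn `|i%:Z - j%:Z|%N (grid_freq N k))).
  rewrite -mulrDr wave_square /latent_std sqr_sqrtr; last first.
    by rewrite divr_ge0// ?mulr_ge0// ?pi_ge0.
  rewrite mulr_sumr; apply: eq_bigr => i _; rewrite mulr_sumr; apply: eq_bigr => j _.
  by ring.
rewrite (eq_bigr _ (fun k _ => E (nat_of_ord k))).
rewrite exchange_big; apply: eq_bigr => i _.
rewrite exchange_big; apply: eq_bigr => j _.
rewrite -!mulr_sumr sum_cos_poly_grid//; last first.
  apply: leq_trans nKN; rewrite ltn_add2r.
  have [ij|/ltnW ij] := leqP j i.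
    by rewrite distnEl// (leq_ltn_trans (leq_subr _ _)).
  by rewrite distnEr// (leq_ltn_trans (leq_subr _ _)).
have N0 : N%:R != 0 :> R.
  by rewrite pnatr_eq0 -lt0n (leq_trans _ nKN)// ltn_addr// (leq_ltn_trans _ (ltn_ord i)).
by field.
Qed.

End latent_variance.

Section sample_law.
Context {R : realType} {d : measure_display} {Om : measurableType d} {n : nat}.
Variables (P : probability Om R) (X : int -> {mfun Om >-> R}) (mu : R).
Local Notation RM := (measurableTypeR R).
Local Open Scope ereal_scope.

Hypothesis gX : gaussian_process P X.
Hypothesis EX : forall t, 'E_P[X t] = mu%:E.
Variable gamma : int -> R.
Hypothesis covX : forall t k, covariance P (X t) (X (t + k)%R) = (gamma k)%:E.

Lemma autocovariance_even k : gamma (- k)%R = gamma k.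
Proof.
apply: EFin_inj; rewrite -(covX k (- k)%R) subrr covarianceC -[in LHS](add0r k).
exact: covX.
Qed.

Let V t w : R := (X t w - mu)%R.

Let mV t : measurable_fun [set: Om] (V t).
Proof. exact: measurable_funB. Qed.

Let covE t u : \int[P]_w (V t w * V u w)%:E = (gamma (u - t)%R)%:E.
Proof.
have := covX t (u - t)%R; rewrite addrC subrK unlock !EX /= unlock => <-.
by apply: eq_integral.
Qed.

Let iV2 t : P.-integrable setT (fun w => (V t w ^+ 2)%:E).
Proof.
apply/integrableP; split; first by apply/measurable_EFinP; exact: measurable_funX.
have := covE t t; under eq_integral do rewrite -expr2.
by under [X in _ -> X < _]eq_integral do rewrite gee0_abs ?lee_fin ?sqr_ge0//;
  move=> ->; exact: ltry.
Qed.

Let iVV t u : P.-integrable setT (fun w => (V t w * V u w)%:E).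
Proof.
apply: (@le_integrable _ _ _ P setT measurableT _
  (fun w => (V t w ^+ 2)%:E + (V u w ^+ 2)%:E)).
- by apply/measurable_EFinP; exact: measurable_funM.
- move=> w _; rewrite -EFinD !abse_EFin lee_fin normrM.
  rewrite [X in (_ <= X)%R]ger0_norm ?addr_ge0 ?sqr_ge0//.
  rewrite -(real_normK (num_real (V t w))) -(real_normK (num_real (V u w))).
  have := sqr_ge0 (`|V t w| - `|V u w|)%R; have := normr_ge0 (V t w).
  have := normr_ge0 (V u w); nra.
- by apply: integrableD.
Qed.

Let iV t : P.-integrable setT (fun w => (V t w)%:E).
Proof.
apply: (@le_integrable _ _ _ P setT measurableT _
  (fun w => 1%:E + (V t w ^+ 2)%:E)).
- exact/measurable_EFinP.
- move=> w _; rewrite -EFinD !abse_EFin lee_fin.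
  rewrite [X in (_ <= X)%R]ger0_norm ?addr_ge0 ?sqr_ge0//.
  by rewrite -(real_normK (num_real (V t w))); have := normr_ge0 (V t w); nra.
- apply: integrableD => //; apply: (@bounded_integrable_on _ _ _ P setT measurableT _ (fun=> 1%R) 1%R) => //.
    by rewrite (le_lt_trans (probability_le1 _ _)) ?ltry.
  by move=> x; rewrite normr1.
Qed.

Let EV t : \int[P]_w (V t w)%:E = 0.
Proof.
have i1 : P.-integrable setT (fun=> mu%:E).
  apply: (@bounded_integrable_on _ _ _ P setT measurableT _ (fun=> mu) `|mu|%R) => //.
  by rewrite (le_lt_trans (probability_le1 _ _)) ?ltry.
have iX : P.-integrable setT (fun w => (X t w)%:E).
  apply: (eq_integrable measurableT (fun w => (V t w)%:E + mu%:E)).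
    by move=> w _; rewrite -EFinD /V subrK.
  exact: integrableD.
rewrite /V; under eq_integral do rewrite EFinB.
rewrite integralB// integral_cst//= probability_setT mule1.
by have := EX t; rewrite unlock => ->; rewrite subee.
Qed.

(** The linear form \sum a_i X_i is normal by assumption; its mean and its variance
    are identified by computing both from the first two moments of the process. *)
Lemma sample_cos (a : 'I_n -> R) b :
  \int[P]_w (cos_lin a b (sample n X w))%:E =
  (expR (- ((\sum_(i < n) \sum_(j < n) a i * a j * gamma (`|i%:Z - j%:Z|%N)%:Z) / 2)) *
   cos (mu * \sum_(i < n) a i + b))%:E.
Proof.
pose a' (t : int) : R := if t is Posz k.+1 then
  (if insub k is Some i then a i else 0)%R else 0%R.
have [m [s [s0 law]]] := gX [seq k.+1%:Z | k <- iota 0 n] a'.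
pose Y w : R := (\sum_(i < n) a i * X i.+1%:Z w)%R.
have YE w : (\sum_(t <- [seq k.+1%:Z | k <- iota 0 n]) a' t * X t w)%R = Y w.
  rewrite big_map (_ : iota 0 n = index_iota 0 n);
    last by rewrite /index_iota subn0.
  rewrite big_mkord; apply: eq_bigr => i _.
  by rewrite /a' insubT//= => ni; congr (a _ * _)%R; exact: val_inj.
have mY : measurable_fun [set: Om] Y.
  by apply: measurable_sum => i; exact: measurable_funM.
pose Y' : {mfun Om >-> RM} := HB.pack (Y : Om -> RM) (isMeasurableFun.Build _ _ _ RM Y mY).
have lawY (A : set RM) : measurable A -> distribution P Y' A = normal_law m s A.
  move=> mA; rewrite -(law A mA); congr (P _); apply/seteqP; split => w /=;
    by rewrite YE.
have iY (f : R -> R) : measurable_fun [set: R] f -> P.-integrable setT (fun w => (f (Y w))%:E) ->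
    \int[distribution P Y']_y (f y)%:E = \int[P]_w (f (Y w))%:E.
  move=> mf iff; rewrite integral_distribution//; exact/measurable_EFinP.
have linV w : (Y w - mu * \sum_(i < n) a i = \sum_(i < n) a i * V i.+1%:Z w)%R.
  rewrite mulr_sumr -sumrB; apply: eq_bigr => i _; rewrite /V; ring.
pose q := (mu * \sum_(i < n) a i)%R.
have isum : P.-integrable setT (fun w => (Y w - q)%:E).
  under eq_fun do rewrite linV -sumEFin.
  apply: integrable_sum => // i _; under eq_fun do rewrite EFinM; exact: integrableZl.
have Eq : \int[P]_w (Y w - q)%:E = 0.
  under eq_integral do rewrite linV -sumEFin.
  rewrite integral_sum//; last first.
    by move=> i; under eq_fun do rewrite EFinM; exact: integrableZl.
  by rewrite big1// => i _; under eq_integral do rewrite EFinM; rewrite integralZl// EV mule0.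
have mq : m = q.
  have ilin : P.-integrable setT (fun w => (Y w - m)%:E).
    have -> : (fun w => (Y w - m)%:E) = (fun w => (Y w - q)%:E + (q - m)%:E).
      by apply/funext => w; rewrite -EFinD; congr EFin; ring.
    apply: integrableD => //.
    apply: (@bounded_integrable_on _ _ _ P setT measurableT _ (fun=> q - m)%R `|q - m|%R) => //.
    by rewrite (le_lt_trans (probability_le1 _ _)) ?ltry.
  have := normal_law_mean lawY.
  rewrite (iY (fun y => y - m)%R)//; last exact: measurable_funB.
  have -> : \int[P]_w (Y w - m)%:E = (q - m)%:E.
    rewrite (_ : (fun w => _) = (fun w => (Y w - q)%:E + (q - m)%:E)); last first.
      by apply/funext => w; rewrite -EFinD; congr EFin; ring.
    rewrite integralD//; last first.
      apply: (@bounded_integrable_on _ _ _ P setT measurableT _ (fun=> q - m)%R `|q - m|%R) => //.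
      by rewrite (le_lt_trans (probability_le1 _ _)) ?ltry.
    by rewrite Eq integral_cst//= probability_setT mule1 add0e.
  by move=> h; apply/esym/subr0_eq/EFin_inj; exact: h.
have sqE w : ((Y w - m) ^+ 2)%R =
    (\sum_(i < n) \sum_(j < n) a i * a j * (V i.+1%:Z w * V j.+1%:Z w))%R.
  rewrite mq linV expr2 mulr_suml; apply: eq_bigr => i _.
  by rewrite mulr_sumr; apply: eq_bigr => j _; ring.
have iaVV i j : P.-integrable setT (fun w => (a i * a j * (V i.+1%:Z w * V j.+1%:Z w))%:E).
  by under eq_fun do rewrite EFinM; exact: integrableZl.
have isVV i : P.-integrable setT (fun w => \sum_(j < n) (a i * a j * (V i.+1%:Z w * V j.+1%:Z w))%:E).
  by apply: integrable_sum => // j _; exact: iaVV.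
have sE w : ((Y w - m) ^+ 2)%:E =
    \sum_(i < n) \sum_(j < n) (a i * a j * (V i.+1%:Z w * V j.+1%:Z w))%:E.
  by rewrite sqE -sumEFin; apply: eq_bigr => i _; rewrite sumEFin.
have s2E : (s ^+ 2)%R = (\sum_(i < n) \sum_(j < n) a i * a j * gamma (`|i%:Z - j%:Z|%N)%:Z)%R.
  apply: EFin_inj; rewrite -(normal_law_variance lawY).
  rewrite (iY (fun y => (y - m) ^+ 2)%R)/=; last 2 first.
  - by apply: measurable_funX; exact: measurable_funB.
  - under eq_fun do rewrite sE.
    by apply: integrable_sum => // i _; exact: isVV.
  under eq_integral do rewrite sE.
  rewrite integral_sum// -sumEFin; apply: eq_bigr => i _.
  rewrite integral_sum//.
  rewrite -sumEFin; apply: eq_bigr => j _.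
  under eq_integral do rewrite EFinM.
  rewrite integralZl// covE -EFinM; congr (_ * _)%:E.
  have -> : (j.+1%:Z - i.+1%:Z = j%:Z - i%:Z)%R by rewrite !intS opprD addrACA subrr add0r.
  have [ij|/ltnW ij] := leqP i j.
    by rewrite distnEr// subzn.
  by rewrite distnEl// -subzn// -autocovariance_even opprB.
have mcosb : measurable_fun [set: R] (fun y : R => cos (1 * y + b)).
  apply: (@measurableT_comp _ _ _ _ _ _ cos _ (fun y : R => 1 * y + b)%R).
    by apply: continuous_measurable_fun; exact: continuous_cos.
  by apply: measurable_funD => //; exact: measurable_funM.
have := normal_law_cos lawY 1 b.
rewrite (iY (fun y => cos (1 * y + b)))//; last first.
  apply: (@bounded_integrable_on _ _ _ P setT measurableT _ (fun w => cos (1 * Y w + b)) 1%R) => //.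
  - by rewrite (le_lt_trans (probability_le1 _ _)) ?ltry.
  - exact: (measurableT_comp mcosb).
  - by move=> w; exact: cos_max.
rewrite expr1n !mul1r s2E mq => <-; apply: eq_integral => w _; rewrite mul1r.
congr (cos (_ + _))%:E; rewrite /lin_form /Y; apply: eq_bigr => i _.
by rewrite tnth_mktuple.
Qed.

End sample_law.

(** * Testing two spectral densities through the channel *)

Section two_densities.
Context {R : realType} {d : measure_display} {Om : measurableType d} {n : nat}.
Variables (X : int -> {mfun Om >-> R}) (mu : R).
Implicit Types (P : probability Om R) (c : int -> R).

Let mean : n.-tuple R := [tuple mu | i < n].

(** Both laws have the same characteristic function. *)
Lemma sample_law P c K N (S : set (n.-tuple R)) : (0 < N)%N -> (n + K <= N)%N ->
  (forall j, c (- j) = c j) -> (forall j : nat, (K < j)%N -> c j%:Z = 0) ->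
  (forall w, 0 < cos_poly c K w) ->
  stationary_gaussian P X mu (cos_poly c K) -> measurable S ->
  P (sample n X @^-1` S) = gaussian_sum_law mean (latent c K N) S.
Proof.
move=> N0 nKN cN c0 f0 [gX EX [gamma [covX fs]]] mS.
have gN := autocovariance_even covX.
have gE k : gamma k = 2 * pi * c k.
  have pi0 := pi_gt0 R.
  have cN' j : gamma (- j) / (2 * pi) = gamma j / (2 * pi) by rewrite gN.
  have <- := fourier_coef_unique cN cN' c0 fs k.
  by rewrite mulrC divfK// gt_eqF// mulr_gt0.
have ms : measurable_fun [set: Om] (sample n X) by exact: measurable_sample.
pose smp : {mfun Om >-> n.-tuple R} := HB.pack (sample n X) (isMeasurableFun.Build _ _ _ _ (sample n X) ms).
rewrite -[LHS]/(distribution P smp S).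
apply: cramer_wold => // a b.
rewrite integral_distribution//; last 2 first.
- by apply/measurable_EFinP; exact: measurable_cos_lin.
- have := @bounded_integrable_on _ _ _ P setT measurableT _ (fun w => cos_lin a b (smp w)) 1.
  apply.
  + by rewrite (le_lt_trans (probability_le1 _ _)) ?ltry.
  + by apply: (measurableT_comp (measurable_cos_lin a b)).
  + by move=> w; exact: cos_max.
rewrite gaussian_sum_law_cos; last first.
  apply/allP => p; rewrite mem_cat => /orP[] /mapP[k _ ->] /=;
  by rewrite gt_eqF// sqrtr_gt0 divr_gt0 ?ltr0n// mulr_gt0// mulr_gt0// pi_gt0.
rewrite (sample_cos gX EX covX) (latent_variance _ c0 nKN); last first.
  by move=> w; exact: ltW.
congr (expR (- (_ / 2)) * cos (_ + _))%:E.
  by apply: eq_bigr => i _; apply: eq_bigr => j _; rewrite gE.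
by rewrite /lin_form mulr_sumr; apply: eq_bigr => i _; rewrite tnth_mktuple mulrC.
Qed.

Let pair_list c c' K N : seq (R * R * n.-tuple R) :=
  [seq (latent_std c K N k, latent_std c' K N k, cos_wave (grid_freq N k)) | k <- iota 0 N] ++
  [seq (latent_std c K N k, latent_std c' K N k, sin_wave (grid_freq N k)) | k <- iota 0 N].

(** The relative deviation of the variances at each grid frequency is at most
    dlt / m, so the sum of their squares over the 2N components is at most 1/4 and
    chi2_bound is at most 4/3. With weight w = 1 the testing lemma gives the error
    (4/3) / 4 = 1/3. *)
Lemma sample_testing P P' c c' K N (U : n.-tuple R -> R) (m dlt : R) :
  (0 < N)%N -> (n + K <= N)%N ->
  (forall j, c (- j) = c j) -> (forall j : nat, (K < j)%N -> c j%:Z = 0) ->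
  (forall j, c' (- j) = c' j) -> (forall j : nat, (K < j)%N -> c' j%:Z = 0) ->
  0 < m -> (forall w, m <= cos_poly c K w) -> (forall w, m <= cos_poly c' K w) ->
  (forall w, `|cos_poly c' K w - cos_poly c K w| <= dlt) ->
  N%:R * dlt ^+ 2 <= m ^+ 2 / 8 ->
  stationary_gaussian P X mu (cos_poly c K) ->
  stationary_gaussian P' X mu (cos_poly c' K) ->
  measurable_fun [set: n.-tuple R] U -> (forall x, 0 <= U x <= 1) ->
  (\int[P']_w (U (sample n X w))%:E <= \int[P]_w (U (sample n X w))%:E + (3^-1)%:E)%E.
Proof.
move=> N0 nKN cN c0 cN' c0' m0 fm fm' dl small sP sP' mU U01.
have NR : (0 : R) < N%:R by rewrite ltr0n.
have f0 w : 0 < cos_poly c K w by exact: lt_le_trans (fm w).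
have f0' w : 0 < cos_poly c' K w by exact: lt_le_trans (fm' w).
have ms : measurable_fun [set: Om] (sample n X) by exact: measurable_sample.
pose smp : {mfun Om >-> n.-tuple R} := HB.pack (sample n X) (isMeasurableFun.Build _ _ _ _ (sample n X) ms).
have mUE : measurable_fun [set: n.-tuple R] (EFin \o U) by exact/measurable_EFinP.
have tr (Q : probability Om R) c'' : (forall j, c'' (- j) = c'' j) ->
    (forall j : nat, (K < j)%N -> c'' j%:Z = 0) -> (forall w, 0 < cos_poly c'' K w) ->
    stationary_gaussian Q X mu (cos_poly c'' K) ->
    (\int[Q]_w (U (sample n X w))%:E = \int[gaussian_sum_law mean (latent c'' K N)]_x (U x)%:E)%E.
  move=> H1 H2 H3 H4; transitivity (\int[distribution Q smp]_x (U x)%:E)%E.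
    by rewrite ge0_integral_distribution// => x; rewrite lee_fin; have /andP[] := U01 x.
  by apply: eq_measure_integral => S mS _; exact: (sample_law N0 nKN).
rewrite (tr P' c')// (tr P c)//.
pose l := pair_list c c' K N.
have -> : latent c' K N = right_list l by rewrite /right_list /l map_cat -!map_comp.
have -> : latent c K N = left_list l by rewrite /left_list /l map_cat -!map_comp.
have vd k : var_dev (latent_std c K N k) (latent_std c' K N k) =
    (cos_poly c' K (grid_freq N k) - cos_poly c K (grid_freq N k)) / cos_poly c K (grid_freq N k).
  have pi0 := pi_gt0 R.
  rewrite /var_dev /latent_std !sqr_sqrtr; [|by rewrite divr_ge0// mulr_ge0// ?mulr_ge0// ltW..].
  have E (p x y z : R) : 0 < p -> 0 < x -> 0 < z ->
      2 * p * y / z / (2 * p * x / z) - 1 = (y - x) / x.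
    by move=> p0 x0 z0; field; rewrite !gt_eqF.
  exact: E.
have vd2 k : var_dev (latent_std c K N k) (latent_std c' K N k) ^+ 2 <= dlt ^+ 2 / m ^+ 2.
  rewrite vd -expr_div_n -[X in X <= _]real_normK ?num_real//.
  have d0 : 0 <= dlt by apply: le_trans (dl 0).
  rewrite lerXn2r ?nnegrE ?divr_ge0 ?(ltW m0)// normrM normfV ler_pM ?invr_ge0//.
  by rewrite (gtr0_norm (f0 _)) lef_pV2 ?posrE.
have dm : N%:R * (dlt ^+ 2 / m ^+ 2) <= 8^-1.
  by rewrite mulrA ler_pdivrMr ?exprn_gt0// [X in _ <= X]mulrC.
have dm1 : dlt ^+ 2 / m ^+ 2 <= 8^-1.
  apply: le_trans dm; rewrite ler_peMl ?ler1n// divr_ge0 ?sqr_ge0//.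
have al : all admissible_pair l.
  have std0 c'' k : (forall w, 0 < cos_poly c'' K w) -> 0 < latent_std c'' K N k.
    by move=> h; rewrite sqrtr_gt0 divr_gt0// mulr_gt0// mulr_gt0// pi_gt0.
  have vd1 k : `|var_dev (latent_std c K N k) (latent_std c' K N k)| < 1.
    rewrite -[X in _ < X](ger0_norm ler01) -ltr_sqr ?nnegrE// !real_normK ?num_real//.
    by apply: le_lt_trans (vd2 k) _; rewrite expr1n; lra.
  apply/allP => p; rewrite mem_cat => /orP[] /mapP[k _ ->];
  by rewrite /admissible_pair /= !std0//= vd1.
have sum4 : \sum_(p <- l) var_dev p.1.1 p.1.2 ^+ 2 <= 4^-1.
  rewrite /l big_cat !big_map /= (_ : iota 0 N = index_iota 0 N); last by rewrite /index_iota subn0.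
  rewrite big_mkord.
  have : \sum_(k < N) var_dev (latent_std c K N k) (latent_std c' K N k) ^+ 2 <= 8^-1.
    apply: le_trans dm; rewrite -[N in N%:R]card_ord mulr_natl -sumr_const.
    by apply: ler_sum => k _; exact: vd2.
  lra.
have chi := chi2_bound_le al sum4 ltac:(lra).
have := gaussian_testing mean al mU U01 ler01.
rewrite mul1e => /le_trans; apply; rewrite leeD2l// lee_fin expr1n.
by move: chi; rewrite (_ : (1 - 4^-1)^-1 = 4 / 3 :> R); [lra|field].
Qed.

End two_densities.

Lemma private_testing (R : realType) (dZ d : measure_display) (ZT : measurableType dZ)
  (Om : measurableType d) (n : nat) (Q : channel R ZT n)
  (X : int -> {mfun Om >-> R}) (Z : 'I_n -> {mfun Om >-> ZT}) (mu : R)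
  (P P' : probability Om R) (c c' : int -> R) (K N : nat) (m dlt : R)
  (S : set (n.-tuple ZT)) :
  (0 < N)%N -> (n + K <= N)%N ->
  (forall j, c (- j) = c j) -> (forall j : nat, (K < j)%N -> c j%:Z = 0) ->
  (forall j, c' (- j) = c' j) -> (forall j : nat, (K < j)%N -> c' j%:Z = 0) ->
  0 < m -> (forall w, m <= cos_poly c K w) -> (forall w, m <= cos_poly c' K w) ->
  (forall w, `|cos_poly c' K w - cos_poly c K w| <= dlt) ->
  N%:R * dlt ^+ 2 <= m ^+ 2 / 8 ->
  stationary_gaussian P X mu (cos_poly c K) ->
  stationary_gaussian P' X mu (cos_poly c' K) ->
  privatized P X Z Q -> privatized P' X Z Q -> measurable S ->
  (P' (outputs Z @^-1` S) <= P (outputs Z @^-1` S) + (3^-1)%:E)%E.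
Proof.
move=> N0 nKN cN c0 cN' c0' m0 fm fm' dl small sP sP' pP pP' mS.
have [U [mU U01 UE]] := data_processing Q X Z mS.
rewrite !UE//.
exact: (sample_testing N0 nKN cN c0 cN' c0' m0 fm fm' dl small sP sP').
Qed.

(** * A hypercube of spectral densities *)

Lemma esum_finite_support (R : realType) (g : int -> R) (K : nat) :
  (forall j, 0 <= g j) -> (forall j : int, (K < `|j|)%N -> g j = 0) ->
  (\esum_(j in [set: int]) (g j)%:E = (\sum_(i < K.*2.+1) g (i%:Z - K%:Z))%:E)%E.
Proof.
move=> g0 gK.
have E (j : int) : ((g j)%:E = \sum_(i < K.*2.+1)
    (if j \in [set (i%:Z - K%:Z)%R] then (g j)%:E else 0))%E.
  have [jK|Kj] := leqP `|j|%N K; last first.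
    by rewrite gK// big1// => i _; case: ifP.
  have [i ij] : exists i : 'I_K.*2.+1, (i%:Z - K%:Z)%R = j.
    have jK0 : (0 <= j + K%:Z)%R by move: jK; case: j => k /=; lia.
    have iK : (`|(j + K%:Z)%R|%N < K.*2.+1)%N.
      by move: jK jK0; rewrite -muln2; case: j => k /=; lia.
    by exists (Ordinal iK) => /=; rewrite gez0_abs// addrK.
  rewrite (bigD1 i)//= ij mem_set// big1 ?adde0// => i' i'i.
  rewrite memNset//= => ji'; move/negP: i'i; apply; apply/eqP/val_inj => /=.
  by move: ij; rewrite ji' => /addIr [].
under eq_esum do rewrite E.
rewrite esum_sum; last by move=> j i _ _; case: ifP; rewrite ?lee_fin.
rewrite -sumEFin; apply: eq_bigr => i _.
by rewrite -esum_mkcond esum_set1// lee_fin.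
Qed.

Section hypercube.
Context {R : realType}.
Variables (K : nat) (a r : R).
Hypotheses (a_ge0 : 0 <= a) (r_ge0 : 0 <= r).
Implicit Types th : {ffun 'I_K -> bool}.

Definition cube_coef th (j : int) : R :=
  if j == 0 then a else
  if insub `|j|.-1 is Some i then (th i)%:R * r else 0.

Lemma cube_coef0 th : cube_coef th 0 = a.
Proof. by rewrite /cube_coef eqxx. Qed.

Lemma cube_coefS th (i : 'I_K) : cube_coef th i.+1%:Z = (th i)%:R * r.
Proof. by rewrite /cube_coef /= insubT//= => iK; congr ((th _)%:R * r); exact: val_inj. Qed.

Lemma cube_coef_even th j : cube_coef th (- j) = cube_coef th j.
Proof. by rewrite /cube_coef oppr_eq0 abszN. Qed.

Lemma cube_coef_support th (j : int) : (K < `|j|)%N -> cube_coef th j = 0.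
Proof.
move=> Kj; rewrite /cube_coef ifN; last by apply: contraTneq Kj => ->.
by rewrite insubN// -leqNgt -ltnS prednK//; apply: leq_ltn_trans Kj.
Qed.

Lemma cube_coef_bound th (j : int) : j != 0 -> 0 <= cube_coef th j <= r.
Proof.
move=> j0; rewrite /cube_coef (negbTE j0); case: insub => [i|]; last by rewrite lexx.
by case: (th i); rewrite ?mul1r ?mul0r ?lexx r_ge0.
Qed.

Definition cube_density th : R -> R := cos_poly (cube_coef th) K.

Lemma cube_densityE th w :
  cube_density th w = a + \sum_(j < K) 2 * ((th j)%:R * r) * cosn j.+1 w.
Proof. by rewrite /cube_density /cos_poly cube_coef0; under eq_bigr do rewrite cube_coefS. Qed.

Lemma cube_density_ge th w : a - 2 * r * K%:R <= cube_density th w.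
Proof.
rewrite cube_densityE lerD2l.
have -> : - (2 * r * K%:R) = \sum_(j < K) - (2 * r).
  by rewrite sumr_const card_ord -mulNr mulr_natr.
apply: ler_sum => j _.
have := cosn_max j.+1 w; rewrite ler_norml => /andP[c1 c2].
by move: r_ge0; case: (th j) => /= r0; rewrite ?mul1r ?mul0r ?mulr0 ?mul0r; nra.
Qed.

Definition flip (j : 'I_K) th : {ffun 'I_K -> bool} :=
  [ffun i => if i == j then ~~ th i else th i].

Lemma flipK j : involutive (flip j).
Proof. by move=> th; apply/ffunP => i; rewrite !ffunE; case: eqP => // _; rewrite negbK. Qed.

Lemma cube_density_flip j th w :
  `|cube_density (flip j th) w - cube_density th w| <= 2 * r.
Proof.
rewrite !cube_densityE opprD addrACA subrr add0r -sumrB (bigD1 j)//= big1 ?addr0; last first.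
  by move=> i ij; rewrite ffunE (negbTE ij) subrr.
rewrite ffunE eqxx -mulrBl -mulrBr -mulrBl normrM.
have := cosn_max j.+1 w => c1; have cn := normr_ge0 (cosn j.+1 w).
have -> : `|2 * (((~~ th j)%:R - (th j)%:R) * r)| = 2 * r.
  case: (th j) => /=; rewrite ?sub0r ?subr0 ?mulN1r ?mul1r ?mulrN ?normrN ger0_norm//;
  by rewrite mulr_ge0.
by rewrite ler_piMr// mulr_ge0.
Qed.

Lemma cube_density_in_class beta L th : weight_sequence beta ->
  0 <= a - 2 * r * K%:R ->
  a ^+ 2 + (K.*2.+1)%:R * (r ^+ 2 * beta K%:Z ^+ 2) <= L ^+ 2 ->
  spectral_class beta L (cube_density th).
Proof.
move=> [b0 bN b1 bm] pos ell; split.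
  by move=> w _; apply: le_trans pos (cube_density_ge _ _).
exists (cube_coef th); split.
  apply: fourier_series_cos_poly; first exact: cube_coef_even.
  by move=> j Kj; exact: cube_coef_support.
rewrite (@esum_finite_support _ _ K); last 2 first.
- by move=> j; rewrite mulr_ge0 ?sqr_ge0.
- by move=> j Kj; rewrite cube_coef_support// expr0n mul0r.
rewrite lee_fin; apply: le_trans ell.
pose B := r ^+ 2 * beta K%:Z ^+ 2.
have B0 : 0 <= B by rewrite mulr_ge0 ?sqr_ge0.
have habs (j : int) : beta j = beta `|j|%N%:Z.
  by case: j => k //; rewrite NegzE bN abszN.
(* The index i = K of the centered sum carries the constant term, of weight 1;
   each of the others contributes at most r^2 beta_K^2. *)
have H (i : 'I_K.*2.+1) : cube_coef th (i%:Z - K%:Z) ^+ 2 * beta (i%:Z - K%:Z) ^+ 2 <=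
    (if i == inord K then a ^+ 2 else 0) + B.
  have KK : (K < K.*2.+1)%N by rewrite ltnS -addnn leq_addr.
  have [->|iK] := eqVneq i (inord K).
    by rewrite inordK// subrr cube_coef0 b1 expr1n mulr1 lerDl.
  rewrite add0r; have j0 : i%:Z - K%:Z != 0.
    rewrite subr_eq0; apply: contra iK => /eqP[iK]; apply/eqP/val_inj.
    by rewrite /= inordK.
  have /andP[c0 c1] := cube_coef_bound th j0.
  apply: ler_pM; rewrite ?sqr_ge0// lerXn2r ?nnegrE//; try exact: ltW.
  rewrite habs; apply: bm; have iK2 : (i < (K * 2).+1)%N by rewrite muln2.
  move: (nat_of_ord i) iK2 => k iK2.
  by have [ij|/ltnW ij] := leqP K k; [rewrite distnEl//|rewrite distnEr//]; lia.
apply: (le_trans (ler_sum _ (fun i _ => H i))).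
rewrite big_split /= -big_mkcond big_pred1_eq sumr_const card_ord mulr_natl.
exact: lexx.
Qed.

End hypercube.

(** * Reading a coordinate of the hypercube off an estimator *)

Section section_integral.
Context {R : realType} {d : measure_display} {T : measurableType d}.
Local Notation RM := (measurableTypeR R).
Local Notation mu := (@lebesgue_measure R).
Local Notation D := (@frequencies R).
Local Open Scope ereal_scope.

Lemma measurable_fun_section_integral (f : T * RM -> \bar R) :
  measurable_fun [set: T * RM] f ->
  measurable_fun [set: T] (fun z => \int[mu]_(u in D) f (z, u)).
Proof.
move=> mf.
have ge0 (g : T * RM -> \bar R) : measurable_fun [set: T * RM] g -> (forall p, 0 <= g p) ->
    measurable_fun [set: T] (fun z => \int[mu]_(u in D) g (z, u)).
  move=> mg g0.
  rewrite (_ : (fun z => _) = fubini_F mu (fun p : T * RM => g p * (\1_D p.2)%:E)); last first.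
    apply/funext => z; rewrite /fubini_F [LHS]integral_mkcond; apply: eq_integral => u _ /=.
    by rewrite patchE indicE; case: (u \in D); rewrite ?mule1 ?mule0.
  apply: measurable_fun_fubini_tonelli_F.
  - apply: emeasurable_funM => //; apply/measurable_EFinP.
    apply: (@measurableT_comp _ _ _ _ _ _ (\1_D : RM -> R)); last exact: measurable_snd.
    by apply: measurable_indic; exact: measurable_frequencies.
  - by move=> p; rewrite mule_ge0// lee_fin.
rewrite (_ : (fun z => _) = (fun z => \int[mu]_(u in D) f^\+ (z, u)) \-
    (fun z => \int[mu]_(u in D) f^\- (z, u))); last first.
  apply/funext => z; rewrite integralE.
  by congr (_ - _); apply: eq_integral => u _; rewrite ?funeposE ?funenegE.
by apply: emeasurable_funB; apply: ge0 => //; [exact: measurable_funepos|exact: measurable_funeneg].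
Qed.

End section_integral.

Section detection.
Context {R : realType} {dZ : measure_display} {ZT : measurableType dZ} {n : nat}.
Local Notation RM := (measurableTypeR R).
Local Notation mu := (@lebesgue_measure R).
Local Notation D := (@frequencies R).
Variables (g : @estimator R dZ ZT n) (K : nat) (a r : R).
Hypotheses (r_gt0 : 0 < r).

Let mg : measurable_fun [set: n.-tuple ZT * RM] g.
Proof. exact: (@measurable_funPT _ _ _ _ g). Qed.

(** The j-th Fourier coefficient of the estimate exceeds the midpoint r / 2 between
    its two possible values 0 and r, that is, its integral against the cosine exceeds
    pi r. *)
Definition detected (j : nat) : set (n.-tuple ZT) :=
  [set z | ((r * pi)%:E <= \int[mu]_(u in D) (g (z, u) * cosn j.+1 u)%:E)%E].

Lemma measurable_detected j : measurable (detected j).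
Proof.
have mf : measurable_fun [set: n.-tuple ZT]
    (fun z => \int[mu]_(u in D) (g (z, u) * cosn j.+1 u)%:E)%E.
  apply: (@measurable_fun_section_integral _ _ _ (fun p => (g p * cosn j.+1 p.2)%:E)).
  apply/measurable_EFinP; apply: measurable_funM => //.
  apply: (@measurableT_comp _ _ _ _ _ _ (cosn j.+1 : RM -> R)); last exact: measurable_snd.
  exact: measurable_cosn.
by rewrite /detected -[X in measurable X]setTI; apply: emeasurable_fun_c_infty.
Qed.

(** A wrong bit means that the estimate and the density differ by at least pi r when
    integrated against the cosine, and Bessel's inequality adds up the contributions
    r^2 pi of the wrong bits. When the loss is infinite the bound is trivial. *)
Lemma detection_loss (th : {ffun 'I_K -> bool}) z :
  ((pi * r ^+ 2 * \sum_(j < K) ((z \in detected j) != th j)%:R)%:E <=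
   \int[mu]_(u in D) ((g (z, u) - cube_density a r th u) ^+ 2)%:E)%E.
Proof.
have pi0 := pi_gt0 R.
pose h u := g (z, u) - cube_density a r th u.
have mgz : measurable_fun [set: RM] (fun u => g (z, u)).
  by apply: (measurableT_comp mg); exact: pair1_measurable.
have mD := @measurable_frequencies R.
have mh : measurable_fun D h.
  by apply: measurable_funB; [exact: measurable_funTS|exact: measurable_cos_poly].
have [fin|inf] := boolP (\int[mu]_(u in D) (h u ^+ 2)%:E < +oo)%E; last first.
  by move: inf; rewrite -leNgt leye_eq => /eqP ->; exact: leey.
have sh : square_integrable mu D h.
  split => //; apply/integrableP; split; first by apply/measurable_EFinP; exact: measurable_funX.
  by under eq_integral do rewrite gee0_abs ?lee_fin ?sqr_ge0//.
have ih2 := sh.2.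
rewrite -[X in (_ <= X)%E]fineK; last exact: (integrable_fin_num mD ih2).
rewrite lee_fin; apply: le_trans (bessel_cosn K sh).
rewrite mulr_sumr; apply: ler_sum => j _.
have if_ : mu.-integrable D (EFin \o (fun u => cube_density a r th u * cosn j.+1 u)).
  have := @bounded_integrable_on _ _ _ mu D mD measure_frequencies_fin
    (fun u => cube_density a r th u * cosn j.+1 u)
    (`|cube_coef a r th 0| + \sum_(j < K) `|2 * cube_coef a r th j.+1%:Z|).
  apply; first by apply: measurable_funM; [exact: measurable_cos_poly|exact: measurable_cosn].
  move=> x; rewrite normrM -[X in _ <= X]mulr1 ler_pM//; first exact: cos_poly_bound.
  exact: cosn_max.
have ihc : mu.-integrable D (EFin \o (fun u => h u * cosn j.+1 u)).
  have mc : measurable_fun D (cosn j.+1) by exact: measurable_cosn.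
  exact: (@square_integrable_mul _ _ _ mu D mD measure_frequencies_fin h (cosn j.+1) sh mc (cosn_max _)).
have igE : (\int[mu]_(u in D) (g (z, u) * cosn j.+1 u)%:E =
    (\int[mu]_(u in D) (h u * cosn j.+1 u) + 2 * pi * ((th j)%:R * r))%:E)%E.
  rewrite -(cube_coefS a r th j) -(@integral_cos_polyM _ (cube_coef a r th) K j.+1 (ltn_ord j)).
  rewrite -RintegralD// /Rintegral fineK.
    by apply: eq_integral => u _; congr EFin; rewrite -mulrDl /h subrK.
  exact: (integrable_fin_num mD (integrableD mD ihc if_)).
set I := \int[mu]_(u in D) (h u * cosn j.+1 u) in igE *.
case: eqVneq => [_|wrong].
  by rewrite mulr0 divr_ge0 ?sqr_ge0// ltW.
rewrite mulr1 ler_pdivlMr// mulrAC -expr2 -exprMn.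
have : pi * r <= `|I|.
  move: wrong; case: (th j) igE => igE.
    rewrite eqb_id => /negP nd.
    have {}nd : I + 2 * pi * r < r * pi.
      rewrite ltNge; apply/negP => le1; apply: nd; rewrite inE /detected /= igE lee_fin.
      by rewrite mul1r.
    by rewrite -normrN; apply: le_trans (ler_norm _); move: nd; rewrite (mulrC r pi); nra.
  rewrite eqbF_neg negbK inE /detected /= igE lee_fin mul0r mulr0 addr0 => h1.
  by apply: le_trans (ler_norm _); rewrite mulrC.
move=> h1; rewrite -[X in _ <= X]real_normK ?num_real// lerXn2r ?nnegrE// mulr_ge0// ltW//.
Qed.

End detection.

(** * Minimax risk over the hypercube *)

(** Average over the whole cube: flipping the j-th bit is an involution, so twice the
    sum over th of p th j is the sum over th of p th j + p (flip j th) j. *)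
Lemma assouad_average (R : realType) (K : nat) (c : R) (p : {ffun 'I_K -> bool} -> 'I_K -> R) :
  (forall th j, c *+ 2 <= p th j + p (flip j th) j) ->
  exists th, K%:R * c <= \sum_(j < K) p th j.
Proof.
move=> pair; apply/not_existsP => small.
have lt_sum th : \sum_(j < K) p th j < K%:R * c by rewrite ltNge; apply/negP.
pose T := {ffun 'I_K -> bool}.
have : \sum_(th : T) \sum_(j < K) p th j < \sum_(th : T) K%:R * c.
  rewrite (bigD1 [ffun=> false])//= [X in _ < X](bigD1 [ffun=> false])//=.
  by apply: ltr_leD => //; apply: ler_sum => th _; exact: ltW.
rewrite ltNge => /negP; apply.
rewrite [leRHS]exchange_big/= -(ler_pM2r (ltr0Sn R 1)) !mulr_suml.
have -> : \sum_(th : T) K%:R * c * 2 = \sum_(j < K) \sum_(th : T) c * 2.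
  rewrite exchange_big/=; apply: eq_bigr => th _.
  by rewrite sumr_const card_ord -[RHS]mulr_natl mulrA.
apply: ler_sum => j _.
have -> : (\sum_(th : T) p th j) * 2 = \sum_(th : T) (p th j + p (flip j th) j).
  rewrite big_split/= -(reindex_inj (can_inj (flipK j)) (P := xpredT) (F := fun th => p th j))/=.
  by rewrite mulr_natr mulr2n.
by apply: ler_sum => th _; rewrite mulr_natr.
Qed.

Section assouad.
Context {R : realType} {dO dZ : measure_display} {Om : measurableType dO}
  {ZT : measurableType dZ} {n : nat}.
Variables (Q : channel R ZT n) (P : (R -> R) -> probability Om R)
  (X : int -> {mfun Om >-> R}) (Z : 'I_n -> {mfun Om >-> ZT})
  (beta : int -> R) (L mu : R) (K : nat) (a r : R).
Hypotheses (K_gt0 : (0 < K)%N) (a_ge0 : 0 <= a) (r_gt0 : 0 < r)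
  (wbeta : weight_sequence beta)
  (pos : 0 < a - 2 * r * K%:R)
  (ellipsoid : a ^+ 2 + (K.*2.+1)%:R * (r ^+ 2 * beta K%:Z ^+ 2) <= L ^+ 2)
  (close : (n + K)%:R * (2 * r) ^+ 2 <= (a - 2 * r * K%:R) ^+ 2 / 8)
  (PE : private_experiment (spectral_class beta L) mu Q P X Z).
Local Notation leb := (@lebesgue_measure R).
Local Notation D := (@frequencies R).
Local Notation f th := (cube_density a r th).

Let measurable_outputs : measurable_fun [set: Om] (outputs Z).
Proof.
by apply/measurable_fun_tnthP => i; rewrite (_ : _ \o _ = Z i)//;
  apply/funext => w /=; rewrite tnth_mktuple.
Qed.

Definition wrong (g : @estimator R dZ ZT n) (th : {ffun 'I_K -> bool}) (j : 'I_K) : set (n.-tuple ZT) :=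
  [set z | (z \in detected g r j) != th j].

Lemma measurable_wrong g th j : measurable (wrong g th j).
Proof.
have md := measurable_detected g r j; rewrite /wrong; case: (th j).
  rewrite (_ : mkset _ = ~` detected g r j); first exact: measurableC.
  by apply/funext => z; apply/propext; rewrite /= eqb_id; split => [/negP nz /mem_set|nz] //;
    apply/negP => /set_mem.
rewrite (_ : mkset _ = detected g r j)//.
by apply/seteqP; split => z /=; rewrite eqbF_neg negbK in_setE.
Qed.

Lemma wrong_flip g th j : wrong g (flip j th) j = ~` wrong g th j.
Proof.
apply/seteqP; split => z; rewrite /wrong /= ffunE eqxx;
  by case: (z \in _); case: (th j).
Qed.

Lemma risk_ge_wrong g th :
  ((pi * r ^+ 2 * \sum_(j < K) fine (P (f th) (outputs Z @^-1` wrong g th j)))%:E <=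
   L2_risk (P (f th)) Z g (f th))%E.
Proof.
have mw j : measurable (outputs Z @^-1` wrong g th j).
  by rewrite -[X in measurable X]setTI; apply: measurable_outputs => //; exact: measurable_wrong.
have c0 : 0 <= pi * r ^+ 2 by rewrite mulr_ge0 ?sqr_ge0 ?pi_ge0.
have -> : (pi * r ^+ 2 * \sum_(j < K) fine (P (f th) (outputs Z @^-1` wrong g th j)))%:E =
  (\int[P (f th)]_w (pi * r ^+ 2 * \sum_(j < K) \1_(outputs Z @^-1` wrong g th j) w)%:E)%E.
  under eq_integral do rewrite EFinM -sumEFin.
  rewrite ge0_integralZl//; last 2 first.
  - apply: emeasurable_sum => j; apply/measurable_EFinP; exact: measurable_indic.
  - by move=> w _; apply: sume_ge0 => j _; rewrite lee_fin.
  rewrite ge0_integral_sum//; last first.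
    by move=> j; apply/measurable_EFinP; exact: measurable_indic.
  rewrite EFinM -sumEFin; congr (_ * _)%E; apply: eq_bigr => j _.
  by rewrite integral_indic// setIT fineK// fin_num_measure.
rewrite /L2_risk; apply: ge0_le_integral => //.
- by move=> w _; rewrite lee_fin mulr_ge0// sumr_ge0.
- apply/measurable_EFinP; apply: measurable_funM => //.
  by apply: measurable_sum => j; exact: measurable_indic.
- pose loss (p : n.-tuple ZT * measurableTypeR R) := ((g p - f th p.2) ^+ 2)%:E.
  have ml : measurable_fun [set: _] (fun z => \int[leb]_(u in D) loss (z, u))%E.
    apply: measurable_fun_section_integral.
    apply/measurable_EFinP; apply: measurable_funX; apply: measurable_funB.
      exact: (@measurable_funPT _ _ _ _ g).
    apply: (@measurableT_comp _ _ _ _ _ _ (f th : measurableTypeR R -> R)); last exact: measurable_snd.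
    exact: measurable_cos_poly.
  exact: (measurableT_comp ml).
- move=> w _; apply: le_trans (detection_loss g a r_gt0 th (outputs Z w)).
  rewrite lee_fin; apply: ler_wpM2l => //; apply: ler_sum => j _.
  by rewrite indicE mem_setE.
Qed.

(** The error probabilities of a test between th and its flip along j add up to at
    least 1 - 1/3, so some vertex of the cube has K / 3 wrong bits on average, each
    costing pi r^2. *)
Theorem assouad_minimax :
  ((pi * r ^+ 2 * K%:R / 3)%:E <= minimax_risk (spectral_class beta L) P Z)%E.
Proof.
have class (th : {ffun 'I_K -> bool}) : spectral_class beta L (f th).
  exact: (cube_density_in_class a_ge0 (ltW r_gt0) th wbeta (ltW pos) ellipsoid).
apply: le_ereal_inf_tmp => _ [g _ <-].
have mw (th : {ffun 'I_K -> bool}) j := measurable_wrong g th j.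
have mow (th : {ffun 'I_K -> bool}) j : measurable (outputs Z @^-1` wrong g th j).
  by rewrite -[X in measurable X]setTI; exact: measurable_outputs.
pose p (th : {ffun 'I_K -> bool}) j := fine (P (f th) (outputs Z @^-1` wrong g th j)).
have [th pth] : exists th, K%:R * 3^-1 <= \sum_(j < K) p th j.
  apply: assouad_average => th j.
  have [sP pP] := PE (class th); have [sP' pP'] := PE (class (flip j th)).
  have nK0 : (0 < n + K)%N by rewrite addn_gt0 K_gt0 orbT.
  have cs (t : {ffun 'I_K -> bool}) (i : nat) : (K < i)%N -> cube_coef a r t i%:Z = 0.
    by move=> Ki; exact: cube_coef_support.
  have := private_testing nK0 (leqnn _) (cube_coef_even a r th) (cs th)
    (cube_coef_even a r (flip j th)) (cs (flip j th)) pos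
    (cube_density_ge a (ltW r_gt0) th) (cube_density_ge a (ltW r_gt0) (flip j th))
    (cube_density_flip a (ltW r_gt0) j th) close sP sP' pP pP' (mw th j).
  rewrite /p wrong_flip preimage_setC probability_setC; last exact: mow.
  rewrite -(fineK (fin_num_measure (P (f th)) _ (mow th j))).
  rewrite -(fineK (fin_num_measure (P (f (flip j th))) _ (mow th j))) -EFinB -EFinD lee_fin /=.
  by rewrite mulr2n => H; lra.
apply: (@le_trans _ _ (L2_risk (P (f th)) Z g (f th))); last first.
  by apply: ereal_sup_ubound; exists (f th).
apply: le_trans (risk_ge_wrong g th).
rewrite lee_fin -[leLHS]mulrA; apply: ler_wpM2l pth; exact: mulr_ge0 (pi_ge0 R) (sqr_ge0 r).
Qed.

End assouad.

(** The cube has side L / (32 sqrt n), short enough that neighbouring vertices cannot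
    be told apart from n observations, while K^2 <= 16 n keeps the densities above L / 4
    and K beta_K^2 <= n keeps the cube inside the ellipsoid. *)
Theorem minimax_lower_bound (R : realType) (dO dZ : measure_display) (Om : measurableType dO)
  (ZT : measurableType dZ) (n : nat) (Q : channel R ZT n)
  (P : (R -> R) -> probability Om R) (X : int -> {mfun Om >-> R})
  (Z : 'I_n -> {mfun Om >-> ZT}) (beta : int -> R) (L mu : R) (K : nat) :
  0 < L -> weight_sequence beta -> (0 < K)%N -> (K <= n)%N ->
  (K ^ 2 <= 16 * n)%N -> K%:R * beta K%:Z ^+ 2 <= n%:R ->
  private_experiment (spectral_class beta L) mu Q P X Z ->
  ((L ^+ 2 * K%:R / (1536 * n%:R))%:E <= minimax_risk (spectral_class beta L) P Z)%E.
Proof.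
move=> L0 wb K0 Kn K16 Kb PE.
have n0 : 0 < n%:R :> R by rewrite ltr0n (leq_trans K0).
have K1 : 1 <= K%:R :> R by rewrite ler1n.
have Knr : K%:R <= n%:R :> R by rewrite ler_nat.
have K16r : K%:R ^+ 2 <= 16 * n%:R :> R by rewrite -natrX -natrM ler_nat.
pose s := Num.sqrt (n%:R : R); have s0 : 0 < s by rewrite sqrtr_gt0.
have sn : s ^+ 2 = n%:R by rewrite sqr_sqrtr// ltW.
(* The constant 32 is what makes 2 r K <= L / 4 when K <= 4 s, and 2 n (2 r)^2
   equal to (L / 4)^2 / 8. *)
pose r := L / (32 * s); have r0 : 0 < r by rewrite divr_gt0// mulr_gt0.
have r2 : r ^+ 2 = L ^+ 2 / (1024 * n%:R).
  by rewrite -sn /r; field; rewrite gt_eqF.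
have Ks : K%:R <= 4 * s.
  rewrite -(@ler_pXn2r _ 2)// ?nnegrE ?mulr_ge0 ?(ltW s0)//.
  by rewrite exprMn sn; apply: le_trans K16r _; lra.
have rK : 2 * r * K%:R <= L / 4.
  have -> : 2 * r * K%:R = (L / 16) * (K%:R / s) by rewrite /r; field; rewrite gt_eqF.
  have : K%:R / s <= 4 by rewrite ler_pdivrMr.
  by move=> h; nra.
have pos : L / 4 <= L / 2 - 2 * r * K%:R by lra.
have m0 : 0 < L / 2 - 2 * r * K%:R by apply: lt_le_trans pos; rewrite divr_gt0.
have rn : r ^+ 2 * n%:R = L ^+ 2 / 1024 by rewrite r2; field; rewrite gt_eqF.
have r20 : 0 < r ^+ 2 by rewrite exprn_gt0.
apply: le_trans (assouad_minimax (a := L / 2) (r := r) K0 _ r0 wb m0 _ _ PE).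
- rewrite lee_fin.
  have -> : L ^+ 2 * K%:R / (1536 * n%:R) = 2 * r ^+ 2 * K%:R / 3.
    by rewrite r2; field; rewrite gt_eqF.
  rewrite ler_pM2r ?invr_gt0// ler_pM2r ?(lt_le_trans ltr01)// ler_pM2r//.
  exact: pi_ge2.
- by rewrite divr_ge0// ltW.
- have -> : (K.*2.+1)%:R = 2 * K%:R + 1 :> R by rewrite -natr1 -muln2 natrM mulrC.
  have b0 := sqr_ge0 (beta K%:Z).
  rewrite mulrCA; have : (2 * K%:R + 1) * beta K%:Z ^+ 2 <= 3 * n%:R by nra.
  by rewrite -(ler_pM2l r20) [X in _ <= X]mulrCA rn; nra.
- apply: (@le_trans _ _ ((L / 4) ^+ 2 / 8)); last first.
    by rewrite ler_pM2r ?invr_gt0// lerXn2r ?nnegrE ?(ltW m0)// divr_ge0// ltW.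
  rewrite natrD exprMn; have : (n%:R + K%:R) * r ^+ 2 <= 2 * (r ^+ 2 * n%:R) by nra.
  by rewrite rn; nra.
Qed.

(** * The optimal dimension in the bias-variance tradeoff *)

Section tradeoff.
Variable R : realType.
Implicit Types beta : int -> R.

Lemma approx_sq_gt0 beta k : weight_sequence beta -> 0 < approx_sq beta k.
Proof. by case=> b0 _ _ _; rewrite /approx_sq invr_gt0 exprn_gt0. Qed.

Lemma approx_sq_nonincreasing beta (k l : nat) : weight_sequence beta ->
  (k <= l)%N -> approx_sq beta l <= approx_sq beta k.
Proof.
case=> b0 _ _ bm kl; rewrite /approx_sq lef_pV2 ?posrE ?exprn_gt0//.
by rewrite lerXn2r ?nnegrE ?bm// ltW.
Qed.

(** At the minimizer k the variance term at k is at most the tradeoff at k - 1, whose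
    own variance term is smaller; so the tradeoff at k - 1 must be the bias term. *)
Lemma argmin_approx_ge beta n k : weight_sequence beta -> (0 < n)%N -> (1 < k)%N ->
  is_argmin_tradeoff beta n k -> dim_ratio R n k <= approx_sq beta k.-1.
Proof.
move=> wb n0 k1 [_ /(_ k.-1)]; rewrite -subn1 subn_gt0 => /(_ k1).
have : dim_ratio R n k <= tradeoff beta n k by rewrite le_max lexx orbT.
move=> /le_trans h /h; rewrite le_max => /orP[//|].
by rewrite /dim_ratio ler_pM2r ?invr_gt0 ?ltr0n// ler_nat; lia.
Qed.

Lemma partial_sum_le_esum (g : int -> R) m : (forall j, 0 <= g j) ->
  ((\sum_(0 <= i < m) g i%:Z)%:E <= \esum_(j in [set: int]) (g j)%:E)%E.
Proof.
move=> g0; apply: (@le_trans _ _ (\esum_(j in range Posz) (g j)%:E)); last first.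
  by rewrite esum_mkcond; apply: le_esum => j _; case: ifP; rewrite ?lee_fin.
rewrite (@reindex_esum _ _ _ [set: nat] _ Posz); last first.
  by split => //; move=> i j _ _ [].
rewrite (_ : [set: nat] = [set i | xpredT i]); last by apply/seteqP; split.
rewrite -nneseries_esum; last by move=> i _; rewrite lee_fin.
by rewrite -sumEFin; apply: nneseries_lim_ge => i _ _; rewrite lee_fin.
Qed.

(** A nonincreasing summable sequence is O(1 / k): the k - J >= k / 2 terms between J
    and k, all at least the k-th one, sum to less than 1 once J is large. *)
Lemma approx_sq_decay beta : weight_sequence beta ->
  (\esum_(j in [set: int]) ((beta j) ^- 2)%:E < +oo)%E ->
  exists J : nat, forall k, (J.*2 <= k)%N -> k%:R * approx_sq beta k <= 2.
Proof.
move=> wb fin; have [b0 _ _ _] := wb.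
have g0 j : 0 <= (beta j) ^- 2 by rewrite invr_ge0 sqr_ge0.
pose S m := \sum_(0 <= i < m) approx_sq beta i.
have hS : has_sup (range S).
  split; first by exists (S 0%N), 0%N.
  exists (fine (\esum_(j in [set: int]) ((beta j) ^- 2)%:E)) => _ [m _ <-].
  rewrite -lee_fin fineK; first exact: partial_sum_le_esum.
  by rewrite ge0_fin_numE// esum_ge0// => j _; rewrite lee_fin.
have [_ [J _ <-] SJ] := sup_adherent ltr01 hS.
exists J => k Jk.
have Jk' : (J <= k)%N by apply: leq_trans Jk; rewrite -addnn leq_addr.
have : S k <= sup (range S) by apply: (ub_le_sup hS.2); exists k.
rewrite /S (big_cat_nat _ Jk')//= -/(S J) => Sk.
have : \sum_(J <= i < k) approx_sq beta k <= \sum_(J <= i < k) approx_sq beta i.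
  by apply: ler_sum_nat => i /andP[_ /ltnW]; exact: approx_sq_nonincreasing.
rewrite sumr_const_nat -[X in X <= _]mulr_natl natrB// => h.
have Jk2 : 2 * J%:R <= k%:R :> R by rewrite -natrM ler_nat mul2n.
have kJA : (k%:R - J%:R) * approx_sq beta k < 1 by apply: le_lt_trans h _; lra.
have : 0 <= (k%:R - 2 * J%:R) * approx_sq beta k.
  by rewrite mulr_ge0 ?subr_ge0// ltW// approx_sq_gt0.
lra.
Qed.

(** Each k <= J has tradeoff at least beta_J^-2, while a fixed l with
    beta_l^-2 < beta_J^-2 has a smaller tradeoff once n is large. *)
Lemma argmin_tends_to_oo beta (J : nat) : weight_sequence beta ->
  (\esum_(j in [set: int]) ((beta j) ^- 2)%:E < +oo)%E ->
  exists N : nat, forall n k, (0 < n)%N -> (N <= n)%N -> is_argmin_tradeoff beta n k -> (J < k)%N.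
Proof.
move=> wb fin; have [I decay] := approx_sq_decay wb fin.
have a0 := approx_sq_gt0 J wb.
have bnd (x : R) : x < (Num.bound `|x|)%:R.
  by apply: le_lt_trans (archi_boundP (normr_ge0 x)); exact: ler_norm.
pose l := maxn I.*2.+1 (Num.bound `|2 / approx_sq beta J|).
have l0 : (0 < l)%N by rewrite leq_max.
have al : approx_sq beta l < approx_sq beta J.
  have hl : 2 / approx_sq beta J < l%:R.
    by apply: lt_le_trans (bnd _) _; rewrite ler_nat leq_maxr.
  have := decay l (leq_trans (leqnSn _) (leq_maxl _ _)).
  rewrite mulrC -ler_pdivlMr ?ltr0n// => /le_lt_trans; apply.
  by rewrite ltr_pdivrMr ?ltr0n// mulrC -ltr_pdivrMr.
exists (Num.bound `|(2 * l + 1)%:R / approx_sq beta J|) => n k n0 Nn [k0 /(_ _ l0)].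
rewrite ltnNge; apply: contraTN => kJ; rewrite -ltNge.
apply: (@lt_le_trans _ _ (approx_sq beta J)); last first.
  by rewrite le_max approx_sq_nonincreasing.
rewrite gt_max al /= /dim_ratio ltr_pdivrMr ?ltr0n// mulrC -ltr_pdivrMr//.
by apply: lt_le_trans (bnd _) _; rewrite ler_nat.
Qed.

End tradeoff.

Theorem theorem3p7 (R : realType) :
  (forall L : R, 0 < L ->
   exists C : R, 0 < C /\
   forall (beta : int -> R) (kstar : nat -> nat) (eta alpha mu : R),
     weight_sequence beta ->
     (\esum_(j in [set: int]) ((beta j) ^- 2)%:E < +oo)%E ->
     (forall n, (0 < n)%N -> is_argmin_tradeoff beta n (kstar n)) ->
     0 < eta ->
     (forall n, (0 < n)%N ->
        eta^-1 <= (tradeoff beta n (kstar n))^-1 *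
          Num.min (approx_sq beta (kstar n)) (dim_ratio R n (kstar n))) ->
     0 < alpha ->
   exists N : nat, forall n, (0 < n)%N -> (N <= n)%N ->
   forall (dO dZ : measure_display)
     (Om : measurableType dO) (ZT : measurableType dZ)
     (Q : channel R ZT n) (P : (R -> R) -> probability Om R)
     (X : int -> {mfun Om >-> R}) (Z : 'I_n -> {mfun Om >-> ZT}),
     locally_private alpha Q ->
     private_experiment (spectral_class beta L) mu Q P X Z ->
     ((dim_ratio R n (kstar n))%:E
        <= C%:E * minimax_risk (spectral_class beta L) P Z)%E)
  /\
  (exists C : R, 0 < C /\
   forall (L : R) (beta : int -> R) (alpha mu : R),
     0 < L -> weight_sequence beta -> 0 < alpha ->
   exists N : nat, forall n, (0 < n)%N -> (N <= n)%N ->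
   forall (dO dZ : measure_display)
     (Om : measurableType dO) (ZT : measurableType dZ)
     (Q : channel R ZT n) (P : (R -> R) -> probability Om R)
     (X : int -> {mfun Om >-> R}) (Z : 'I_n -> {mfun Om >-> ZT}),
     locally_private alpha Q ->
     private_experiment (spectral_class beta L) mu Q P X Z ->
     ((Num.min (pi / (n%:R * (expR alpha - 1) ^+ 2)) (L ^+ 2 / 4))%:E
        <= C%:E * minimax_risk (spectral_class beta L) P Z)%E).
Proof.
have bnd (x : R) : x < (Num.bound `|x|)%:R.
  by apply: le_lt_trans (archi_boundP (normr_ge0 x)); exact: ler_norm.
split.
  move=> L L0; pose C : R := 5 * 1536 / L ^+ 2.
  have C0 : 0 < C by apply: divr_gt0; [apply: mulr_gt0; rewrite ltr0n|exact: exprn_gt0].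
  (* The cube has dimension K = kstar n - 1, and 2 K + 3 <= 5 K. *)
  exists C; split => //.
  move=> beta kstar eta alpha mu wb fin argmin _ _ _.
  have [J decay] := approx_sq_decay wb fin.
  have [N kN] := argmin_tends_to_oo (J.*2).+1 wb fin.
  exists N => n n0 Nn dO dZ Om ZT Q P X Z _ PE.
  have am := argmin n n0; have k1 := kN n _ n0 Nn am.
  have [b0 _ b00 bm] := wb.
  have := argmin_approx_ge wb n0 (leq_ltn_trans (ltn0Sn _) k1) am.
  move: k1; case: (kstar n) => // K /[!ltnS] JK /= dimK.
  have K0 : (0 < K)%N by apply: leq_trans JK.
  have n0r : 0 < n%:R :> R by rewrite ltr0n.
  have dimE : (2 * K.+1 + 1)%:R = 2 * K%:R + 3 :> R.
    by rewrite natrD natrM -natr1; lra.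
  have A0 := approx_sq_gt0 K wb.
  have A1 : approx_sq beta K <= 1.
    have := approx_sq_nonincreasing wb (leq0n K).
    by rewrite [X in _ <= X]/approx_sq b00 expr1n invr1.
  have Ab : approx_sq beta K * beta K%:Z ^+ 2 = 1.
    by rewrite /approx_sq mulVf// gt_eqF// exprn_gt0.
  (* With A = beta_K^-2, the three facts (2 K + 3) / n <= A, A <= 1 and K A <= 2
     give K <= n, K beta_K^2 <= n and K^2 <= n. *)
  have KA := decay K (ltnW JK).
  move: dimK; rewrite /dim_ratio ler_pdivrMr// dimE => dimK.
  have K0r : 1 <= K%:R :> R by rewrite ler1n.
  have lower := minimax_lower_bound (n := n) L0 wb K0 _ _ _ PE.
  have {}lower : ((L ^+ 2 * K%:R / (1536 * n%:R))%:E <= minimax_risk (spectral_class beta L) P Z)%E.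
    apply: lower.
    - rewrite -(ler_nat R); nra.
    - rewrite -(ler_nat R) natrX natrM.
      have : K%:R * (2 * K%:R + 3) <= 2 * n%:R :> R.
        apply: le_trans (_ : K%:R * (approx_sq beta K * n%:R) <= _); first by rewrite ler_pM2l// ltr0n.
        by rewrite mulrA ler_pM2r.
      by nra.
    - have : (2 * K%:R + 3) * beta K%:Z ^+ 2 <= n%:R.
        apply: le_trans (_ : approx_sq beta K * n%:R * beta K%:Z ^+ 2 <= _).
          by rewrite ler_pM2r// exprn_gt0.
        by rewrite mulrAC Ab mul1r.
      by have := sqr_ge0 (beta K%:Z); nra.
  have {}C0 : (0 <= C%:E :> \bar R)%E by rewrite lee_fin ltW.
  apply: le_trans (lee_wpmul2l C0 lower).
  rewrite -EFinM lee_fin.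
  have -> : C * (L ^+ 2 * K%:R / (1536 * n%:R)) = 5 * K%:R / n%:R.
    by rewrite /C; field; rewrite !gt_eqF.
  by rewrite ler_pM2r ?invr_gt0//; lra.
exists 1; split => // L beta alpha mu L0 wb alpha0.
(* A cube of fixed dimension K suffices, since the bound to be beaten is a
   multiple of 1 / n. *)
pose K := (Num.bound `|pi / (expR alpha - 1) ^+ 2 * 1536 / L ^+ 2|).+1.
exists (maxn K (maxn (K ^ 2) (Num.bound `|K%:R * beta K%:Z ^+ 2|))) => n n0 Nn.
move=> dO dZ Om ZT Q P X Z _ PE.
move: Nn; rewrite !geq_max => /and3P[Kn K2n bn].
have nr0 : 0 < n%:R :> R by rewrite ltr0n.
rewrite mul1e; apply: le_trans (minimax_lower_bound L0 wb (ltn0Sn _ : 0 < K)%N Kn _ _ PE).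
- rewrite lee_fin ge_min; apply/orP; left.
  have hK : pi / (expR alpha - 1) ^+ 2 * 1536 / L ^+ 2 <= K%:R.
    by apply: ltW; apply: lt_le_trans (bnd _) _; rewrite ler_nat.
  move: hK; rewrite (invfM n%:R); move: (pi : R) ((expR alpha - 1) ^- 2) => p v hK.
  have -> : p * (n%:R^-1 * v) = p * v * 1536 / L ^+ 2 * (L ^+ 2 / (1536 * n%:R)).
    by field; rewrite !gt_eqF.
  have -> : L ^+ 2 * K%:R / (1536 * n%:R) = K%:R * (L ^+ 2 / (1536 * n%:R)) by ring.
  apply: ler_wpM2r hK; apply: divr_ge0 (sqr_ge0 _) _.
  by apply: mulr_ge0; [rewrite ler0n|exact: ltW].
- by apply: leq_trans K2n _; rewrite leq_pmull.
- by apply: le_trans (ltW (bnd _)) _; rewrite ler_nat.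
Qed.
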